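(* Let $M\ge 2$ be an integer and let $\eta_1,\eta_2,\ldots$ be independent random variables, each uniformly distributed on $\{1,2,\ldots,M\}$. Let $\tau^{(M)}$ be the first index $r\ge 1$ such that $\eta_1+\cdots+\eta_r$ is a prime number. Then, as $M\to+\infty$, $$\mathbf{E}(\tau^{(M)})=\log M+O(\log\log M).$$
   Context: Here $\mathbf{E}(\tau^{(M)})$ is defined as $\sum_{r\ge 1} r\,\Pr(\tau^{(M)}=r)$, where $\Pr(\tau^{(M)}=r)=M^{-r}\cdot\#\{(\eta_1,\ldots,\eta_r)\in\{1,\ldots,M\}^r:\ \sum_{i=1}^{\ell}\eta_i\notin\mathbb{P}\text{ for all }1\le\ell<r,\ \sum_{i=1}^r\eta_i\in\mathbb{P}\}$ and $\mathbb{P}$ is the set of primes. $\log$ is the natural logarithm. $f(M)=O(g(M))$ means $|f(M)|\le Cg(M)$ for an absolute constant $C$ (for all sufficiently large $M$). *)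

(* Defs.v *)
From HB Require Import structures.
From mathcomp Require Import all_boot all_order all_algebra.
From mathcomp Require Import all_classical all_reals all_analysis.
Set Implicit Arguments.
Unset Strict Implicit.
Unset Printing Implicit Defensive.
Import Order.TTheory GRing.Theory Num.Theory.
Local Open Scope ring_scope.

(* eta_1 + ... + eta_l.  Outcomes of (eta_1, ..., eta_r) in {1, ..., M}^r are
   coded as functions 'I_r -> 'I_M: the value of eta_(i+1) is (eta i).+1. *)
Definition partial_sum (M r : nat) (eta : {ffun 'I_r -> 'I_M}) (l : nat) : nat :=
  (\sum_(i < r | (i < l)%N) (eta i).+1)%N.

Definition first_prime_at (M r : nat) : {set {ffun 'I_r -> 'I_M}} :=
  [set eta : {ffun 'I_r -> 'I_M} |
     [forall l : 'I_r, (1 <= l)%N ==> ~~ prime (partial_sum eta l)]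
     && prime (partial_sum eta r)].

Definition pr_tau_eq (R : realType) (M r : nat) : R :=
  #|first_prime_at M r|%:R / M%:R ^+ r.

(* Extended-real valued, so that a divergent series gives +oo. *)
Definition expected_tau (R : realType) (M : nat) : \bar R :=
  (\sum_(1 <= r <oo) (r%:R * pr_tau_eq R M r)%:E)%E.

(* Main.v *)
Require Import Defs.
From HB Require Import structures.
From mathcomp Require Import all_boot all_order all_algebra.
From mathcomp Require Import all_classical all_reals all_analysis.
From mathcomp Require Import complex ring lra zify.
Set Implicit Arguments.
Unset Strict Implicit.
Unset Printing Implicit Defensive.
Import Order.TTheory GRing.Theory Num.Theory.
Import numFieldNormedType.Exports.
Local Open Scope ring_scope.
Local Open Scope complex_scope.

(* The probability of surviving [n] steps without meeting a prime satisfies a one-step recursion.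
   If each of the intervals [(x, x + M]] below [M (log M)^2] contains [M / (log M + O(log log M))]
   primes, then survival is geometric with ratio [1 - 1 / (log M + O(log log M))] up to that height,
   and the sum of the survival probabilities is [log M + O(log log M)]; beyond it, survival past
   height [Y] has probability at most [(1 - 1 / M) ^ pi(Y)], which makes the tail negligible.

   The primes in short intervals come from [psi(x) = x + O(x / (log x)^3)].  For this, the fourth
   derivative of [zeta' / zeta + zeta] is bounded by a power of [log |t|] in [Re s > 1] up to the
   line [Re s = 1], from the 3-4-1 inequality and the recurrence obtained by differentiating
   [- zeta' = (- zeta' / zeta) zeta].  Summing over a window in [log n] expanded in a truncated
   sawtooth Fourier series bounds the partial sums of [(Lambda(n) - 1) (log n)^4 n^(-s)] on
   [s = 1 + 1 / log x] without contour integration, and Abel summation removes the weights. *)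

(** * Moduli of complex numbers and points of the unit circle *)

Section ComplexModulus.
Context (R : realType).
Implicit Types (x y : R) (z w : R[i]).

(** With L the logarithm of the height, the Dirichlet series are read at distance 1 / L from the
    line Re s = 1, where n^(-1/L) >= 1/e for all n <= e^L. The frequencies j / L^2 of the window are
    at most a power of L, so a power of log |t| becomes a power of log L, far below L; hence no
    exponent in the zeta estimates needs care. The fourth derivative is dictated by the final
    precision: the sums with weight (log n)^4 are O(L), so removing the weight leaves x / L^3. At
    heights up to a multiple of M (log M)^2 this is O(M / log M), a relative error that moves the
    parameter log M of the geometric law by a bounded amount only. The terms log log M have another
    source: log p lies within O(log log M) of log M for all primes that matter, those between M /
    (log M)^2 and a multiple of M (log M)^2. Subtracting the coefficients of zeta, so that Lambda(n)
    becomes Lambda(n) - 1, removes the pole at s = 1, so one bound serves at all frequencies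
    including 0. *)

Definition cmod z : R := Num.sqrt (complex.Re z ^+ 2 + complex.Im z ^+ 2).
Definition cis x : R[i] := cos x +i* sin x.

Lemma cmodE z : cmod z = Normc.normc z.
Proof. by case: z. Qed.

Lemma cmod_ge0 z : 0 <= cmod z. Proof. exact: sqrtr_ge0. Qed.

Lemma cmodM z w : cmod (z * w) = cmod z * cmod w.
Proof. by rewrite !cmodE Normc.normcM. Qed.

Lemma cmodV z : cmod z^-1 = (cmod z)^-1.
Proof. by rewrite !cmodE Normc.normcV. Qed.

Lemma cmodD z w : cmod (z + w) <= cmod z + cmod w.
Proof. by rewrite !cmodE le_normcD. Qed.

Lemma cmodN z : cmod (- z) = cmod z.
Proof. by rewrite !cmodE normcN. Qed.

Lemma cmod_real x : cmod x%:C = `|x|.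
Proof. by rewrite /cmod /= expr0n addr0 sqrtr_sqr. Qed.

Lemma cmod0 : cmod 0 = 0.
Proof. by rewrite -[0]/(0%:C) cmod_real normr0. Qed.

Lemma cmod1 : cmod 1 = 1.
Proof. by rewrite -[1]/(1%:C) cmod_real normr1. Qed.

Lemma cmod_eq0 z : cmod z = 0 -> z = 0.
Proof. by rewrite cmodE; apply: Normc.eq0_normc. Qed.

Lemma cmod_gt0 z : z != 0 -> 0 < cmod z.
Proof.
move=> z0; rewrite lt_neqAle cmod_ge0 andbT eq_sym.
by apply: contra z0 => /eqP /cmod_eq0 ->.
Qed.

Lemma cmodBC z w : cmod (z - w) = cmod (w - z).
Proof. by rewrite -cmodN opprB. Qed.

Lemma cmodB z w : cmod (z - w) <= cmod z + cmod w.
Proof. by rewrite (le_trans (cmodD _ _)) // cmodN. Qed.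

Lemma cmodB_ge z w : cmod z - cmod w <= cmod (z - w).
Proof. by rewrite lerBlDr; have := cmodD (z - w) w; rewrite subrK. Qed.

Lemma cmod_sum (I : Type) (r : seq I) (P : pred I) (F : I -> R[i]) :
  cmod (\sum_(i <- r | P i) F i) <= \sum_(i <- r | P i) cmod (F i).
Proof.
elim/big_ind2: _ => [|z1 x1 z2 x2 h1 h2|//]; first by rewrite cmod0.
by rewrite (le_trans (cmodD _ _)) // lerD.
Qed.

Lemma sqr_cmod z : cmod z ^+ 2 = complex.Re z ^+ 2 + complex.Im z ^+ 2.
Proof. by rewrite /cmod sqr_sqrtr // addr_ge0 // sqr_ge0. Qed.

Lemma Re_le_cmod z : `|complex.Re z| <= cmod z.
Proof.
rewrite -(ler_pXn2r (n := 2)) // ?nnegrE ?cmod_ge0 //.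
by rewrite sqr_cmod real_normK ?num_real // lerDl sqr_ge0.
Qed.

Lemma Im_le_cmod z : `|complex.Im z| <= cmod z.
Proof.
rewrite -(ler_pXn2r (n := 2)) // ?nnegrE ?cmod_ge0 //.
by rewrite sqr_cmod real_normK ?num_real // lerDr sqr_ge0.
Qed.

Lemma cmod_le_ReIm z : cmod z <= `|complex.Re z| + `|complex.Im z|.
Proof.
rewrite -(ler_pXn2r (n := 2)) // ?nnegrE ?cmod_ge0 ?addr_ge0 //.
rewrite sqr_cmod sqrrD !real_normK ?num_real //.
by rewrite addrAC lerDl mulrn_wge0 // mulr_ge0.
Qed.

Lemma cisD x y : cis (x + y) = cis x * cis y.
Proof.
by apply/eqP; rewrite eq_complex; apply/andP; split; apply/eqP; rewrite /= ?cosD ?sinD //; ring.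
Qed.

Lemma cmod_cis x : cmod (cis x) = 1.
Proof. by rewrite /cmod /= cos2Dsin2 sqrtr1. Qed.

Lemma cis0 : cis 0 = 1.
Proof. by rewrite /cis cos0 sin0. Qed.

Lemma ReD z w : complex.Re (z + w) = complex.Re z + complex.Re w.
Proof. by case: z; case: w. Qed.

Lemma ImD z w : complex.Im (z + w) = complex.Im z + complex.Im w.
Proof. by case: z; case: w. Qed.

Lemma ReN z : complex.Re (- z) = - complex.Re z.
Proof. by case: z. Qed.

Lemma ImN z : complex.Im (- z) = - complex.Im z.
Proof. by case: z. Qed.

Lemma Re_sum (I : Type) (r : seq I) (P : pred I) (F : I -> R[i]) :
  complex.Re (\sum_(i <- r | P i) F i) = \sum_(i <- r | P i) complex.Re (F i).
Proof. by elim/big_ind2: _ => [//|z1 x1 z2 x2 <- <-|//]; rewrite ReD. Qed.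

Lemma Im_sum (I : Type) (r : seq I) (P : pred I) (F : I -> R[i]) :
  complex.Im (\sum_(i <- r | P i) F i) = \sum_(i <- r | P i) complex.Im (F i).
Proof. by elim/big_ind2: _ => [//|z1 x1 z2 x2 <- <-|//]; rewrite ImD. Qed.

Lemma ReZ x z : complex.Re (x%:C * z) = x * complex.Re z.
Proof. by case: z => a b /=; rewrite mul0r subr0. Qed.

Lemma ImZ x z : complex.Im (x%:C * z) = x * complex.Im z.
Proof. by case: z => a b /=; rewrite mul0r addr0. Qed.

End ComplexModulus.

(** * Absolutely convergent complex series *)

Section AbsolutelyConvergentSums.
Context (R : realType).
Implicit Types (f g : nat -> R[i]) (l : R[i]) (B e : R).

Definition sums_to f l :=
  forall e, 0 < e -> exists N, forall n, (N <= n)%N ->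
    cmod (\sum_(0 <= i < n) f i - l) <= e.

Definition abs_bound f B := forall n, \sum_(0 <= i < n) cmod (f i) <= B.

Definition abs_summable f := exists B, abs_bound f B.

Definition csum f : R[i] := xget 0 [set l | sums_to f l]%classic.

Lemma sums_to_unique f l1 l2 : sums_to f l1 -> sums_to f l2 -> l1 = l2.
Proof.
move=> h1 h2; apply/eqP; rewrite -subr_eq0; apply/eqP/cmod_eq0/eqP.
rewrite eq_le cmod_ge0 andbT; apply/ler_addgt0Pl => e e0; rewrite addr0.
have e2 : 0 < e / 2 by lra.
have [N1 H1] := h1 _ e2; have [N2 H2] := h2 _ e2.
have a := H1 (maxn N1 N2) (leq_maxl _ _).
have b := H2 (maxn N1 N2) (leq_maxr _ _).
set s := \sum_(0 <= i < _) _ in a b.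
have -> : l1 - l2 = (s - l2) - (s - l1) by ring.
by rewrite (le_trans (cmodB _ _)) //; lra.
Qed.

Lemma csum_eq f l : sums_to f l -> csum f = l.
Proof.
move=> h; apply: (sums_to_unique (f := f)) => //.
by rewrite /csum; case: xgetP => [? _ //|/(_ l)]; contradiction.
Qed.

Lemma real_series_cvg (u : nat -> R) B :
  (forall n, 0 <= u n) -> (forall n, \sum_(0 <= i < n) u i <= B) ->
  exists s, forall e, 0 < e -> exists N, forall n, (N <= n)%N ->
    s - e <= \sum_(0 <= i < n) u i <= s.
Proof.
move=> u0 uB; set S := range (fun n => \sum_(0 <= i < n) u i).
have mono n m : (n <= m)%N -> \sum_(0 <= i < n) u i <= \sum_(0 <= i < m) u i.
  move=> nm; rewrite (big_cat_nat (leq0n _) nm) //= lerDl.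
  by apply: sumr_ge0 => i _.
have hS : has_sup S.
  split; first by exists (\sum_(0 <= i < 0) u i), 0%N.
  by exists B => _ [n _ <-].
exists (sup S) => e e0.
have [_ [N _ <-] hN] := sup_adherent e0 hS.
exists N => n Nn; apply/andP; split.
  by rewrite (le_trans (ltW hN)) // mono.
by apply: (ub_le_sup (proj2 hS)); exists n.
Qed.

Lemma abs_summable_tail f : abs_summable f ->
  forall e, 0 < e -> exists N, forall n m, (N <= n)%N ->
    \sum_(n <= i < m) cmod (f i) <= e.
Proof.
move=> [B fB] e e0.
have [s hs] := real_series_cvg (fun n => cmod_ge0 (f n)) fB.
have [N hN] := hs e e0; exists N => n m Nn.
have [mn|/ltnW nm] := leqP m n; first by rewrite big_geq // ltW.
have /andP[a _] := hN n Nn.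
have /andP[_ b] := hN m (leq_trans Nn nm).
move: b; rewrite (big_cat_nat (leq0n _) nm) //=; lra.
Qed.

(** Writing [u] as [(u + v) - v] gives a difference of two bounded series with nonnegative terms. *)
Lemma real_abs_series_cvg (u v : nat -> R) B :
  (forall n, `|u n| <= v n) -> (forall n, \sum_(0 <= i < n) v i <= B) ->
  exists s, forall e, 0 < e -> exists N, forall n, (N <= n)%N ->
    `|\sum_(0 <= i < n) u i - s| <= e.
Proof.
move=> uv vB.
have v0 n : 0 <= v n by rewrite (le_trans _ (uv n)).
have [s hs] := real_series_cvg v0 vB.
have uv0 n : 0 <= u n + v n by have := uv n; rewrite ler_norml => /andP[]; lra.
have uvB n : \sum_(0 <= i < n) (u i + v i) <= B + B.
  rewrite big_split /= lerD //.
  by rewrite (le_trans _ (vB n)) //; apply: ler_sum => i _; rewrite (le_trans (ler_norm _)).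
have [t ht] := real_series_cvg uv0 uvB.
exists (t - s) => e e0.
have [N1 h1] := hs e e0; have [N2 h2] := ht e e0.
exists (maxn N1 N2) => n; rewrite geq_max => /andP[n1 n2].
have := h2 n n2; rewrite big_split /= => /andP[a b].
have /andP[c d] := h1 n n1.
by rewrite ler_norml; apply/andP; split; lra.
Qed.

Lemma csumP f : abs_summable f -> sums_to f (csum f).
Proof.
move=> [B fB]; suff [l hl] : exists l, sums_to f l by rewrite (csum_eq hl).
have [a ha] := real_abs_series_cvg (fun n => Re_le_cmod (f n)) fB.
have [b hb] := real_abs_series_cvg (fun n => Im_le_cmod (f n)) fB.
exists (a +i* b) => e e0; have e2 : 0 < e / 2 by lra.
have [N1 h1] := ha _ e2; have [N2 h2] := hb _ e2.
exists (maxn N1 N2) => n; rewrite geq_max => /andP[n1 n2].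
apply: (le_trans (cmod_le_ReIm _)).
rewrite ReD ImD ReN ImN Re_sum Im_sum /=.
by have := h1 n n1; have := h2 n n2; lra.
Qed.

Lemma abs_summable_bound f B : abs_bound f B -> abs_summable f.
Proof. by exists B. Qed.

Lemma abs_bound_ge0 f B : abs_bound f B -> 0 <= B.
Proof. by move=> /(_ 0%N); rewrite big_geq. Qed.

Lemma sums_to_le f l B N : sums_to f l ->
  (forall n, (N <= n)%N -> cmod (\sum_(0 <= i < n) f i) <= B) -> cmod l <= B.
Proof.
move=> h hB; apply/ler_addgt0Pl => e e0.
have [N1 h1] := h e e0; have := h1 (maxn N N1) (leq_maxr _ _).
have := hB (maxn N N1) (leq_maxl _ _).
set s := \sum_(_ <= _ < _) _ => sB; rewrite cmodBC => a.
have -> : l = (l - s) + s by rewrite subrK.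
by rewrite (le_trans (cmodD _ _)) // lerD.
Qed.

Lemma csum_le f B : abs_bound f B -> cmod (csum f) <= B.
Proof.
move=> fB; apply: (sums_to_le (N := 0) (csumP (abs_summable_bound fB))) => n _.
by rewrite (le_trans (cmod_sum _ _ _)).
Qed.

Lemma sums_toD f g l1 l2 : sums_to f l1 -> sums_to g l2 ->
  sums_to (fun n => f n + g n) (l1 + l2).
Proof.
move=> h1 h2 e e0; have e2 : 0 < e / 2 by lra.
have [N1 H1] := h1 _ e2; have [N2 H2] := h2 _ e2.
exists (maxn N1 N2) => n; rewrite geq_max => /andP[n1 n2].
rewrite big_split /= opprD addrACA (le_trans (cmodD _ _)) //.
by have := H1 n n1; have := H2 n n2; lra.
Qed.

Lemma sums_toZ c f l : sums_to f l -> sums_to (fun n => c * f n) (c * l).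
Proof.
move=> h e e0.
have c0 : 0 < 1 + cmod c by have := cmod_ge0 c; lra.
have [N hN] := h (e / (1 + cmod c)) (divr_gt0 e0 c0).
exists N => n Nn; rewrite -mulr_sumr -mulrBr cmodM.
apply: (@le_trans _ _ ((1 + cmod c) * (e / (1 + cmod c)))).
  by rewrite ler_pM ?cmod_ge0 ?hN //; lra.
by rewrite mulrC divfK // gt_eqF.
Qed.

Lemma abs_summableD f g : abs_summable f -> abs_summable g ->
  abs_summable (fun n => f n + g n).
Proof.
move=> [B fB] [C gC]; exists (B + C) => n.
rewrite (le_trans (y := \sum_(0 <= i < n) (cmod (f i) + cmod (g i)))) //.
  by apply: ler_sum => i _; exact: cmodD.
by rewrite big_split lerD.
Qed.

Lemma abs_summableZ c f : abs_summable f -> abs_summable (fun n => c * f n).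
Proof.
move=> [B fB]; exists (cmod c * B) => n.
under eq_bigr do rewrite cmodM.
by rewrite -mulr_sumr ler_wpM2l ?cmod_ge0.
Qed.

Lemma abs_summable_le f (u : nat -> R) B :
  (forall n, cmod (f n) <= u n) -> (forall n, \sum_(0 <= i < n) u i <= B) ->
  abs_bound f B.
Proof. by move=> fu uB n; rewrite (le_trans _ (uB n)) //; apply: ler_sum. Qed.

Lemma csumD f g : abs_summable f -> abs_summable g ->
  csum (fun n => f n + g n) = csum f + csum g.
Proof. by move=> /csumP h1 /csumP h2; apply/csum_eq/sums_toD. Qed.

Lemma csumZ c f : abs_summable f -> csum (fun n => c * f n) = c * csum f.
Proof. by move=> /csumP h1; apply/csum_eq/sums_toZ. Qed.

Lemma csumB f g : abs_summable f -> abs_summable g ->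
  csum (fun n => f n - g n) = csum f - csum g.
Proof.
move=> hf hg; have h : csum (fun n => -1 * g n) = - csum g by rewrite csumZ // mulN1r.
rewrite -h -csumD //; first by congr csum; apply/funext => n; rewrite mulN1r.
exact: abs_summableZ.
Qed.

Lemma abs_summableB f g : abs_summable f -> abs_summable g ->
  abs_summable (fun n => f n - g n).
Proof.
move=> hf /(abs_summableZ (-1)) hg.
have := abs_summableD hf hg; congr abs_summable.
by apply/funext => n; rewrite mulN1r.
Qed.

Lemma csum_sum (I : Type) (r : seq I) (F : I -> nat -> R[i]) :
  (forall i, abs_summable (F i)) ->
  abs_summable (fun n => \sum_(i <- r) F i n) /\
  csum (fun n => \sum_(i <- r) F i n) = \sum_(i <- r) csum (F i).
Proof.
move=> hF; elim: r => [|i r [IH1 IH2]].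
  have -> : (fun n => \sum_(i <- [::]) F i n) = (fun=> 0).
    by apply/funext => n; rewrite big_nil.
  split; first by exists 0 => n; rewrite big1 // => j _; rewrite cmod0.
  rewrite big_nil; apply: csum_eq => e e0; exists 0%N => n _.
  by rewrite big1 // subr0 cmod0 ltW.
have -> : (fun n => \sum_(j <- i :: r) F j n) = (fun n => F i n + \sum_(j <- r) F j n).
  by apply/funext => n; rewrite big_cons.
split; first exact: abs_summableD.
by rewrite big_cons csumD // IH2.
Qed.

Lemma csum_split f N : abs_summable f ->
  csum f = \sum_(0 <= i < N) f i + csum (fun n => if (n < N)%N then 0 else f n).
Proof.
move=> hf; set g : nat -> R[i] := fun n => if (n < N)%N then 0 else f n; rewrite -/g.
have [B fB] := hf.
have hg : abs_summable g.
  exists B; apply: (abs_summable_le _ fB) => n; rewrite /g.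
  by case: ifP => _ //; rewrite cmod0 cmod_ge0.
suff : sums_to f (\sum_(0 <= i < N) f i + csum g) by move/csum_eq.
move=> e e0; have [M hM] := csumP hg e0.
exists (maxn N M) => n; rewrite geq_max => /andP[n1 n2].
have -> : \sum_(0 <= i < n) f i = \sum_(0 <= i < N) f i + \sum_(0 <= i < n) g i.
  rewrite !(big_cat_nat (leq0n _) n1) /=; congr (_ + _).
  rewrite [X in _ = X + _]big_nat [X in _ = X + _]big1; last first.
    by move=> i /andP[_ iN]; rewrite /g iN.
  rewrite add0r; apply: eq_big_nat => i /andP[iN _].
  by rewrite /g ltnNge iN.
by rewrite opprD addrACA subrr add0r hM.
Qed.

End AbsolutelyConvergentSums.

(** * Dirichlet convolution and products of series *)

Section DirichletConvolution.
Context (R : realType).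
Implicit Types (f g : nat -> R[i]).

(** The index d = 0 divides only 0, so it contributes a single term, [f 0 * g 0] at n = 0; the
    lemmas below assume that both factors vanish there. *)
Definition dconv f g n := \sum_(0 <= d < n.+1 | (d %| n)%N) f d * g (n %/ d)%N.

Lemma dconvE f g X n : f 0%N = 0 -> g 0%N = 0 -> (n < X)%N ->
  dconv f g n = \sum_(0 <= d < X) \sum_(0 <= m < X | (d * m == n)%N) f d * g m.
Proof.
move=> f0 g0 nX; rewrite /dconv [RHS](big_cat_nat (n := n.+1)) //=.
rewrite [X in _ = _ + X]big_nat [X in _ = _ + X]big1 => [|d /andP[dn _]]; last first.
  apply: big1 => m /eqP dm; case: n dm nX dn => [|n] dm nX dn; last first.
    by case: m dm => [|m]; [rewrite muln0|rewrite mulnS; lia].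
  by move/eqP: dm; rewrite muln_eq0 => /orP[|] /eqP ->; rewrite ?f0 ?g0 ?mul0r ?mulr0.
rewrite addr0 big_mkcond; apply: eq_bigr => d _.
case: ifP => dn; last first.
  rewrite big1 // => m /eqP dm; move: dn; rewrite -dm dvdn_mulr //.
case: (posnP d) => [->|d0].
  by rewrite f0 mul0r big1 // => m _; rewrite mul0r.
rewrite (eq_bigl (fun m => m == n %/ d)%N) => [|m]; last first.
  by apply/eqP/eqP => [<-|->]; [rewrite mulKn|rewrite mulnC divnK].
by rewrite big_nat1_eq /= (leq_ltn_trans (leq_div _ _)).
Qed.

Lemma dconv_partial f g X : f 0%N = 0 -> g 0%N = 0 ->
  \sum_(0 <= n < X) dconv f g n =
  \sum_(0 <= d < X) \sum_(0 <= m < X | (d * m < X)%N) f d * g m.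
Proof.
move=> f0 g0; rewrite big_nat.
under eq_bigr => n /andP[_ nX] do rewrite (dconvE f0 g0 nX).
rewrite -big_nat exchange_big /=; apply: eq_bigr => d _.
rewrite (exchange_big_dep xpredT) //= [RHS]big_mkcond; apply: eq_bigr => m _.
rewrite (eq_bigl (fun n => n == d * m)%N) => [|n]; last by rewrite eq_sym.
by rewrite big_nat1_eq.
Qed.

Lemma abs_summable_dconv f g : f 0%N = 0 -> g 0%N = 0 ->
  abs_summable f -> abs_summable g -> abs_summable (dconv f g).
Proof.
move=> f0 g0 [B fB] [C gC].
(* The partial-sum identity is applied to the moduli, embedded back into the complex numbers. *)
pose F n : R[i] := (cmod (f n))%:C; pose G n : R[i] := (cmod (g n))%:C.
have F0 : F 0%N = 0 by rewrite /F f0 cmod0.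
have G0 : G 0%N = 0 by rewrite /G g0 cmod0.
have FG d m : F d * G m = (cmod (f d) * cmod (g m))%:C by rewrite rmorphM.
exists (B * C) => X.
apply: (@le_trans _ _ (\sum_(0 <= d < X) \sum_(0 <= m < X) cmod (f d) * cmod (g m))).
  have := @dconv_partial F G X F0 G0.
  have E n : dconv F G n = (\sum_(0 <= d < n.+1 | (d %| n)%N) cmod (f d) * cmod (g (n %/ d)%N))%:C.
    by rewrite /dconv rmorph_sum; apply: eq_bigr => d _; rewrite FG.
  under eq_bigr do rewrite E.
  rewrite -rmorph_sum; under [in X in _ = X -> _]eq_bigr => d _.
    under eq_bigr do rewrite FG.
    rewrite -rmorph_sum; over.
  rewrite -rmorph_sum => /complexI H.
  apply: (@le_trans _ _ (\sum_(0 <= n < X) \sum_(0 <= d < n.+1 | (d %| n)%N) cmod (f d) * cmod (g (n %/ d)%N))).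
    apply: ler_sum => n _; rewrite (le_trans (cmod_sum _ _ _)) //.
    by under eq_bigr do rewrite cmodM.
  rewrite H; apply: ler_sum => d _; rewrite [leLHS]big_mkcond.
  by apply: ler_sum => m _; case: ifP => // _; rewrite mulr_ge0 ?cmod_ge0.
under eq_bigr do rewrite -mulr_sumr.
rewrite -mulr_suml ler_pM ?sumr_ge0 // => *; exact: cmod_ge0.
Qed.

(** The first X terms of the convolution collect the products [f d * g m] with d m < X. A pair with
    d m >= X >= K^2 has d >= K or m >= K, so what is missing from the full square is controlled by
    the tails past [K]. *)
Lemma csum_dconv f g : f 0%N = 0 -> g 0%N = 0 ->
  abs_summable f -> abs_summable g ->
  csum (dconv f g) = csum f * csum g.
Proof.
move=> f0 g0 hf hg; apply: csum_eq => e e0.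
have [B fB] := hf; have [C gC] := hg.
have B0 := abs_bound_ge0 fB; have C0 := abs_bound_ge0 gC.
have BC : 0 < 2 * (B + C + 1) by lra.
set e1 := e / (2 * (B + C + 1)).
have e10 : 0 < e1 by rewrite divr_gt0.
have e1E : 2 * (B + C + 1) * e1 = e by rewrite mulrC divfK // gt_eqF.
have [N1 h1] := abs_summable_tail hf e10.
have [N2 h2] := abs_summable_tail hg e10.
have [N3 h3] := csumP hf e10.
have [N4 h4] := csumP hg e10.
pose K := maxn (maxn N1 N2) (maxn N3 N4).+1.
exists (K * K)%N => X KX.
have KX' : (K <= X)%N by rewrite (leq_trans _ KX) // leq_pmull // /K; lia.
pose SA := \sum_(0 <= d < X) f d; pose SB := \sum_(0 <= d < X) g d.
have tailf : \sum_(K <= i < X) cmod (f i) <= e1 by apply: h1; rewrite /K; lia.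
have tailg : \sum_(K <= i < X) cmod (g i) <= e1 by apply: h2; rewrite /K; lia.
have dA : cmod (SA - csum f) <= e1 by apply: h3; move: KX'; rewrite /K; lia.
have dB : cmod (SB - csum g) <= e1 by apply: h4; move: KX'; rewrite /K; lia.
have main : cmod (SA * SB - \sum_(0 <= n < X) dconv f g n) <= e1 * C + B * e1.
  rewrite dconv_partial // /SA /SB mulr_suml -sumrB.
  apply: (@le_trans _ _ (\sum_(0 <= d < X) \sum_(0 <= m < X | (X <= d * m)%N) cmod (f d) * cmod (g m))).
    rewrite (le_trans (cmod_sum _ _ _)) //; apply: ler_sum => d _.
    rewrite mulr_sumr (bigID (fun m => (d * m < X)%N)) /= addrAC subrr add0r.
    rewrite (le_trans (cmod_sum _ _ _)) //.
    rewrite [leLHS](eq_bigl (fun m => (X <= d * m)%N)) => [|m]; last by rewrite -leqNgt.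
    by apply: ler_sum => m _; rewrite cmodM.
  rewrite (big_cat_nat (leq0n _) KX') /= addrC lerD //.
    apply: (@le_trans _ _ (\sum_(K <= d < X) cmod (f d) * C)).
      apply: ler_sum => d _.
      apply: (@le_trans _ _ (\sum_(0 <= m < X) cmod (f d) * cmod (g m))).
        rewrite [leLHS]big_mkcond.
        by apply: ler_sum => m _; case: ifP => // _; rewrite mulr_ge0 ?cmod_ge0.
      by rewrite -mulr_sumr ler_wpM2l ?cmod_ge0.
    by rewrite -mulr_suml ler_wpM2r.
  apply: (@le_trans _ _ (\sum_(0 <= d < K) cmod (f d) * e1)); last first.
    by rewrite -mulr_suml ler_wpM2r // ltW.
  rewrite big_nat [leRHS]big_nat; apply: ler_sum => d /andP[_ dK].
  rewrite (big_cat_nat (leq0n _) KX') /= [X in X + _]big_nat_cond [X in X + _]big1; last first.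
    move=> m /andP[/andP[_ mK] Xdm].
    have : (d * m <= K * K)%N by rewrite leq_mul // ltnW.
    have : (d * m < K * K)%N by rewrite ltn_mul.
    by lia.
  rewrite add0r [leLHS]big_mkcond.
  apply: (@le_trans _ _ (\sum_(K <= m < X) cmod (f d) * cmod (g m))).
    by apply: ler_sum => m _; case: ifP => // _; rewrite mulr_ge0 ?cmod_ge0.
  by rewrite -mulr_sumr ler_wpM2l ?cmod_ge0.
have cf : cmod (csum f) <= B := csum_le fB.
have cg : cmod SB <= C by rewrite (le_trans (cmod_sum _ _ _)).
have -> : \sum_(0 <= n < X) dconv f g n - csum f * csum g =
  ((SA - csum f) * SB + csum f * (SB - csum g)) - (SA * SB - \sum_(0 <= n < X) dconv f g n) by ring.
rewrite (le_trans (cmodB _ _)) //.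
have a1 : cmod ((SA - csum f) * SB) <= e1 * C by rewrite cmodM ler_pM ?cmod_ge0.
have a2 : cmod (csum f * (SB - csum g)) <= B * e1 by rewrite cmodM ler_pM ?cmod_ge0.
have a3 := cmodD ((SA - csum f) * SB) (csum f * (SB - csum g)).
have -> : e = 2 * (e1 * C + B * e1) + 2 * e1 by rewrite -e1E; ring.
lra.
Qed.

End DirichletConvolution.

(** * Elementary estimates for logarithms and sums of powers *)

Section RealEstimates.
Context (R : realType).
Implicit Types (x y d u : R).

Lemma pow_le_expR m d y : 0 < d -> 0 <= y -> y ^+ m <= m`!%:R / d ^+ m * expR (d * y).
Proof.
move=> d0 y0; have dm : 0 < d ^+ m by rewrite exprn_gt0.
have f0 : 0 < (m`!%:R : R) by rewrite ltr0n fact_gt0.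
have dy : 0 <= d * y by rewrite mulr_ge0 // ltW.
suff h : (d * y) ^+ m <= m`!%:R * expR (d * y).
  by rewrite mulrAC ler_pdivlMr // mulrC -exprMn.
case: m {dm} f0 => [|m] f0; first by rewrite expr0 fact0 mul1r; have := expR_ge1Dx (d * y); lra.
have := expR_ge1Dxn m dy => h.
by rewrite [leRHS]mulrC -ler_pdivrMr //; lra.
Qed.

Lemma ln_nat_ge0 n : 0 <= ln (n%:R : R).
Proof.
case: n => [|n]; first by rewrite ln0.
by rewrite ln_ge0 // ler1n.
Qed.

Lemma ler_ln_nat m n : (0 < m)%N -> (m <= n)%N -> ln (m%:R : R) <= ln n%:R.
Proof.
by move=> m0 mn; rewrite ler_ln ?posrE ?ltr0n ?ler_nat // (leq_trans m0).
Qed.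

Lemma lnS_sub_le n : (0 < n)%N -> ln (n.+1%:R : R) - ln n%:R <= n%:R^-1.
Proof.
move=> n0; have n0' : 0 < (n%:R : R) by rewrite ltr0n.
rewrite -ln_div ?posrE ?ltr0n //.
have -> : n.+1%:R / n%:R = 1 + (n%:R)^-1 :> R by rewrite -natr1; field; rewrite gt_eqF.
by rewrite le_ln1Dx // (lt_trans _ (y := 0)) ?ltrN10 // invr_gt0.
Qed.

Lemma lnS_sub_ge n : (0 < n)%N -> n.+1%:R^-1 <= ln (n.+1%:R : R) - ln n%:R.
Proof.
move=> n0; have n0' : 0 < (n%:R : R) by rewrite ltr0n.
have n1' : 0 < (n.+1%:R : R) by rewrite ltr0n.
rewrite -opprB lerNr -ln_div ?posrE //.
have -> : n%:R / n.+1%:R = 1 + (- n.+1%:R^-1) :> R.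
  by rewrite -natr1; field; rewrite natr1 gt_eqF.
by rewrite le_ln1Dx // ltrN2 invf_lt1 // ltr1n.
Qed.

(** The integral test without integrals: the right-hand side telescopes in [n]. It follows from 1 /
    (n + 1) <= ln ((n + 1) / n) and e^y >= 1 + y. *)
Lemma expR_step d n : 0 < d -> (0 < n)%N ->
  expR (- (1 + d) * ln (n.+1%:R : R)) <=
  (expR (- d * ln n%:R) - expR (- d * ln n.+1%:R)) / d.
Proof.
move=> d0 n0; have n1' : 0 < (n.+1%:R : R) by rewrite ltr0n.
have -> : - d * ln n%:R = - d * ln (n.+1%:R) + d * (ln n.+1%:R - ln n%:R) :> R by ring.
have -> : - (1 + d) * ln n.+1%:R = - ln (n.+1%:R : R) + - d * ln (n.+1%:R) by ring.
rewrite !expRD expRN lnK ?posrE // ler_pdivlMr //.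
have := expR_ge1Dx (d * (ln (n.+1%:R : R) - ln n%:R)).
have := lnS_sub_ge n0; have := expR_gt0 (- d * ln (n.+1%:R : R)).
set E := expR (- d * _); set a := _^-1; set b := ln _ - _; set F := expR _ => E0 ab F1.
have : d * a <= d * b by rewrite ler_pM2l.
move=> dab; have : 1 + d * a <= F by lra.
move/(ler_wpM2l (ltW E0)); lra.
Qed.

Lemma sum_expR_tail d N X : 0 < d -> (0 < N)%N ->
  \sum_(N <= n < X) expR (- (1 + d) * ln (n.+1%:R : R)) <= expR (- d * ln N%:R) / d.
Proof.
move=> d0 N0.
have [XN|/ltnW NX] := leqP X N.
  by rewrite big_geq // divr_ge0 ?expR_ge0 // ltW.
apply: (@le_trans _ _ (\sum_(N <= n < X) ((expR (- d * ln n%:R) / d) - (expR (- d * ln n.+1%:R) / d)))).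
  rewrite big_nat [leRHS]big_nat; apply: ler_sum => n /andP[Nn _].
  by rewrite -mulrBl expR_step // (leq_trans N0).
rewrite -[leLHS]opprK -sumrN.
under eq_bigr do rewrite opprB.
rewrite (telescope_sumr (fun n => expR (- d * ln n%:R) / d)) // opprB lerBlDr lerDl.
by rewrite divr_ge0 ?expR_ge0 // ltW.
Qed.

(** This is n^(-a). Since [ln 0] is 0, the exponential alone would give 1 at n = 0; the value 0
    there makes [pterm] multiplicative on all of nat and fits the convention of [dconv]. *)
Definition pterm (a : R) n : R := if n is 0 then 0 else expR (- a * ln n%:R).

Lemma pterm_ge0 a n : 0 <= pterm a n.
Proof. by case: n => // n; rewrite expR_ge0. Qed.

Lemma sum_pterm d X : 0 < d -> \sum_(0 <= n < X) pterm (1 + d) n <= 1 + d^-1.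
Proof.
move=> d0; have d1 : 0 < d^-1 by rewrite invr_gt0.
case: X => [|[|X]]; first by rewrite big_geq // addr_ge0 // ltW.
  by rewrite big_nat1 addr_ge0 // ltW.
rewrite big_nat_recl // add0r big_nat_recl //= ln1 mulr0 expR0 lerD2l.
have := @sum_expR_tail d 1 X.+1 d0 isT.
by rewrite big_add1 ln1 mulr0 expR0 mul1r.
Qed.

Lemma sum_pterm_tail d N X : 0 < d -> (0 < N)%N ->
  \sum_(N <= n < X) pterm (1 + d) n.+1 <= expR (- d * ln N%:R) / d.
Proof. by move=> d0 N0; exact: sum_expR_tail. Qed.

Lemma ln_pterm j d e n : 0 < e ->
  ln n%:R ^+ j * pterm (d + e) n <= j`!%:R / e ^+ j * pterm d n.
Proof.
move=> e0; case: n => [|n]; first by rewrite !mulr0.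
rewrite /pterm.
have -> : - d * ln n.+1%:R = - (d + e) * ln n.+1%:R + e * ln n.+1%:R by ring.
rewrite expRD mulrCA [_ * expR _]mulrC ler_wpM2l ?expR_ge0 //.
by rewrite pow_le_expR // ln_nat_ge0.
Qed.

Lemma sum_ln_pterm j d X : 0 < d ->
  \sum_(0 <= n < X) ln n%:R ^+ j * pterm (1 + d) n <=
  j`!%:R * (2 / d) ^+ j * (1 + 2 / d).
Proof.
(* Half of [d] pays for the powers of the logarithm, the other half for convergence. *)
move=> d0; have d2 : 0 < d / 2 by lra.
apply: (@le_trans _ _ (\sum_(0 <= n < X) j`!%:R / (d / 2) ^+ j * pterm (1 + d / 2) n)).
  apply: ler_sum => n _; rewrite -[in leLHS](_ : 1 + d / 2 + d / 2 = 1 + d); last by field.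
  exact: ln_pterm.
rewrite -mulr_sumr -exprVn invf_div ler_wpM2l //.
  by rewrite mulr_ge0 ?exprn_ge0 ?divr_ge0 // ltW.
by have := sum_pterm X d2; rewrite invf_div.
Qed.

End RealEstimates.

Section DirichletTerms.
Context (R : realType).
Implicit Types (sg t : R).

(* [(log n)^j n^(-s)] at [s = sg + i t], with value [0] at [n = 0]. *)
Definition dterm j sg t n : R[i] :=
  (ln n%:R ^+ j * pterm sg n)%:C * cis (- (t * ln n%:R)).

Lemma dterm0 j sg t : dterm j sg t 0 = 0.
Proof. by rewrite /dterm /= mulr0 mul0r. Qed.

Lemma cmod_dterm j sg t n : cmod (dterm j sg t n) = ln n%:R ^+ j * pterm sg n.
Proof.
rewrite /dterm cmodM cmod_cis mulr1 cmod_real ger0_norm //.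
by rewrite mulr_ge0 ?pterm_ge0 // exprn_ge0 // ln_nat_ge0.
Qed.

Lemma dterm_abs_bound j d t : 0 < d ->
  abs_bound (dterm j (1 + d) t) (j`!%:R * (2 / d) ^+ j * (1 + 2 / d)).
Proof.
move=> d0 X; under eq_bigr do rewrite cmod_dterm.
exact: sum_ln_pterm.
Qed.

Lemma dterm_summable j sg t : 1 < sg -> abs_summable (dterm j sg t).
Proof.
move=> sg1; rewrite -(subrKC 1 sg).
by eexists; apply: dterm_abs_bound; lra.
Qed.

Lemma ptermM sg m n : pterm sg (m * n) = pterm sg m * pterm sg n :> R.
Proof.
case: m => [|m]; first by rewrite mul0n /= mul0r.
case: n => [|n]; first by rewrite muln0 /= mulr0.
have -> : pterm sg (m.+1 * n.+1) = expR (- sg * ln (m.+1 * n.+1)%:R) by rewrite mulnS.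
by rewrite natrM lnM ?posrE ?ltr0n // mulrDr expRD.
Qed.

Lemma dterm0M sg t m n : dterm 0 sg t (m * n) = dterm 0 sg t m * dterm 0 sg t n.
Proof.
case: m => [|m]; first by rewrite mul0n dterm0 mul0r.
case: n => [|n]; first by rewrite muln0 dterm0 mulr0.
rewrite /dterm !expr0 !mul1r ptermM natrM lnM ?posrE ?ltr0n //.
rewrite mulrDr opprD cisD rmorphM /=; ring.
Qed.

Lemma dterm_ln j sg t n : dterm j sg t n = (ln n%:R ^+ j)%:C * dterm 0 sg t n.
Proof. by rewrite /dterm expr0 mul1r rmorphM mulrA. Qed.

(* [(-1)^j zeta^(j)(sg + i t)] *)
Definition Zs j sg t := csum (dterm j sg t).

End DirichletTerms.

(** * Calculus for complex-valued functions of a real variable *)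

Section ComplexDerivative.
Context (R : realType).
Implicit Types (f g : R -> R[i]) (x u : R) (d z : R[i]).

Definition cderiv f x d :=
  is_derive x 1 (fun u => complex.Re (f u)) (complex.Re d) /\
  is_derive x 1 (fun u => complex.Im (f u)) (complex.Im d).

Lemma cderiv_cst z x : cderiv (fun=> z) x 0.
Proof. by split; apply: is_derive_cst. Qed.

Lemma cderiv_real (h : R -> R) x dh : is_derive x 1 h dh ->
  cderiv (fun u => (h u)%:C) x dh%:C.
Proof. by move=> hh; split => //=; apply: is_derive_cst. Qed.

Lemma cderivD f g x d1 d2 : cderiv f x d1 -> cderiv g x d2 ->
  cderiv (fun u => f u + g u) x (d1 + d2).
Proof.
move=> [a1 a2] [b1 b2]; split.
  rewrite ReD (_ : (fun u => _) = (fun u => complex.Re (f u)) + (fun u => complex.Re (g u))).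
    exact: is_deriveD.
  by apply/funext => u; rewrite ReD.
rewrite ImD (_ : (fun u => _) = (fun u => complex.Im (f u)) + (fun u => complex.Im (g u))).
  exact: is_deriveD.
by apply/funext => u; rewrite ImD.
Qed.

Lemma cderivM f g x d1 d2 : cderiv f x d1 -> cderiv g x d2 ->
  cderiv (fun u => f u * g u) x (d1 * g x + f x * d2).
Proof.
move=> [a1 a2] [b1 b2]; split.
  rewrite (_ : (fun u => _) = (fun u => complex.Re (f u)) * (fun u => complex.Re (g u))
     - (fun u => complex.Im (f u)) * (fun u => complex.Im (g u))).
    apply: (is_derive_eq (is_deriveB (is_deriveM a1 b1) (is_deriveM a2 b2))).
    by rewrite ReD; case: (f x) (g x) d1 d2 {a1 a2 b1 b2} => [? ?] [? ?] [? ?] [? ?]; rewrite /= /GRing.scale /=; ring.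
  by apply/funext => u; rewrite !fctE; case: (f u) (g u) => [? ?] [? ?].
rewrite (_ : (fun u => _) = (fun u => complex.Re (f u)) * (fun u => complex.Im (g u))
   + (fun u => complex.Im (f u)) * (fun u => complex.Re (g u))).
  apply: (is_derive_eq (is_deriveD (is_deriveM a1 b2) (is_deriveM a2 b1))).
  by rewrite ImD; case: (f x) (g x) d1 d2 {a1 a2 b1 b2} => [? ?] [? ?] [? ?] [? ?]; rewrite /= /GRing.scale /=; ring.
by apply/funext => u; rewrite !fctE; case: (f u) (g u) => [? ?] [? ?].
Qed.

Lemma cderivZ z f x d : cderiv f x d -> cderiv (fun u => z * f u) x (z * d).
Proof. by move=> h; have := cderivM (cderiv_cst z x) h; rewrite mul0r add0r. Qed.

Lemma is_derive_lin (a x : R) : is_derive x (1 : R) (fun u : R => a * u) a.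
Proof.
apply: (is_derive_eq (is_deriveZ a (is_derive_id (x : R^o) (1 : R^o)))).
by rewrite /GRing.scale /= mulr1.
Qed.

Lemma cderiv_cis a x : cderiv (fun u => cis (- (a * u))) x
  ((0 -i* a) * cis (- (a * x))).
Proof.
have h : is_derive x 1 (fun u => - (a * u)) (- a).
  rewrite (_ : (fun u => _) = (fun u => - a * u)); last by apply/funext => u; rewrite mulNr.
  exact: is_derive_lin.
split => /=.
  apply: (is_derive_eq (is_derive1_comp (is_derive_cos _) h)).
  by rewrite mul0r; ring.
apply: (is_derive_eq (is_derive1_comp (is_derive_sin _) h)).
by rewrite mul0r; ring.
Qed.

Lemma cderiv_expR a x : cderiv (fun u => (expR (- a * u))%:C) x
  ((- a)%:C * (expR (- a * x))%:C).
Proof.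
have h := is_derive_lin (- a) x.
rewrite -rmorphM; apply: cderiv_real.
apply: (is_derive_eq (is_derive1_comp (is_derive_expR _) h)).
by rewrite mulrC.
Qed.

Lemma cderivX j x : cderiv (fun u => (u ^+ j)%:C) x ((x ^+ j.-1 *+ j)%:C).
Proof.
apply: cderiv_real.
have h : is_derive x (1 : R) (id : R -> R) 1 by exact: is_derive_id.
rewrite (_ : (fun u => _) = (id : R -> R) ^+ j); last by apply/funext => u; rewrite exprfctE.
apply: (is_derive_eq (is_deriveX j h)).
by rewrite /GRing.scale /= mulr1 mulr_natl.
Qed.

(** There is no mean value equality for complex values. It is applied to the real function Re
    (conj(w) f) with w = f b - f a, whose increment is |w|^2. *)
Lemma cderiv_le f df (a b B : R) : a <= b ->
  (forall x, cderiv f x (df x)) ->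
  (forall x, a <= x <= b -> cmod (df x) <= B) ->
  cmod (f b - f a) <= B * (b - a).
Proof.
move=> ab hf hB; set w := f b - f a.
pose p := complex.Re w; pose q := complex.Im w.
pose g := p \*: (fun u => complex.Re (f u)) + q \*: (fun u => complex.Im (f u)).
have hg x : is_derive x 1 g (p * complex.Re (df x) + q * complex.Im (df x)).
  by have [h1 h2] := hf x; apply: is_deriveD.
have cg : {within `[a, b], continuous g}%classic.
  apply: continuous_subspaceT => x; apply: differentiable_continuous.
  by apply/derivable1_diffP; have [] := hg x.
have [c cab E] := @MVT_segment R g _ a b ab (fun x _ => hg x) cg.
have gE : g b - g a = cmod w ^+ 2.
  rewrite sqr_cmod /g /p /q /w ReD ImD ReN ImN !fctE /= /GRing.scale /=; ring.
have dB : p * complex.Re (df c) + q * complex.Im (df c) <= cmod w * B.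
  pose z := conjc w * df c.
  have -> : p * complex.Re (df c) + q * complex.Im (df c) = complex.Re z.
    by rewrite /z /p /q; case: (w) (df c) => [? ?] [? ?] /=; ring.
  apply: (le_trans (ler_norm _)); apply: (le_trans (Re_le_cmod _)).
  rewrite /z cmodM; have -> : cmod (conjc w) = cmod w.
    by rewrite /cmod; case: (w) => ? ? /=; rewrite sqrrN.
  by rewrite ler_wpM2l ?cmod_ge0 // hB.
move: E; rewrite gE => E.
have B0 : 0 <= B by rewrite (le_trans (cmod_ge0 (df a))) // hB // lexx ab.
have [w0|w0] := eqVneq (cmod w) 0.
  by rewrite w0 mulr_ge0 // subr_ge0.
have wp : 0 < cmod w by rewrite lt_neqAle eq_sym w0 cmod_ge0.
rewrite -(ler_pM2l wp) -expr2 E mulrA ler_wpM2r // subr_ge0 //.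
Qed.

End ComplexDerivative.

(** * Comparison of the terms of zeta and its derivatives with integrals *)

Section ZetaExpansion.
Context (R : realType).
Implicit Types (u : R).

Lemma ln_nat_unbounded (W : R) : exists N, forall n, (N <= n)%N -> W <= ln n%:R.
Proof.
have [n hn] : exists n, expR W <= n%:R :> R.
  by exists (Num.bound (expR W)); rewrite ltW // archi_boundP // expR_ge0.
exists n.+1 => m nm; rewrite -ler_expR lnK ?posrE ?ltr0n ?(leq_ltn_trans _ nm) //.
by rewrite (le_trans hn) // ler_nat ltnW.
Qed.

Context (sg t : R).
Let v : R[i] := (sg - 1) +i* t.

(* With [u = log x] and [v = s - 1], [e0 u = x^(1 - s)] and [Ej j u du = (log x)^j x^(-s) dx]. *)
Definition e0 u : R[i] := (expR (- (sg - 1) * u))%:C * cis (- (t * u)).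
Definition Ej j u : R[i] := (u ^+ j)%:C * e0 u.
(** The antiderivative of [Ej j] produced by repeated integration by parts. For sg > 1 it tends to 0
    at infinity, so [- Ij j u] is the integral of [Ej j] from [u] on. *)
Fixpoint Ij j u : R[i] :=
  if j is j'.+1 then (j'.+1%:R * Ij j' u - Ej j u) / v else - e0 u / v.

Lemma cderiv_e0 u : cderiv e0 u (- v * e0 u).
Proof.
have := cderivM (cderiv_expR (sg - 1) u) (cderiv_cis t u).
rewrite (_ : _ + _ = - v * e0 u) //.
have -> : - v = (- (sg - 1))%:C + (0 -i* t).
  by apply/eqP; rewrite eq_complex /= addr0 add0r !eqxx.
by rewrite /e0; ring.
Qed.

Lemma cderiv_Ej j u : cderiv (Ej j) u ((u ^+ j.-1 *+ j)%:C * e0 u - v * Ej j u).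
Proof.
have := cderivM (cderivX j u) (cderiv_e0 u).
by rewrite (_ : _ + _ = (u ^+ j.-1 *+ j)%:C * e0 u - v * Ej j u) // /Ej; ring.
Qed.

Lemma cderiv_Ij j u : v != 0 -> cderiv (Ij j) u (Ej j u).
Proof.
move=> v0; elim: j => [|j IH].
  have := cderivZ (- v^-1) (cderiv_e0 u).
  rewrite (_ : _ * _ = Ej 0 u); last by rewrite /Ej expr0; field.
  by congr cderiv; apply/funext => x /=; ring.
have := cderivZ (v^-1) (cderivD (cderivZ j.+1%:R IH) (cderivZ (-1) (cderiv_Ej j.+1 u))).
rewrite (_ : _ * _ = Ej j.+1 u).
  by congr cderiv; apply/funext => x /=; ring.
have -> : (u ^+ j.+1.-1 *+ j.+1)%:C = j.+1%:R * (u ^+ j)%:C :> R[i].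
  by rewrite rmorphMn /= mulr_natl.
by rewrite /Ej; field.
Qed.

Lemma cmod_e0 u : cmod (e0 u) = expR (- (sg - 1) * u).
Proof. by rewrite /e0 cmodM cmod_cis mulr1 cmod_real ger0_norm // expR_ge0. Qed.

Lemma cmod_Ej j u : 0 <= u -> cmod (Ej j u) = u ^+ j * expR (- (sg - 1) * u).
Proof. by move=> u0; rewrite /Ej cmodM cmod_e0 cmod_real ger0_norm // exprn_ge0. Qed.

Lemma Ij0 j : v != 0 -> Ij j 0 = - j`!%:R / v ^+ j.+1.
Proof.
move=> v0; elim: j => [|j IH] /=.
  by rewrite /e0 !mulr0 oppr0 cis0 expR0 mulr1 expr1.
rewrite IH /Ej expr0n /= mul0r subr0 factS natrM [in RHS]exprS; field.
by rewrite expf_neq0 /= ?v0.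
Qed.

Fixpoint Ijc j : R := if j is j'.+1 then j'.+1%:R * Ijc j' + 1 else 1.

Lemma Ijc_ge0 j : 0 <= Ijc j.
Proof. by elim: j => [|j IH] //=; rewrite addr_ge0 // mulr_ge0. Qed.

Lemma Ij_le j u m : 0 <= u -> 0 < m -> m <= 1 -> m <= cmod v ->
  cmod (Ij j u) <= Ijc j * (1 + u) ^+ j / m ^+ j.+1 * expR (- (sg - 1) * u).
Proof.
move=> u0 m0 m1 mv; have vp : 0 < cmod v by rewrite (lt_le_trans m0).
have vm : (cmod v)^-1 <= m^-1 by rewrite lef_pV2 ?posrE.
have E0 := expR_ge0 (- (sg - 1) * u).
elim: j => [|j IH] /=.
  rewrite cmodM cmodN cmodV cmod_e0 !mul1r expr1 mulrC.
  by rewrite ler_wpM2r.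
rewrite cmodM cmodV.
have a1 : cmod (j.+1%:R * Ij j u - Ej j.+1 u) <=
    (j.+1%:R * Ijc j + 1) * (1 + u) ^+ j.+1 / m ^+ j.+1 * expR (- (sg - 1) * u).
  rewrite (le_trans (cmodB _ _)) // cmodM cmod_Ej //.
  have -> : cmod (j.+1%:R : R[i]) = j.+1%:R.
    by rewrite -(rmorph_nat (real_complex R)) cmod_real ger0_norm.
  rewrite !mulrDl mul1r lerD //.
    rewrite -!mulrA ler_wpM2l // (le_trans IH) // -!mulrA ler_wpM2l ?Ijc_ge0 //.
    rewrite ler_wpM2r //; last by rewrite exprS ler_peMl ?exprn_ge0; lra.
    by rewrite mulr_ge0 // invr_ge0 exprn_ge0 // ltW.
  rewrite ler_wpM2r // (@le_trans _ _ ((1 + u) ^+ j.+1)) //.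
    by rewrite lerXn2r ?nnegrE; lra.
  rewrite ler_peMr ?exprn_ge0 //; first lra.
  by rewrite invf_ge1 ?exprn_gt0 // exprn_ile1 // ltW.
have -> : (j.+1%:R * Ijc j + 1) * (1 + u) ^+ j.+1 / m ^+ j.+2 * expR (- (sg - 1) * u) =
  ((j.+1%:R * Ijc j + 1) * (1 + u) ^+ j.+1 / m ^+ j.+1 * expR (- (sg - 1) * u)) * m^-1.
  by rewrite [m ^+ j.+2]exprSr invfM; ring.
by rewrite ler_pM // ?cmod_ge0 // invr_ge0 cmod_ge0.
Qed.

Lemma dterm_Ej j n : (0 < n)%N -> dterm j sg t n = Ej j (ln n%:R) * (n%:R^-1)%:C.
Proof.
move=> n0; rewrite /dterm /Ej /e0; case: n n0 => // n _ /=.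
have -> : - sg * ln n.+1%:R = - (sg - 1) * ln n.+1%:R - ln (n.+1%:R : R) by ring.
rewrite expRD expRN lnK ?posrE ?ltr0n // !rmorphM /=; ring.
Qed.

Hypothesis sg1 : 1 <= sg.

Lemma cmod_Ej_le j u : 0 <= u -> cmod (Ej j u) <= u ^+ j.
Proof.
move=> u0; rewrite cmod_Ej // ler_piMr ?exprn_ge0 //.
by rewrite expR_le1 mulNr oppr_le0 mulr_ge0 // subr_ge0.
Qed.

Lemma cmod_Ej'_le j u b : 0 <= u <= b ->
  cmod ((u ^+ j.-1 *+ j)%:C * e0 u - v * Ej j u) <= (j%:R + cmod v) * (1 + b) ^+ j.
Proof.
move=> /andP[u0 ub]; rewrite (le_trans (cmodB _ _)) // mulrDl lerD //.
  rewrite -mulr_natl rmorphM -mulrA cmodM rmorph_nat.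
  rewrite -(rmorph_nat (real_complex R)) cmod_real ger0_norm // ler_wpM2l //.
  rewrite (le_trans (cmod_Ej_le _ u0)) //; case: j => [|j] /=; first by rewrite !expr0.
  rewrite (@le_trans _ _ ((1 + b) ^+ j)) //; first by rewrite lerXn2r ?nnegrE; lra.
  by rewrite exprS ler_peMl ?exprn_ge0; lra.
rewrite cmodM ler_wpM2l ?cmod_ge0 // (le_trans (cmod_Ej_le _ u0)) //.
by rewrite lerXn2r ?nnegrE; lra.
Qed.

(** The term at [n] minus the integral of (log x)^j x^(-s) over [n, n + 1]. *)
Definition Rm j n := dterm j sg t n - (Ij j (ln n.+1%:R) - Ij j (ln n%:R)).

(** Two errors of order 1 / n^2: replacing the length ln (n + 1) - ln n by 1 / n, and replacing the
    integrand by its left value. For the second, the mean value inequality is used for [Ej], then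
    for the antiderivative minus its linear part. *)
Lemma Rm_le j n : v != 0 -> (0 < n)%N ->
  cmod (Rm j n) <= (j%:R + 1 + cmod v) * (1 + ln n.+1%:R) ^+ j / n%:R ^+ 2.
Proof.
move=> v0 n0; have n0' : 0 < (n%:R : R) by rewrite ltr0n.
have ab1 := lnS_sub_le R n0; have ab2 := lnS_sub_ge R n0.
have nn : n%:R^-1 - n.+1%:R^-1 <= n%:R^-1 * n%:R^-1 :> R.
  have -> : n%:R^-1 - n.+1%:R^-1 = n%:R^-1 * n.+1%:R^-1 :> R.
    by rewrite -natr1; field; rewrite natr1 !gt_eqF ?ltr0n.
  by rewrite ler_wpM2l ?invr_ge0 // lef_pV2 ?posrE ?ltr0n // ler_nat.
have nS : 0 < (n.+1%:R^-1 : R) by rewrite invr_gt0 ltr0n.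
have DE := dterm_Ej j n0.
rewrite -exprVn expr2 /Rm DE; move: ab1 ab2 nn nS.
move: (n%:R^-1 : R) (n.+1%:R^-1 : R) => p q ab1 ab2 nn nS.
set a := ln (n%:R : R) in ab1 ab2; set b := ln (n.+1%:R : R) in ab1 ab2.
have a0 : 0 <= a by exact: ln_nat_ge0.
have ab : a <= b by lra.
set B := (j%:R + cmod v) * (1 + b) ^+ j.
have bj0 : 0 <= (1 + b) ^+ j by rewrite exprn_ge0; lra.
have B0 : 0 <= B by rewrite mulr_ge0 // addr_ge0 // cmod_ge0.
have st1 : forall x, a <= x <= b -> cmod (Ej j x - Ej j a) <= B * (b - a).
  move=> x /andP[ax xb].
  apply: (@le_trans _ _ (B * (x - a))); last by rewrite ler_wpM2l // lerD2r.
  apply: (cderiv_le ax (cderiv_Ej j)) => y /andP[ay yx].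
  by apply: cmod_Ej'_le; apply/andP; split; lra.
have st2 : cmod ((Ij j b - Ej j a * b%:C) - (Ij j a - Ej j a * a%:C)) <= B * (b - a) * (b - a).
  apply: (cderiv_le ab (f := fun x => Ij j x - Ej j a * x%:C) (df := fun x => Ej j x - Ej j a)) => // x.
  have := cderivD (cderiv_Ij j x v0) (cderivZ (- Ej j a) (cderivX 1 x)).
  rewrite mulr1n expr0 mulr1; congr cderiv.
  by apply/funext => y; rewrite expr1 mulNr.
have sq : (b - a) * (b - a) <= p * p by rewrite ler_pM //; lra.
have -> : Ej j a * p%:C - (Ij j b - Ij j a) = Ej j a * (p - (b - a))%:C
  - ((Ij j b - Ej j a * b%:C) - (Ij j a - Ej j a * a%:C)).
  by rewrite !rmorphB /=; ring.
rewrite (le_trans (cmodB _ _)) // (_ : _ * (p * p) = (1 + b) ^+ j * (p * p) + B * (p * p)); last first.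
  by rewrite /B; ring.
rewrite lerD //.
  rewrite cmodM ler_pM ?cmod_ge0 //.
    by rewrite (le_trans (cmod_Ej_le _ a0)) // lerXn2r ?nnegrE //; lra.
  by rewrite cmod_real ger0_norm; lra.
by rewrite (le_trans st2) // -mulrA ler_wpM2l.
Qed.

Definition Rmc j : R := (j%:R + 1) * 4 * (2 ^+ j * j`!%:R * expR 2^-1).

Lemma Rmc_ge0 j : 0 <= Rmc j.
Proof. by rewrite !mulr_ge0 ?expR_ge0 ?exprn_ge0 // addr_ge0. Qed.

(** Half a power out of n^(-2) pays for the logarithms, through (1 + b)^j <= 2^j j! e^((1 + b) / 2),
    and a summable power 3/2 remains. *)
Lemma Rm_le_pterm j n : v != 0 -> (0 < n)%N ->
  cmod (Rm j n) <= Rmc j * (1 + cmod v) * pterm (1 + 2^-1) n.+1.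
Proof.
move=> v0 n0; have n0' : 0 < (n%:R : R) by rewrite ltr0n.
have n1' : 0 < (n.+1%:R : R) by rewrite ltr0n.
rewrite (le_trans (Rm_le j v0 n0)) //.
set b := ln (n.+1%:R : R).
have b0 : 0 <= b by exact: ln_nat_ge0.
have h1 : (1 + b) ^+ j <= 2 ^+ j * j`!%:R * expR 2^-1 * expR (2^-1 * b).
  have hb : 0 <= 1 + b by lra.
  have h2 : 0 < 2^-1 :> R by lra.
  have := pow_le_expR j h2 hb; rewrite exprVn invrK mulrDr mulr1 expRD.
  by rewrite [_`!%:R * _]mulrC !mulrA.
have h2 : n%:R ^- 2 <= 4 * expR (- 2 * b) :> R.
  rewrite mulNr expRN (expRM_natl 2) lnK ?posrE //.
  rewrite ler_pdivlMr ?exprn_gt0 // mulrC ler_pdivrMr ?exprn_gt0 //.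
  have : n.+1%:R <= 2 * n%:R :> R by rewrite -natrM ler_nat; lia.
  move=> h; have : n.+1%:R ^+ 2 <= (2 * n%:R) ^+ 2 :> R by rewrite lerXn2r ?nnegrE // mulr_ge0 // ltW.
  by rewrite exprMn; lra.
have h3 : pterm (1 + 2^-1) n.+1 = expR (2^-1 * b) * expR (- 2 * b).
  by rewrite /pterm -expRD -/b; congr expR; field.
have c0 := cmod_ge0 v.
have h4 : j%:R + 1 + cmod v <= (j%:R + 1) * (1 + cmod v).
  rewrite mulrDr mulr1 lerD2l ler_peMl // lerDr //.
rewrite -mulrA h3 /Rmc.
set P := 2 ^+ j * _ * _ in h1 *.
have -> : (j%:R + 1) * 4 * P * (1 + cmod v) * (expR (2^-1 * b) * expR (- 2 * b)) =
  ((j%:R + 1) * (1 + cmod v)) * ((P * expR (2^-1 * b)) * (4 * expR (- 2 * b))) by ring.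
rewrite ler_pM //; first by rewrite !addr_ge0.
  by rewrite mulr_ge0 ?invr_ge0 ?exprn_ge0 //; lra.
by rewrite ler_pM ?invr_ge0 ?exprn_ge0 //; lra.
Qed.

End ZetaExpansion.

Section ZetaPartialSums.
Context (R : realType).

(** The tail of the series is its integral, equal to [- Ij] at the cut, plus the sum of the [Rm].
    The factor N^(-1/2) does not degenerate as [sg] tends to 1, so N of order t^2 makes the error
    bounded at every height. *)
Lemma Zs_expand j (sg t : R) N : 1 < sg -> (0 < N)%N ->
  cmod (Zs j sg t - \sum_(0 <= n < N) dterm j sg t n + Ij sg t j (ln N%:R)) <=
  Rmc R j * (1 + cmod ((sg - 1) +i* t)) * 2 * expR (- 2^-1 * ln N%:R).
Proof.
move=> sg1 N0; set v := _ +i* _.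
have v0 : v != 0.
  by rewrite eq_complex /= negb_and subr_eq0 gt_eqF.
have sg1' := ltW sg1.
apply/ler_addgt0Pr => e e0.
have e2 : 0 < e / 2 by lra.
have [N1 h1] := csumP (dterm_summable j t sg1) e2.
have [N2 h2] : exists N2, forall n, (N2 <= n)%N -> cmod (Ij sg t j (ln n%:R)) <= e / 2.
  pose m : R := Num.min 1 (cmod v).
  have m0 : 0 < m by rewrite lt_min ltr01 cmod_gt0.
  have m1 : m <= 1 by rewrite ge_min lexx.
  have mv : m <= cmod v by rewrite ge_min lexx orbT.
  (* The decay in [u] is split into two equal exponentials: one absorbs (1 + u)^j, the other makes
     [Ij] tend to 0. *)
  have d0 : 0 < (sg - 1) / 2 by lra.
  set d := (sg - 1) / 2 in d0.
  pose K := Ijc R j / m ^+ j.+1 * (j`!%:R / d ^+ j * expR d).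
  have K0 : 0 <= K.
    by rewrite !mulr_ge0 ?invr_ge0 ?expR_ge0 ?Ijc_ge0 ?exprn_ge0 // ltW.
  have [N2 h2] := ln_nat_unbounded (2 * K / (d * e)).
  exists N2 => n Nn; have := h2 n Nn; set u := ln _ => hu.
  have u0 : 0 <= u by exact: ln_nat_ge0.
  apply: (le_trans (Ij_le j u0 m0 m1 mv)).
  have u1 : 0 <= 1 + u by lra.
  have p1 := pow_le_expR j d0 u1.
  have p2 : expR (- (sg - 1) * u) = expR (- (d * u)) * expR (- (d * u)).
    by rewrite -expRD; congr expR; rewrite /d; field.
  apply: (@le_trans _ _ (K * expR (- (d * u)))).
    rewrite p2 mulrA ler_wpM2r ?expR_ge0 //.
    have -> : K = Ijc R j * (j`!%:R / d ^+ j * expR (d * (1 + u))) / m ^+ j.+1 * expR (- (d * u)).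
      have E : expR (d * (1 + u)) * expR (- (d * u)) = expR d by rewrite -expRD; congr expR; ring.
      by rewrite /K -E; ring.
    rewrite ler_wpM2r ?expR_ge0 // ler_wpM2r ?invr_ge0 ?exprn_ge0 ?(ltW m0) //.
    by rewrite ler_wpM2l // Ijc_ge0.
  have hdu : 2 * K <= e * (d * u).
    by move: hu; rewrite ler_pdivrMr ?mulr_gt0 //; lra.
  rewrite expRN ler_pdivrMr ?expR_gt0 //.
  have := expR_ge1Dx (d * u) => h.
  have : e / 2 * (d * u) <= e / 2 * expR (d * u) by rewrite ler_wpM2l; lra.
  lra.
pose X := maxn N (maxn N1 N2).
have NX : (N <= X)%N by rewrite /X; lia.
have a1 : cmod (\sum_(0 <= i < X) dterm j sg t i - Zs j sg t) <= e / 2 by apply: h1; rewrite /X; lia.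
have a2 : cmod (Ij sg t j (ln X%:R)) <= e / 2 by apply: h2; rewrite /X; lia.
have a3 : \sum_(N <= n < X) dterm j sg t n =
   \sum_(N <= n < X) Rm sg t j n + (Ij sg t j (ln X%:R) - Ij sg t j (ln N%:R)).
  rewrite -(telescope_sumr (fun n => Ij sg t j (ln n%:R))) // -big_split.
  by apply: eq_bigr => n _; rewrite /Rm /=; ring.
have a4 : cmod (\sum_(N <= n < X) Rm sg t j n) <=
    Rmc R j * (1 + cmod v) * 2 * expR (- 2^-1 * ln N%:R).
  apply: (le_trans (cmod_sum _ _ _)).
  apply: (@le_trans _ _ (\sum_(N <= n < X) Rmc R j * (1 + cmod v) * pterm (1 + 2^-1) n.+1)).
    rewrite big_nat [leRHS]big_nat; apply: ler_sum => n /andP[Nn _].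
    by rewrite Rm_le_pterm // (leq_trans N0).
  rewrite -mulr_sumr -[leRHS]mulrA ler_wpM2l ?mulr_ge0 ?Rmc_ge0 ?addr_ge0 ?cmod_ge0 //.
  have h2' : 0 < 2^-1 :> R by lra.
  by rewrite (le_trans (sum_pterm_tail _ h2' N0)) // invrK mulrC.
have -> : Zs j sg t - \sum_(0 <= n < N) dterm j sg t n + Ij sg t j (ln N%:R) =
  (Ij sg t j (ln X%:R) - (\sum_(0 <= i < X) dterm j sg t i - Zs j sg t)) + \sum_(N <= n < X) Rm sg t j n.
  by rewrite (big_cat_nat (leq0n _) NX) /= a3; ring.
rewrite (le_trans (cmodD _ _)) // addrC lerD //.
rewrite (le_trans (cmodB _ _)) //; lra.
Qed.

End ZetaPartialSums.

(** * Upper bounds for zeta and its derivatives *)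

Section ZetaBounds.
Context (R : realType).
Implicit Types (sg t c : R).

Definition ell t : R := 1 + ln (2 + `|t|).

Lemma ell_ge1 t : 1 <= ell t.
Proof. by rewrite /ell lerDl ln_ge0 //; have := normr_ge0 t; lra. Qed.

Lemma cmod_v_le sg t : 1 <= sg -> cmod ((sg - 1) +i* t) <= (sg - 1) + `|t|.
Proof.
move=> h; rewrite (le_trans (cmod_le_ReIm _)) //= ger0_norm //; lra.
Qed.

Lemma cmod_v_ge sg t : `|t| <= cmod ((sg - 1) +i* t).
Proof. exact: (Im_le_cmod ((sg - 1) +i* t)). Qed.

(** The expansion cut at N = 1: the partial sum is empty and [- Ij j 0] is exactly the polar term.
    The constant is 2 (1 + |v|) with |v| <= 2. *)
Lemma Zs_near j sg t : 1 < sg <= 2 -> `|t| <= 1 ->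
  cmod (Zs j sg t - j`!%:R / ((sg - 1) +i* t) ^+ j.+1) <= 6 * Rmc R j.
Proof.
move=> /andP[s1 s2] t1; set v := _ +i* _.
have v0 : v != 0 by rewrite eq_complex /= negb_and subr_eq0 gt_eqF.
have := @Zs_expand R j sg t 1 s1 isT.
rewrite big_nat1 dterm0 ln1 subr0 mulr0 expR0 mulr1 Ij0 // mulNr => h.
rewrite (le_trans h) //.
have := cmod_v_le t (ltW s1) => hv.
have := Rmc_ge0 R j => r0.
have : Rmc R j * (1 + cmod v) <= Rmc R j * 3 by rewrite ler_wpM2l //; rewrite -/v in hv; lra.
rewrite -/v; lra.
Qed.

Lemma sum_inv_le N : (0 < N)%N ->
  \sum_(0 <= n < N.+1) pterm 1 n <= 1 + ln (N%:R : R).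
Proof.
elim: N => // -[|N] IH _.
  by rewrite 2?big_nat_recr //= big_geq // ln1 mulr0 expR0; lra.
rewrite big_nat_recr //= mulN1r expRN lnK ?posrE ?ltr0n //.
have := lnS_sub_ge R (ltn0Sn N); have := IH isT.
by move: (_^-1) => x; lra.
Qed.

Lemma pterm_antimono (a b : R) n : a <= b -> pterm b n <= pterm a n.
Proof.
case: n => // n ab; rewrite /= ler_expR ler_wpM2r ?lerN2 //.
exact: (ln_nat_ge0 R n.+1).
Qed.

Lemma Zs_far j c : 0 < c -> c <= 1 -> exists C, [/\ 0 <= C &
  forall sg t, 1 < sg <= 2 -> c <= `|t| -> cmod (Zs j sg t) <= C * ell t ^+ j.+1].
Proof.
move=> c0 c1.
exists (2 ^+ j * 3 + Ijc R j * 3 ^+ j / c ^+ j.+1 + 2 * Rmc R j); split.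
  by rewrite !addr_ge0 ?mulr_ge0 ?exprn_ge0 ?invr_ge0 ?Ijc_ge0 ?Rmc_ge0 ?exprn_ge0 ?(ltW c0).
move=> sg t /andP[s1 s2] ct; set l := ell t.
have l1 : 1 <= l := ell_ge1 t.
have t0 := normr_ge0 t.
pose N1 := (Num.truncn `|t|).+1.
have N1a : `|t| <= N1%:R by rewrite ltW // truncnS_gt.
have N1b : N1%:R <= `|t| + 1 by rewrite -natr1 lerD2r // truncn_le.
(* Of order t^2, so that N^(-1/2) absorbs the factor 1 + |v|, while ln N <= 2 [ell t]. *)
pose N := ((N1 + 2) ^ 2)%N.
have N0 : (0 < N)%N by rewrite expn_gt0 addn2.
have N10 : 0 < (N1 + 2)%:R :> R by rewrite ltr0n addn2.
have lnN : ln (N%:R : R) = 2 * ln (N1 + 2)%:R.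
  by rewrite /N natrX lnXn // mulr_natl.
have lnN1 : ln ((N1 + 2)%:R : R) <= l.
  rewrite -ler_expR lnK ?posrE // /l /ell expRD lnK ?posrE; last by lra.
  have e1 := expR_ge1Dx (1 : R).
  apply: (@le_trans _ _ (2 * (2 + `|t|))); first by rewrite natrD; lra.
  by rewrite ler_wpM2r; lra.
have lnN0 : 0 <= ln (N%:R : R) := ln_nat_ge0 R N.
have hexp := @Zs_expand R j sg t N s1 N0.
have rest : Rmc R j * (1 + cmod ((sg - 1) +i* t)) * 2 * expR (- 2^-1 * ln N%:R) <= 2 * Rmc R j.
  rewrite lnN (_ : - 2^-1 * _ = - ln (N1 + 2)%:R :> R); last by field.
  rewrite expRN lnK ?posrE // ler_pdivrMr //.
  have hv := cmod_v_le t (ltW s1).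
  have h : 1 + cmod ((sg - 1) +i* t) <= (N1 + 2)%:R by rewrite natrD; lra.
  have := ler_wpM2l (Rmc_ge0 R j) h; lra.
have hI : cmod (Ij sg t j (ln N%:R)) <= Ijc R j * 3 ^+ j / c ^+ j.+1 * l ^+ j.
  have hv : c <= cmod ((sg - 1) +i* t) by rewrite (le_trans ct) // cmod_v_ge.
  apply: (le_trans (Ij_le j lnN0 c0 c1 hv)).
  have h1 : expR (- (sg - 1) * ln N%:R) <= 1.
    by rewrite expR_le1 mulNr oppr_le0 mulr_ge0 // subr_ge0 ltW.
  have h2 : (1 + ln (N%:R : R)) ^+ j <= 3 ^+ j * l ^+ j.
    by rewrite -exprMn lerXn2r ?nnegrE; lra.
  apply: (@le_trans _ _ (Ijc R j * (1 + ln (N%:R : R)) ^+ j / c ^+ j.+1)).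
    rewrite ler_piMr // !mulr_ge0 ?Ijc_ge0 ?invr_ge0 ?exprn_ge0 ?(ltW c0) //; lra.
  rewrite -!mulrA ler_wpM2l ?Ijc_ge0 // [leRHS]mulrA [leRHS]mulrAC.
  by rewrite ler_wpM2r // invr_ge0 exprn_ge0 // ltW.
have hS : cmod (\sum_(0 <= n < N) dterm j sg t n) <= 2 ^+ j * 3 * l ^+ j.+1.
  apply: (le_trans (cmod_sum _ _ _)).
  apply: (@le_trans _ _ (\sum_(0 <= n < N.+1) (2 * l) ^+ j * pterm 1 n)).
    rewrite [leRHS]big_nat_recr //= -[leLHS]addr0 lerD //; last first.
      by rewrite mulr_ge0 ?pterm_ge0 // exprn_ge0 //; lra.
    rewrite big_nat [leRHS]big_nat; apply: ler_sum => n /andP[_ nN].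
    rewrite cmod_dterm ler_pM ?pterm_ge0 ?exprn_ge0 ?ln_nat_ge0 //.
      rewrite lerXn2r ?nnegrE ?ln_nat_ge0 //; first by lra.
      case: n nN => [|n] nN; first by rewrite ln0 //; lra.
      by rewrite (le_trans (ler_ln_nat R _ (ltnW nN))) // lnN; lra.
    by rewrite pterm_antimono // ltW.
  rewrite -mulr_sumr exprMn -!mulrA ler_wpM2l ?exprn_ge0 //.
  rewrite exprSr mulrCA ler_wpM2l ?exprn_ge0 //; first by lra.
  rewrite (le_trans (sum_inv_le N0)) // lnN; lra.
have lj : l ^+ j <= l ^+ j.+1 by rewrite exprS ler_peMl ?exprn_ge0 //; lra.
have l11 : 1 <= l ^+ j.+1 by rewrite exprn_ege1.
have k0 : 0 <= Ijc R j * 3 ^+ j / c ^+ j.+1.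
  by rewrite !mulr_ge0 ?Ijc_ge0 ?invr_ge0 ?exprn_ge0 ?(ltW c0).
have m1 := ler_wpM2l k0 lj.
have m2 : 2 * Rmc R j <= 2 * Rmc R j * l ^+ j.+1.
  by rewrite ler_peMr // mulr_ge0 ?Rmc_ge0.
set S := \sum_(0 <= n < N) _ in hS hexp.
set I := Ij _ _ _ _ in hI hexp.
have -> : Zs j sg t = (Zs j sg t - S + I) + (S - I) by ring.
have b1 := cmodD (Zs j sg t - S + I) (S - I).
have b2 := cmodB S I.
lra.
Qed.

Lemma cmod_zeta_real (d : R) t : 0 < d -> d <= 1 -> cmod (Zs 0 (1 + d) t) <= 3 / d.
Proof.
move=> d0 d1; have := csum_le (dterm_abs_bound 0 t d0); rewrite -/(Zs _ _ _).
rewrite fact0 expr0 !mul1r => h; rewrite (le_trans h) //.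
have : 1 <= d^-1 by rewrite invf_ge1.
by move: (d^-1) => x; lra.
Qed.

End ZetaBounds.

(** * Finite Euler products and the 3-4-1 inequality *)

Section EulerProduct.
Context (R : realType).
Implicit Types (sg t : R).

(** Sieving the series of zeta by the primes up to [P] multiplies it by a finite product and leaves
    1 plus a small tail; the Euler product is thus used without any infinite product. *)
Fixpoint rough P n := if P is P'.+1 then rough P' n && ~~ (prime P && (P %| n)%N) else true.

Lemma roughP P n : reflect (forall q, prime q -> (q <= P)%N -> ~~ (q %| n)%N) (rough P n).
Proof.
elim: P => [|P IH] /=.
  by constructor => q /prime_gt0; case: q.
apply: (iffP andP) => [[/IH h1 h2] q pq|h].
  rewrite leq_eqVlt => /orP[/eqP e|]; last by rewrite ltnS; exact: h1.
  by move: h2; rewrite -e pq.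
split; first by apply/IH => q pq qP; apply: h => //; exact: leqW.
by apply/negP => /andP[pP]; apply/negP/h.
Qed.

Definition zr P sg t n : R[i] := if rough P n then dterm 0 sg t n else 0.

Lemma zr_summable P sg t : 1 < sg -> abs_summable (zr P sg t).
Proof.
move=> s1; have [B hB] := dterm_summable 0 t s1; exists B.
apply: (abs_summable_le _ hB) => n; rewrite /zr; case: ifP => // _.
by rewrite cmod0 cmod_ge0.
Qed.

Lemma dconv_single (f : nat -> R[i]) p (c : R[i]) n : f 0%N = 0 -> (0 < p)%N ->
  dconv f (fun m => if m == p then c else 0) n =
  if (p %| n)%N then f (n %/ p)%N * c else 0.
Proof.
move=> f0 p0; rewrite (@dconvE _ _ _ n.+1) ?(ltn_eqF p0) //.
under eq_bigr => d _.
  rewrite big_mkcond (eq_bigr (fun m => if m == p then (if (d * p == n)%N then f d * c else 0) else 0)); last first.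
    by move=> m _; have [->|_] := eqVneq m p; rewrite ?mulr0 // if_same.
  rewrite -big_mkcond big_nat1_eq /=; over.
case: ifP => pn; last first.
  rewrite big1 // => d _; case: ifP => // _; case: ifP => // /eqP e.
  by move: pn; rewrite -e dvdn_mull.
case: (posnP n) => [->|n0].
  by rewrite div0n f0 mul0r big_nat1 mul0n f0 mul0r !if_same.
have pn' : (p < n.+1)%N by rewrite ltnS dvdn_leq.
rewrite pn' -big_mkcond (eq_bigl (fun d => d == n %/ p)%N); last first.
  by move=> d /=; apply/eqP/eqP => [<-|->]; [rewrite mulnK|rewrite divnK].
by rewrite big_nat1_eq /= ltnS leq_div.
Qed.

(** Multiplying by 1 - p^(-s) deletes the multiples of [p]. The subtracted series is the convolution
    with a mass at [p], and passing from n to n / p does not affect divisibility by primes below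
    [p]. *)
Lemma csum_zr P sg t : 1 < sg ->
  csum (zr P sg t) = Zs 0 sg t * \prod_(0 <= p < P.+1 | prime p) (1 - dterm 0 sg t p).
Proof.
move=> s1; elim: P => [|P IH].
  by rewrite big_mkcond big_nat1 /= mulr1.
rewrite big_mkcond big_nat_recr //= -big_mkcond /= mulrA -IH.
have [pP|pP] := boolP (prime P.+1); last first.
  rewrite mulr1; congr csum; apply/funext => n; rewrite /zr /= (negbTE pP) /= andbT //.
set p := P.+1 in pP *.
pose dl m : R[i] := if m == p then dterm 0 sg t p else 0.
have dl_sum : sums_to dl (dterm 0 sg t p).
  move=> e e0; exists p.+1 => n pn.
  by rewrite -big_mkcond big_nat1_eq /= pn subrr cmod0 ltW.
have dl_abs : abs_summable dl.
  exists (cmod (dterm 0 sg t p)) => n.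
  rewrite (eq_bigr (fun m => if m == p then cmod (dterm 0 sg t p) else 0)).
    by rewrite -big_mkcond big_nat1_eq; case: ifP; rewrite ?cmod_ge0.
  by move=> m _; rewrite /dl; case: ifP; rewrite ?cmod0.
have zr0 : zr P sg t 0 = 0 by rewrite /zr dterm0 if_same.
have dl0 : dl 0%N = 0 by [].
rewrite mulrBr mulr1 -(csum_eq dl_sum) -csum_dconv //; last exact: zr_summable.
rewrite -csumB; [|exact: zr_summable|apply: abs_summable_dconv => //; exact: zr_summable].
congr csum; apply/funext => n; rewrite dconv_single // /zr [rough P.+1 n]/= -/p pP /=.
have [pn|pn] := boolP (p %| n)%N; last by rewrite andbT subr0.
rewrite andbF.
have -> : rough P (n %/ p) = rough P n.
  have h q : prime q -> (q <= P)%N -> (q %| n)%N = (q %| n %/ p)%N.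
    move=> pq qP; rewrite -[in LHS](divnK pn) Euclid_dvdM // (dvdn_prime2 pq pP).
    by rewrite (_ : q == p = false) ?orbF //; apply/eqP => e; move: qP; rewrite e ltnn.
  by apply/roughP/roughP => hh q pq qP; [rewrite h|rewrite -h] => //; exact: hh.
case: ifP => _; last by rewrite mul0r subrr.
by rewrite -dterm0M divnK // subrr.
Qed.

(** Every n between 2 and [P] has a prime factor at most [P], so only n = 1 survives up to [P]; the
    rest is at most the tail of n^(-sg). *)
Lemma csum_zr_ge P sg t e : 1 < sg -> (0 < P)%N ->
  expR (- (sg - 1) * ln P%:R) / (sg - 1) <= e -> 1 - e <= cmod (csum (zr P sg t)).
Proof.
move=> s1 P0 he.
have hz := zr_summable P t s1.
have E : \sum_(0 <= n < P.+1) zr P sg t n = 1.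
  rewrite big_ltn // big_ltn // /zr dterm0 if_same add0r.
  have -> : rough P 1 by apply/roughP => q pq _; rewrite dvdn1; case: q pq => [|[|q]].
  rewrite big_nat big1 => [|n /andP[n1 nP]]; last first.
    case: ifP => // /roughP /(_ (pdiv n) (pdiv_prime n1)).
    rewrite pdiv_dvd => h; exfalso; suff: ~~ true by []. apply: h.
    by rewrite (leq_trans (pdiv_leq _)) // ltnW.
  by rewrite addr0 /dterm expr0 /= ln1 !mulr0 oppr0 expR0 cis0 !mulr1.
rewrite (csum_split P.+1 hz) E; set T := csum _.
have hT : cmod T <= e.
  apply: csum_le => n; rewrite (le_trans _ he) //.
  apply: (@le_trans _ _ (\sum_(P <= m < n) pterm (1 + (sg - 1)) m.+1)); last first.
    have d0 : 0 < sg - 1 by lra.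
    exact: (sum_pterm_tail n d0 P0).
  have [nP|Pn] := leqP n P.+1.
    rewrite big_nat big1 => [|m /andP[_ mn]]; last by rewrite (leq_trans mn nP) cmod0.
    by apply: sumr_ge0 => m _; apply: pterm_ge0.
  rewrite (big_cat_nat (leq0n _) (ltnW Pn)) /= [X in X + _]big_nat [X in X + _]big1; last first.
    by move=> m /andP[_ ->]; rewrite cmod0.
  rewrite add0r big_add1; case: n Pn => // n Pn /=.
  have Pn' : (P <= n)%N by lia.
  rewrite [leRHS]big_nat_recr //= -[leLHS]addr0 lerD ?expR_ge0 //.
  apply: ler_sum => m _; case: ifP => _; first by rewrite cmod0 expR_ge0.
  rewrite /zr; case: ifP => _; last by rewrite cmod0 expR_ge0.
  by rewrite cmod_dterm expr0 mul1r subrKC.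
have := cmodB_ge 1 (- T); rewrite opprK cmod1 cmodN; lra.
Qed.

(* [x <= exp (x - 1)] for each of the factors turns the product into the 3-4-1 trigonometric
   polynomial. *)
Lemma three_four_one (r c : R) : 0 <= r -> -1 <= c <= 1 ->
  ((1 - r) ^+ 2) ^+ 3 * (1 - 2 * r * c + r ^+ 2) ^+ 4 *
  (1 - 2 * r * (2 * c ^+ 2 - 1) + r ^+ 2) <= expR (8 * r ^+ 2).
Proof.
move=> r0 /andP[c1 c2].
have quad (y : R) : 0 <= 1 - y -> 0 <= 1 + y -> 0 <= 1 - 2 * r * y + r ^+ 2.
  move=> y1 y2; have := mulr_ge0 y1 y2; have := sqr_ge0 (r - y); rewrite sqrrB; nra.
have c21 : 0 <= (1 - c) * (1 + c) by rewrite mulr_ge0; lra.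
have c20 := sqr_ge0 c.
have h (x : R) : x <= expR (x - 1) by have := expR_ge1Dx (x - 1); lra.
set A := (1 - r) ^+ 2; set B := 1 - 2 * r * c + r ^+ 2; set C := 1 - _ + _.
have A0 : 0 <= A by exact: sqr_ge0.
have B0 : 0 <= B by apply: quad; lra.
have C0 : 0 <= C by apply: quad; nra.
have gen (a b e : R) : 0 <= a -> 0 <= b -> 0 <= e ->
    a ^+ 3 * b ^+ 4 * e <= expR (a - 1) ^+ 3 * expR (b - 1) ^+ 4 * expR (e - 1).
  move=> a0 b0 e0; apply: ler_pM; rewrite ?mulr_ge0 ?exprn_ge0 ?h //.
  by apply: ler_pM; rewrite ?exprn_ge0 // lerXn2r ?nnegrE ?expR_ge0 ?h.
apply: (le_trans (gen _ _ _ A0 B0 C0)).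
rewrite -!expRM_natl -!expRD ler_expR /A /B /C.
have : 0 <= r * (1 + c) ^+ 2 by rewrite mulr_ge0 // sqr_ge0.
nra.
Qed.

(** For [P] large the eight sieved series are each at least 1/2 in modulus, whence 256 = 2^8. The
    square of the corresponding finite product is at most exp of the sum of 8 p^(-2), hence at most
    e^16, and the product itself at most e^8. *)
Lemma zeta_341 sg t : 1 < sg ->
  expR (- 8) / 256 <= cmod (Zs 0 sg 0) ^+ 3 * cmod (Zs 0 sg t) ^+ 4 * cmod (Zs 0 sg (2 * t)).
Proof.
move=> s1; have d0 : 0 < sg - 1 by lra.
have [P [P0 hP]] : exists P, (0 < P)%N /\ expR (- (sg - 1) * ln P%:R) / (sg - 1) <= 2^-1.
  have [N hN] := ln_nat_unbounded (2 / ((sg - 1) * (sg - 1))).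
  exists N.+1; split => //.
  have := hN N.+1 (leqnSn _); set u := ln _ => hu.
  have hu' : 2 <= (sg - 1) * ((sg - 1) * u) by move: hu; rewrite ler_pdivrMr ?mulr_gt0 //; lra.
  rewrite ler_pdivrMr // mulNr expRN.
  have h1 := expR_ge1Dx ((sg - 1) * u).
  have hp := expR_gt0 ((sg - 1) * u).
  rewrite -[leLHS]mul1r ler_pdivrMr //.
  have : (sg - 1) * ((sg - 1) * u) <= (sg - 1) * expR ((sg - 1) * u) by rewrite ler_pM2l //; lra.
  lra.
have z1 := csum_zr_ge 0 s1 P0 hP.
have z2 := csum_zr_ge t s1 P0 hP.
have z3 := csum_zr_ge (2 * t) s1 P0 hP.
rewrite !csum_zr // !cmodM in z1 z2 z3.
set p1 := cmod (\prod_(_ <= _ < _ | _) _) in z1.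
set p2 := cmod (\prod_(_ <= _ < _ | _) _) in z2.
set p3 := cmod (\prod_(_ <= _ < _ | _) _) in z3.
have half : 1 - 2^-1 = 2^-1 :> R by field.
rewrite half in z1 z2 z3.
have cos2 (x : R) : cos (2 * x) = 2 * cos x ^+ 2 - 1.
  by rewrite mulr_natl mulr2n cosD; have := cos2Dsin2 x; lra.
have prods : (p1 ^+ 3 * p2 ^+ 4 * p3) ^+ 2 <= expR 16.
  have cprod (I : Type) (s : seq I) (Q : pred I) (F : I -> R[i]) :
      cmod (\prod_(i <- s | Q i) F i) = \prod_(i <- s | Q i) cmod (F i).
    by elim/big_ind2: _ => [|z1' x1 z2' x2 <- <-|//]; rewrite ?cmod1 ?cmodM.
  rewrite /p1 /p2 /p3 !cprod -!prodrXl -!big_split -prodrXl /=.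
  apply: (@le_trans _ _ (\prod_(0 <= p < P.+1 | prime p) expR (8 * pterm 2 p))).
    have r2 q : pterm sg q ^+ 2 <= pterm 2 q :> R.
      rewrite expr2; case: q => [|q] /=; first by rewrite mulr0.
      rewrite -expRD ler_expR; have := ln_nat_ge0 R q.+1; nra.
    apply: ler_prod => p pp; rewrite sqr_ge0 /=.
    set r := pterm sg p; pose th := t * ln (p%:R : R).
    have r0 : 0 <= r := pterm_ge0 sg p.
    have D s : cmod (1 - dterm 0 sg s p) ^+ 2 = 1 - 2 * r * cos (s * ln p%:R) + r ^+ 2.
      rewrite /dterm expr0 mul1r -/r sqr_cmod ReD ImD ReN ImN ReZ ImZ /= cosN sinN.
      by have := cos2Dsin2 (s * ln p%:R); nra.
    apply: (@le_trans _ _ (expR (8 * r ^+ 2))); last by rewrite ler_expR ler_pM2l // r2.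
    have cc : -1 <= cos th <= 1 by rewrite cos_geN1 cos_le1.
    have := three_four_one r0 cc; congr (_ <= _).
    have D0 := D 0; rewrite mul0r cos0 in D0.
    have D2 := D (2 * t); rewrite (_ : 2 * t * _ = 2 * th) ?cos2 in D2; last by rewrite /th mulrA.
    have D1 := D t; rewrite -/th in D1.
    rewrite -D1 -D2 (_ : (1 - r) ^+ 2 = cmod (1 - dterm 0 sg 0 p) ^+ 2); last by rewrite D0; ring.
    ring.
  rewrite -expR_sum ler_expR -mulr_sumr.
  have h1 : 0 < 1 :> R by [].
  have := sum_pterm P.+1 h1; rewrite invr1.
  have : \sum_(0 <= p < P.+1 | prime p) pterm 2 p <= \sum_(0 <= n < P.+1) pterm (1 + 1) n :> R.
    by rewrite [leLHS]big_mkcond; apply: ler_sum => n _; case: ifP => // _; apply: pterm_ge0.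
  lra.
have pp0 : 0 <= p1 ^+ 3 * p2 ^+ 4 * p3 by rewrite !mulr_ge0 ?exprn_ge0 ?cmod_ge0.
have prod8 : p1 ^+ 3 * p2 ^+ 4 * p3 <= expR 8.
  rewrite -(ler_pXn2r (n := 2)) ?nnegrE ?expR_ge0 //.
  by rewrite (le_trans prods) // -expRM_natl ler_expR; lra.
set a1 := cmod (Zs 0 sg 0) in z1 *; set a2 := cmod (Zs 0 sg t) in z2 *.
set a3 := cmod (Zs _ _ _) in z3 *.
have q1 : 2^-1 ^+ 3 <= (a1 * p1) ^+ 3 by rewrite lerXn2r ?nnegrE ?mulr_ge0 ?cmod_ge0 //; lra.
have q2 : 2^-1 ^+ 4 <= (a2 * p2) ^+ 4 by rewrite lerXn2r ?nnegrE ?mulr_ge0 ?cmod_ge0 //; lra.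
have tot : 256^-1 <= (a1 ^+ 3 * a2 ^+ 4 * a3) * (p1 ^+ 3 * p2 ^+ 4 * p3).
  have -> : (a1 ^+ 3 * a2 ^+ 4 * a3) * (p1 ^+ 3 * p2 ^+ 4 * p3) =
    (a1 * p1) ^+ 3 * (a2 * p2) ^+ 4 * (a3 * p3) by ring.
  have -> : 256^-1 = 2^-1 ^+ 3 * 2^-1 ^+ 4 * 2^-1 :> R by field.
  by rewrite !ler_pM ?mulr_ge0 ?exprn_ge0 //; lra.
have aa0 : 0 <= a1 ^+ 3 * a2 ^+ 4 * a3 by rewrite !mulr_ge0 ?exprn_ge0 ?cmod_ge0.
rewrite expRN mulrC ler_pdivrMr ?expR_gt0 // (le_trans tot) //.
by rewrite ler_wpM2l.
Qed.

End EulerProduct.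

(** * Lower bound for zeta up to the line Re s = 1 *)

Section ZetaLowerBound.
Context (R : realType).
Implicit Types (sg t c : R).

(** A mean value inequality that asks for second-order increments instead of a derivative, so no
    series has to be differentiated: with m equal steps the quadratic errors add up to K (b - a)^2 /
    m. *)
Lemma cmod_subdivision (f : R -> R[i]) (a b D K : R) : a <= b -> 0 <= K ->
  (forall x y, a <= x -> x <= y -> y <= b ->
     cmod (f y - f x) <= D * (y - x) + K * (y - x) ^+ 2) ->
  cmod (f b - f a) <= D * (b - a).
Proof.
move=> ab K0 hf; apply/ler_addgt0Pr => e e0.
pose k := Num.bound (K * (b - a) ^+ 2 / e).
have q0 : 0 <= K * (b - a) ^+ 2 by rewrite mulr_ge0 ?sqr_ge0.
have hk : K * (b - a) ^+ 2 / e < k%:R by rewrite archi_boundP // divr_ge0 // ltW.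
pose m := k.+1; have m0 : 0 < m%:R :> R by rewrite ltr0n.
pose h := (b - a) / m%:R.
have h0 : 0 <= h by rewrite divr_ge0 // ?subr_ge0 // ltW.
have mh : h * m%:R = b - a by rewrite divfK // gt_eqF.
have step i : (i <= m)%N -> cmod (f (a + h * i%:R) - f a) <= (D * h + K * h ^+ 2) * i%:R.
  elim: i => [|i IH] im; first by rewrite !mulr0 addr0 subrr cmod0.
  have i1 : h * i.+1%:R <= h * m%:R by rewrite ler_wpM2l // ler_nat.
  have i2 : 0 <= h * i%:R by rewrite mulr_ge0.
  have s1 := IH (ltnW im).
  have iE : h * i.+1%:R = h * i%:R + h by rewrite -natr1 mulrDr mulr1.
  have s2 : cmod (f (a + h * i.+1%:R) - f (a + h * i%:R)) <= D * h + K * h ^+ 2.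
    have := hf (a + h * i%:R) (a + h * i.+1%:R).
    have -> : a + h * i.+1%:R - (a + h * i%:R) = h by rewrite iE; ring.
    by apply; [lra|rewrite iE; lra|move: i1; rewrite mh; lra].
  have -> : f (a + h * i.+1%:R) - f a =
    (f (a + h * i.+1%:R) - f (a + h * i%:R)) + (f (a + h * i%:R) - f a) by ring.
  have E : (D * h + K * h ^+ 2) * i.+1%:R = (D * h + K * h ^+ 2) + (D * h + K * h ^+ 2) * i%:R.
    by rewrite -natr1 mulrDr mulr1 addrC.
  by rewrite E (le_trans (cmodD _ _)) // lerD.
have := step m (leqnn _); rewrite mh subrKC => hm.
rewrite (le_trans hm) // mulrDl -mulrA mh lerD2l.
have -> : K * h ^+ 2 * m%:R = K * (b - a) ^+ 2 / m%:R by rewrite /h; field; rewrite gt_eqF.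
rewrite ler_pdivrMr //; move: hk; rewrite ltr_pdivrMr // => hk.
rewrite (le_trans (ltW hk)) // mulrC ler_wpM2l ?(ltW e0) // ler_nat /m; lia.
Qed.

(** Reduces to 0 <= e^(-z) - 1 + z <= z^2 for z >= 0; summed over [n], it gives the increments
    required by [cmod_subdivision]. *)
Lemma dterm_taylor (x y : R) t n : x <= y ->
  cmod (dterm 0 y t n - dterm 0 x t n + (y - x)%:C * dterm 1 x t n) <=
  (y - x) ^+ 2 * (ln n%:R ^+ 2 * pterm x n).
Proof.
move=> xy; case: n => [|n]; first by rewrite !dterm0 subr0 mulr0 addr0 cmod0 !mulr0.
rewrite /dterm /= expr0 !mul1r expr1.
set u := ln _; have u0 : 0 <= u := ln_nat_ge0 R n.+1.
have -> : expR (- y * u) = expR (- x * u) * expR (- ((y - x) * u)).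
  by rewrite -expRD; congr expR; ring.
set E := expR (- x * u); have E0 : 0 < E := expR_gt0 _.
set z := (y - x) * u; have z0 : 0 <= z by rewrite mulr_ge0 // subr_ge0.
have -> : (E * expR (- z))%:C * cis (- (t * u)) - E%:C * cis (- (t * u)) +
    (y - x)%:C * ((u * E)%:C * cis (- (t * u))) =
  (E * (expR (- z) - 1 + z))%:C * cis (- (t * u)) :> R[i].
  rewrite mulrA -mulrBl -mulrDl -rmorphM -rmorphB -rmorphD; congr (_ * _).
  by congr (_%:C); rewrite /z; ring.
rewrite cmodM cmod_cis mulr1 cmod_real.
have z1 : 1 - z <= expR (- z) by have := expR_ge1Dx (- z); lra.
have z2 : expR (- z) <= 1 - z + z ^+ 2.
  rewrite expRN -[leLHS]mul1r ler_pdivrMr ?expR_gt0 //.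
  have e1 := expR_ge1Dx z.
  have p1 : 0 <= 1 - z + z ^+ 2 by have := sqr_ge0 (z - 1); rewrite sqrrB; nra.
  have := ler_wpM2l p1 e1.
  have : 0 <= z ^+ 3 by rewrite exprn_ge0.
  lra.
rewrite ger0_norm; last by rewrite mulr_ge0 ?(ltW E0) //; lra.
have -> : (y - x) ^+ 2 * (u ^+ 2 * E) = E * z ^+ 2 by rewrite /z; ring.
rewrite ler_pM2l //; lra.
Qed.

Lemma zeta_lipschitz (a b t D : R) : 1 < a -> a <= b ->
  (forall sg, a <= sg <= b -> cmod (Zs 1 sg t) <= D) ->
  cmod (Zs 0 b t - Zs 0 a t) <= D * (b - a).
Proof.
move=> a1 ab hD; pose d := a - 1; have d0 : 0 < d by rewrite /d; lra.
pose K : R := 2`!%:R * (2 / d) ^+ 2 * (1 + 2 / d).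
have d2 : 0 <= 2 / d by rewrite divr_ge0 // ltW.
have K0 : 0 <= K by rewrite mulr_ge0 ?addr_ge0 // mulr_ge0 // exprn_ge0.
apply: (cmod_subdivision (f := fun s => Zs 0 s t) ab K0) => x y ax xy yb.
have x1 : 1 < x by lra.
have y1 : 1 < y by lra.
have T : abs_bound (fun n => dterm 0 y t n - dterm 0 x t n + (y - x)%:C * dterm 1 x t n)
    ((y - x) ^+ 2 * K).
  apply: (abs_summable_le (u := fun n => (y - x) ^+ 2 * (ln n%:R ^+ 2 * pterm (1 + d) n))).
    move=> n; rewrite (le_trans (dterm_taylor t n xy)) //.
    rewrite ler_wpM2l ?sqr_ge0 // ler_wpM2l ?sqr_ge0 // pterm_antimono // /d; lra.
  by move=> n; rewrite -mulr_sumr ler_wpM2l ?sqr_ge0 // sum_ln_pterm.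
have := csum_le T; rewrite csumD; last 2 first.
  by apply: abs_summableB; apply: dterm_summable.
  by apply: abs_summableZ; apply: dterm_summable.
rewrite csumB ?csumZ; [|exact: dterm_summable..].
rewrite -!/(Zs _ _ _) => h.
rewrite -[X in cmod X](addrK ((y - x)%:C * Zs 1 x t)).
rewrite (le_trans (cmodB _ _)) // addrC lerD //; last by rewrite [leRHS]mulrC.
rewrite cmodM cmod_real ger0_norm ?subr_ge0 // mulrC ler_wpM2r ?subr_ge0 //.
by rewrite hD // ax (le_trans xy).
Qed.

Lemma ell_double t : ell (2 * t) <= 2 * ell t.
Proof.
rewrite /ell normrM ger0_norm //; have t0 := normr_ge0 t.
have h : ln (2 + 2 * `|t|) <= 1 + ln (2 + `|t|).
  rewrite -ler_expR expRD !lnK ?posrE; [|lra..].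
  have := expR_ge1Dx (1 : R) => e1.
  apply: (@le_trans _ _ (2 * (2 + `|t|))); first by lra.
  by rewrite ler_wpM2r //; lra.
have : 0 <= ln (2 + `|t|) by rewrite ln_ge0 //; lra.
lra.
Qed.

(** At sg = 1 + d, the 3-4-1 inequality and |zeta(1 + d)| <= 3 / d give |zeta|^4 of order at least
    d^3 / ell, which degenerates as d tends to 0. Closer to the line, zeta is compared with its
    value at 1 + tau through the derivative bound C ell^2. The two balance for tau of order
    ell^(-9), which leaves tau ell^2, of order ell^(-7). *)
Lemma zeta_lower c : 0 < c -> c <= 1 -> exists k, [/\ 0 < k &
  forall sg t, 1 < sg <= 2 -> c <= `|t| -> k / ell t ^+ 7 <= cmod (Zs 0 sg t)].
Proof.
move=> c0 c1.
have [A0 [a0 hA0]] := Zs_far 0 c0 c1.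
have [A1 [a1 hA1]] := Zs_far 1 c0 c1.
pose C := 1 + A0 + A1; have C1 : 1 <= C by rewrite /C; lra.
have C0 : 0 < C by lra.
have [c' [c'0 c'1 h341]] : exists c' : R, [/\ 0 < c', c' <= 1 & forall sg t, 1 < sg ->
    c' <= cmod (Zs 0 sg 0) ^+ 3 * cmod (Zs 0 sg t) ^+ 4 * cmod (Zs 0 sg (2 * t))].
  exists (expR (- 8) / 256); split; [|have : expR (- 8 : R) <= 1 by rewrite expR_le1; lra|].
  - by rewrite divr_gt0 ?expR_gt0 ?ltr0n.
  - lra.
  - by move=> sg t; exact: zeta_341.
(* 54 = 27 * 2 comes from (3 / d)^3 and [ell (2 * t) <= 2 * ell t]; 864 = 54 * 2^4 is chosen so that
   at d = tau the inequality yields exactly twice the desired lower bound. *)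
have [q [q1 qE]] : exists q : R, 1 <= q /\ q = 864 by exists 864; split => //; lra.
pose k0 := c' / (q * C ^+ 5).
have C5 : 0 < q * C ^+ 5 by rewrite mulr_gt0 ?exprn_gt0 //; lra.
have k00 : 0 < k0 by rewrite divr_gt0.
have k0E : q * C ^+ 5 * k0 = c' by rewrite mulrC divfK // gt_eqF.
have k01 : k0 <= 1.
  rewrite ler_pdivrMr // mul1r (le_trans c'1) // (le_trans (exprn_ege1 5 C1)) //.
  by rewrite ler_peMl ?exprn_ge0 ?(ltW C0).
exists (C * k0); split; first by rewrite mulr_gt0.
move=> sg t hs ct; set l := ell t.
have l1 : 1 <= l := ell_ge1 t.
have l0 : 0 < l by lra.
have l9 : 0 < l ^+ 9 by rewrite exprn_gt0.
pose tau := k0 / l ^+ 9.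
have tau0 : 0 < tau by rewrite divr_gt0.
have tauE : tau * l ^+ 9 = k0 by rewrite divfK // gt_eqF.
have tau1 : tau <= 1 by rewrite ler_pdivrMr // mul1r (le_trans k01) // exprn_ege1.
have target : C * k0 / l ^+ 7 = C * tau * l ^+ 2.
  by rewrite -tauE; field; rewrite gt_eqF.
have ctl : 0 <= C * tau * l ^+ 2.
  apply: mulr_ge0; [apply: mulr_ge0|apply: exprn_ge0]; exact: ltW.
have big d : tau <= d -> d <= 1 -> 2 * (C * tau * l ^+ 2) <= cmod (Zs 0 (1 + d) t).
  move=> td d1; have d0 : 0 < d by lra.
  have s1 : 1 < 1 + d by lra.
  have h := h341 (1 + d) t s1.
  have z0 := cmod_zeta_real 0 d0 d1.
  have t2 : c <= `|2 * t| by rewrite normrM ger0_norm //; clear -ct c0; lra.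
  have s12 : 1 < 1 + d <= 2 by clear -s1 d1; apply/andP; split; lra.
  have z2 := hA0 (1 + d) (2 * t) s12 t2; rewrite expr1 in z2.
  have z2' : cmod (Zs 0 (1 + d) (2 * t)) <= C * (2 * l).
    rewrite (le_trans z2) //; have := ell_double t; rewrite -/l => el.
    rewrite ler_pM //; first by rewrite (le_trans ler01) // ell_ge1.
    by rewrite /C; clear -a1; lra.
  set X := cmod (Zs 0 (1 + d) t) in h *.
  have X0 : 0 <= X := cmod_ge0 _.
  have h2 : c' <= (3 / d) ^+ 3 * X ^+ 4 * (C * (2 * l)).
    rewrite (le_trans h) //; apply: ler_pM; rewrite ?mulr_ge0 ?exprn_ge0 ?cmod_ge0 //.
    by rewrite ler_wpM2r ?exprn_ge0 // lerXn2r ?nnegrE ?cmod_ge0 // divr_ge0 // ltW.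
  have h3 : c' * d ^+ 3 <= 54 * C * l * X ^+ 4.
    have d3 : 0 < d ^+ 3 by rewrite exprn_gt0.
    rewrite -ler_pdivlMr //; apply: (le_trans h2); rewrite le_eqVlt; apply/orP; left.
    by apply/eqP; field; rewrite gt_eqF.
  have h4 : c' * tau ^+ 3 <= 54 * C * l * X ^+ 4.
    by rewrite (le_trans _ h3) // ler_wpM2l ?(ltW c'0) // lerXn2r ?nnegrE ?(ltW tau0) ?(ltW d0).
  have h5 : 54 * C * l * (2 * (C * tau * l ^+ 2)) ^+ 4 = c' * tau ^+ 3.
    by rewrite -k0E -tauE qE; ring.
  have Cl : 0 < 54 * C * l by rewrite !mulr_gt0.
  rewrite -h5 ler_pM2l // in h4.
  rewrite -(ler_pXn2r (n := 4)) ?nnegrE //.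
  by rewrite mulr_ge0.
rewrite target.
case/andP: hs => s1 s2.
have [ts|st] := leP tau (sg - 1).
  have sg2 : sg - 1 <= 1 by clear -s2; lra.
  have := big (sg - 1) ts sg2; rewrite subrKC; apply: le_trans.
  by rewrite mulr_natl mulr2n lerDl.
(* Between the line and 1 + tau the variation of zeta is at most half of its lower bound at 1 +
   tau. *)
have b1 := big tau (lexx _) tau1.
have lip : cmod (Zs 0 (1 + tau) t - Zs 0 sg t) <= C * l ^+ 2 * (1 + tau - sg).
  apply: zeta_lipschitz => //; first by lra.
  move=> s /andP[sa sb].
  have s12 : 1 < s <= 2 by clear -s1 sa sb tau1; apply/andP; split; lra.
  rewrite (le_trans (hA1 s t s12 ct)) // ler_wpM2r ?exprn_ge0 ?(ltW l0) //.
  by rewrite /C; lra.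
have lip2 : C * l ^+ 2 * (1 + tau - sg) <= C * tau * l ^+ 2.
  rewrite -[leRHS]mulrA [tau * _]mulrC [leRHS]mulrA ler_wpM2l ?mulr_ge0 ?exprn_ge0 ?(ltW C0) ?(ltW l0) //.
  by clear -s1; lra.
have := cmodB_ge (Zs 0 (1 + tau) t) (Zs 0 (1 + tau) t - Zs 0 sg t).
rewrite subKr; apply: le_trans.
rewrite lerBrDr (le_trans _ b1) // mulr_natl mulr2n lerD2l.
exact: (le_trans lip lip2).
Qed.

End ZetaLowerBound.

(** * The von Mangoldt function *)

Section VonMangoldt.
Context (R : realType).

(** At most one pair (p, i) contributes. In this form a sum over [n] can be exchanged with the sums
    over [p] and [i]. *)
Definition vonM n : R :=
  \sum_(0 <= p < n.+1 | prime p) \sum_(1 <= i < n.+1 | (p ^ i == n)%N) ln p%:R.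

Lemma vonME X n : (n < X)%N -> vonM n =
  \sum_(0 <= p < X | prime p) \sum_(1 <= i < X | (p ^ i == n)%N) ln p%:R.
Proof.
move=> nX; have h p i : prime p -> (p ^ i == n)%N -> (0 < i)%N -> (p < n.+1)%N && (i < n.+1)%N.
  move=> pp /eqP <- i0; have p1 := prime_gt1 pp.
  by rewrite !ltnS -[X in (X <= _)%N && _]expn1 leq_exp2l // i0 ltnW // ltn_expl.
rewrite /vonM [RHS](big_cat_nat (n := n.+1)) //= [X in _ = _ + X]big_nat_cond [X in _ = _ + X]big1 ?addr0; last first.
  move=> p /andP[/andP[np _] pp]; rewrite big_nat_cond big1 // => i /andP[/andP[i1 _] e].
  by have := h p i pp e i1; rewrite (ltnNge p) np.
apply: eq_bigr => p pp; rewrite [RHS](big_cat_nat (n := n.+1)) //=.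
rewrite [X in _ = _ + X]big_nat_cond [X in _ = _ + X]big1 ?addr0 //.
move=> i /andP[/andP[ni _] e].
by have := h p i pp e (leq_trans (ltn0Sn _) ni); rewrite (ltnNge i) ni andbF.
Qed.

Lemma vonM_ge0 n : 0 <= vonM n.
Proof.
by apply: sumr_ge0 => p _; apply: sumr_ge0 => i _; apply: ln_nat_ge0.
Qed.

Lemma sum_vonM_dvd n : (0 < n)%N ->
  \sum_(0 <= d < n.+1 | (d %| n)%N) vonM d = ln n%:R.
Proof.
move=> n0; rewrite big_nat_cond.
under eq_bigr => d /andP[/andP[_ dn] _] do rewrite (vonME dn).
rewrite -big_nat_cond exchange_big /=.
transitivity (\sum_(0 <= p < n.+1 | prime p) (ln (p%:R : R) *+ logn p n)).
  apply: eq_bigr => p pp; have p1 := prime_gt1 pp.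
  rewrite (exchange_big_dep xpredT) //=.
  transitivity (\sum_(1 <= i < n.+1) if (i <= logn p n)%N then ln (p%:R : R) else 0).
    rewrite big_nat [RHS]big_nat; apply: eq_bigr => i /andP[i1 iN].
    rewrite -pfactor_dvdn //.
    case: ifP => pin.
      rewrite (eq_bigl (fun d => d == p ^ i)%N) => [|d].
        by rewrite big_nat1_eq /= ltnS dvdn_leq.
      by rewrite eq_sym; case: eqP => [->|]; rewrite ?pin ?andbF.
    rewrite big1 // => d /andP[dn /eqP e]; move: pin; rewrite e dn //.
  rewrite -big_mkcond (eq_bigl (fun i => i < (logn p n).+1)%N) //.
  have ln_n : ((logn p n).+1 <= n.+1)%N by rewrite ltnS ltnW // ltn_logl.
  rewrite (big_cat_nat (n := (logn p n).+1)) //= [X in _ + X]big_nat_cond [X in _ + X]big1 ?addr0.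
    rewrite big_nat_cond (eq_bigl (fun i => 0 < i < (logn p n).+1)%N) => [|i]; last by rewrite -andbA andbb.
    by rewrite -big_nat big_const_nat iter_addr_0 subn1.
  by move=> i /andP[/andP[a _]]; rewrite ltnNge a.
transitivity (\sum_(0 <= p < n.+1) (ln (p%:R : R) *+ logn p n)).
  rewrite [LHS]big_mkcond; apply: eq_bigr => p _; case: ifP => // pp.
  by rewrite lognE pp /= mulr0n.
have e := partnT n0; rewrite -[in RHS]e /partn.
have hp (s : seq nat) : ln ((\prod_(p <- s) p ^ logn p n)%:R : R) = \sum_(p <- s) ln (p%:R : R) *+ logn p n
   /\ (0 < \prod_(p <- s) p ^ logn p n)%N.
  elim: s => [|p s [IH1 IH2]]; first by rewrite !big_nil ln1.
  have p0 : (0 < p ^ logn p n)%N by rewrite expn_gt0; case: p => //=; rewrite lognE.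
  rewrite !big_cons muln_gt0 p0 IH2; split => //.
  rewrite natrM lnM ?posrE ?ltr0n // IH1; congr (_ + _).
  case: p p0 => [|p] _; first by rewrite lognE /= expn0 ln1 mulr0n.
  by rewrite natrX lnXn // ltr0n.
by rewrite -(proj1 (hp _)) /=.
Qed.

Lemma vonM_le n : vonM n <= ln n%:R.
Proof.
case: n => [|n].
  by rewrite /vonM big_mkcond big_nat1 /= ln0.
rewrite -sum_vonM_dvd // big_mkcond big_nat_recr //= dvdnn lerDr.
by apply: sumr_ge0 => d _; case: ifP => // _; apply: vonM_ge0.
Qed.

End VonMangoldt.

(** * Derivatives of the logarithmic derivative of zeta *)

Section LogDerivative.
Context (R : realType).
Implicit Types (sg t : R).

Definition vterm k sg t n : R[i] := (vonM R n)%:C * dterm k sg t n.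

Lemma vterm0 k sg t : vterm k sg t 0 = 0.
Proof. by rewrite /vterm dterm0 mulr0. Qed.

Lemma vterm_summable k sg t : 1 < sg -> abs_summable (vterm k sg t).
Proof.
move=> s1; have [B hB] := dterm_summable k.+1 t s1; exists B.
apply: (abs_summable_le _ hB) => n.
rewrite /vterm cmodM !cmod_dterm cmod_real ger0_norm ?vonM_ge0 // exprS -mulrA.
by rewrite ler_wpM2r ?vonM_le // mulr_ge0 ?pterm_ge0 ?exprn_ge0 ?ln_nat_ge0.
Qed.

(* [(-1)^(k+1) (zeta'/zeta)^(k)(sg + i t)] *)
Definition Lv k sg t := csum (vterm k sg t).

(** The Leibniz rule for (- zeta' / zeta) zeta at the level of coefficients: one factor log n is
    expanded as the divisor sum of Lambda, the remaining power by the binomial formula for log d +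
    log (n / d). *)
Lemma dterm_vonM k sg t n :
  dterm k.+1 sg t n =
  \sum_(j < k.+1) 'C(k, j)%:R * dconv (vterm j sg t) (dterm (k - j) sg t) n.
Proof.
case: n => [|n].
  rewrite dterm0 big1 // => j _; rewrite /dconv big_mkcond big_nat1 /=.
  by rewrite vterm0 mul0r mulr0.
set N := n.+1.
under eq_bigr => j _ do rewrite /dconv mulr_sumr.
transitivity ((ln (N%:R : R) ^+ k)%:C * (\sum_(0 <= d < N.+1 | (d %| N)%N) (vonM R d)%:C) * dterm 0 sg t N).
  by rewrite dterm_ln exprSr rmorphM -rmorph_sum sum_vonM_dvd.
rewrite exchange_big /= mulr_sumr mulr_suml big_mkcond [RHS]big_mkcond big_nat [RHS]big_nat.
apply: eq_bigr => d /andP[_ dN]; case: ifP => // dn.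
have d0 : (0 < d)%N by rewrite (dvdn_gt0 _ dn).
have q0 : (0 < N %/ d)%N by rewrite divn_gt0 // dvdn_leq.
have lnN : ln (N%:R : R) = ln (N %/ d)%:R + ln d%:R.
  by rewrite -lnM ?posrE ?ltr0n // -natrM divnK.
have dt : dterm 0 sg t N = dterm 0 sg t d * dterm 0 sg t (N %/ d).
  by rewrite -dterm0M mulnC divnK.
rewrite lnN exprDn rmorph_sum !mulr_suml; apply: eq_bigr => j _.
rewrite /vterm (dterm_ln j sg t d) (dterm_ln (k - j) sg t (N %/ d)) dt.
rewrite rmorphMn rmorphM /= -mulr_natl; ring.
Qed.

Lemma Zs_rec k sg t : 1 < sg ->
  Zs k.+1 sg t = \sum_(j < k.+1) 'C(k, j)%:R * (Lv j sg t * Zs (k - j) sg t).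
Proof.
move=> s1; rewrite /Zs (_ : dterm k.+1 sg t = fun n =>
  \sum_(j < k.+1) 'C(k, j)%:R * dconv (vterm j sg t) (dterm (k - j) sg t) n); last first.
  by apply/funext => n; exact: dterm_vonM.
have hs (j : 'I_k.+1) : abs_summable (dconv (vterm j sg t) (dterm (k - j) sg t)).
  apply: abs_summable_dconv; rewrite ?vterm0 ?dterm0 //.
    exact: vterm_summable.
  exact: dterm_summable.
rewrite (proj2 (csum_sum (index_enum _) (F := fun (j : 'I_k.+1) n => 'C(k, j)%:R * dconv (vterm j sg t) (dterm (k - j) sg t) n) _)); last first.
  by move=> j; apply: abs_summableZ.
apply: eq_bigr => j _; rewrite csumZ // csum_dconv ?vterm0 ?dterm0 //.
  exact: vterm_summable.
exact: dterm_summable.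
Qed.

(** The recurrence isolates [Q i] times [D 0]: an earlier term costs B^(2j + 2) B, and dividing by
    [D 0] one more B. It is stated for arbitrary sequences because it serves for zeta away from s =
    1 and for (s - 1) zeta(s) near it. *)
Lemma rec_bound k : exists c : R, 1 <= c /\ forall (D Q : nat -> R[i]) (B : R), 1 <= B ->
  (forall j, (j <= k.+1)%N -> cmod (D j) <= B) -> B^-1 <= cmod (D 0%N) ->
  (forall i, (i <= k)%N -> D i.+1 = \sum_(j < i.+1) 'C(i, j)%:R * (Q j * D (i - j)%N)) ->
  forall i, (i <= k)%N -> cmod (Q i) <= c * B ^+ (2 * i + 2).
Proof.
have natC n : cmod (n%:R : R[i]) = n%:R.
  by rewrite -(rmorph_nat (real_complex R)) cmod_real ger0_norm.
have key (D Q : nat -> R[i]) (B : R) : 1 <= B -> B^-1 <= cmod (D 0%N) ->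
    forall z, cmod z <= B * cmod (z * D 0%N).
  move=> B1 hB z; rewrite cmodM mulrCA ler_peMr ?cmod_ge0 //.
  by rewrite -ler_pdivrMl ?mulr1 //; lra.
elim: k => [|k [c [c1 IH]]].
  exists 1; split => // D Q B B1 hD hD0 hrec i; rewrite leqn0 => /eqP ->.
  have := hrec 0%N isT; rewrite big_ord_recl big_ord0 addr0 /= bin0 mul1r => e.
  have {}e : D 1%N = Q 0%N * D 0%N := etrans e (mul1r _).
  rewrite (le_trans (key D Q B B1 hD0 _)) // -e.
  rewrite -[leRHS]/(B ^+ 2) expr2.
  by rewrite ler_wpM2l ?hD //; lra.
pose c' : R := 1 + \sum_(j < k.+1) 'C(k.+1, j)%:R * c.
have c'0 : 0 <= \sum_(j < k.+1) 'C(k.+1, j)%:R * c.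
  by apply: sumr_ge0 => j _; rewrite mulr_ge0 //; lra.
exists (c + c'); split; first by rewrite /c'; lra.
move=> D Q B B1 hD hD0 hrec.
have B0 : 0 <= B by lra.
have IHk i : (i <= k)%N -> cmod (Q i) <= c * B ^+ (2 * i + 2).
  apply: (IH D Q B B1 _ hD0) => j jk; first by apply: hD; rewrite leqW.
  by apply: hrec; rewrite leqW.
move=> i; rewrite leq_eqVlt => /orP[/eqP ->|]; last first.
  rewrite ltnS => ik; rewrite (le_trans (IHk i ik)) // ler_wpM2r ?exprn_ge0 //.
  by rewrite /c'; lra.
have := hrec k.+1 (leqnn _); rewrite big_ord_recr /= binn mul1r subnn => e.
have e' : Q k.+1 * D 0%N = D k.+2 - \sum_(j < k.+1) 'C(k.+1, j)%:R * (Q j * D (k.+1 - j)%N).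
  by rewrite e addrAC subrr add0r.
rewrite (le_trans (key D Q B B1 hD0 _)) // e'.
have S : cmod (D k.+2 - \sum_(j < k.+1) 'C(k.+1, j)%:R * (Q j * D (k.+1 - j)%N)) <=
    c' * B ^+ (2 * k.+1 + 1).
  rewrite (le_trans (cmodB _ _)) // /c' mulrDl mul1r lerD //.
    rewrite (le_trans (hD _ (leqnn _))) // -[leLHS]expr1 ler_weXn2l //; lia.
  rewrite (le_trans (cmod_sum _ _ _)) // mulr_suml; apply: ler_sum => j _.
  rewrite !cmodM natC -mulrA ler_wpM2l //.
  have jk : (j <= k)%N by rewrite -ltnS.
  apply: (@le_trans _ _ (c * B ^+ (2 * j + 2) * B)).
    rewrite ler_pM ?cmod_ge0 ?IHk // hD //.
    by rewrite (leq_trans (leq_subr _ _)).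
  rewrite -mulrA -exprSr ler_wpM2l //; first by lra.
  by rewrite ler_weXn2l //; lia.
rewrite (le_trans (ler_wpM2l B0 S)) // mulrCA -exprS.
have -> : (2 * k.+1 + 1).+1 = (2 * k.+1 + 2)%N by lia.
by rewrite ler_wpM2r ?exprn_ge0 //; lra.
Qed.

End LogDerivative.

(** * Removing the pole from the recurrence *)

Section RegularPart.
Context (F : fieldType).

Lemma sum_bin4 (a : nat -> F) :
  [/\ \sum_(j < 1) 'C(0, j)%:R * a j = a 0%N,
      \sum_(j < 2) 'C(1, j)%:R * a j = a 0%N + a 1%N,
      \sum_(j < 3) 'C(2, j)%:R * a j = a 0%N + 2 * a 1%N + a 2%N,
      \sum_(j < 4) 'C(3, j)%:R * a j = a 0%N + 3 * a 1%N + 3 * a 2%N + a 3%N &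
      \sum_(j < 5) 'C(4, j)%:R * a j = a 0%N + 4 * a 1%N + 6 * a 2%N + 4 * a 3%N + a 4%N].
Proof.
have b42 : 'C(4, 2) = 6%N by []. have b32 : 'C(3, 2) = 3%N by [].
have b43 : 'C(4, 3) = 4%N by [].
by split; rewrite !big_ord_recr big_ord0 /= ?bin0 ?b42 ?b32 ?b43 ?bin1 ?binn ?mul1r ?add0r.
Qed.

(** With v = s - 1, [v * Z j - j * Z j.-1] is (-1)^j times the j-th derivative of v zeta, and
    [L j - j! / v^(j+1)] is that of - zeta' / zeta - 1 / v, which is minus the logarithmic
    derivative of v zeta. The identity is purely rational, and is checked for each order up to 4. *)
Lemma regular_part_rec (v : F) (Z L : nat -> F) : v != 0 ->
  (forall k, (k <= 4)%N -> Z k.+1 = \sum_(j < k.+1) 'C(k, j)%:R * (L j * Z (k - j)%N)) ->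
  forall i, (i <= 4)%N ->
  v * Z i.+1 - i.+1%:R * Z i =
  \sum_(j < i.+1) 'C(i, j)%:R * ((L j - j`!%:R / v ^+ j.+1) *
    (v * Z (i - j)%N - (i - j)%:R * Z (i - j).-1)).
Proof.
move=> v0 h.
have := h 0%N isT; have := h 1%N isT; have := h 2%N isT; have := h 3%N isT; have := h 4%N isT.
have [_ _ _ _ ->] := sum_bin4 (fun j => L j * Z (4 - j)%N).
have [_ _ _ -> _] := sum_bin4 (fun j => L j * Z (3 - j)%N).
have [_ _ -> _ _] := sum_bin4 (fun j => L j * Z (2 - j)%N).
have [_ -> _ _ _] := sum_bin4 (fun j => L j * Z (1 - j)%N).
have [-> _ _ _ _] := sum_bin4 (fun j => L j * Z (0 - j)%N).
rewrite /subn /= => r4 r3 r2 r1 r0 i.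
have fact1 : 1`! = 1%N by []. have f2 : 2`! = 2%N by []. have f3 : 3`! = 6%N by []. have f4 : 4`! = 24%N by [].
pose T i j := (L j - j`!%:R / v ^+ j.+1) *
    (v * Z (i - j)%N - (i - j)%:R * Z (i - j).-1).
case: i => [|[|[|[|[|//]]]]] _.
- by have [E _ _ _ _] := sum_bin4 (T 0%N); rewrite [RHS]E /T /subn /= r0 ?fact1 ?fact0; field.
- by have [_ E _ _ _] := sum_bin4 (T 1%N); rewrite [RHS]E /T /subn /= r1 r0 ?fact1 ?fact0; field.
- by have [_ _ E _ _] := sum_bin4 (T 2%N); rewrite [RHS]E /T /subn /= r2 r1 r0 ?f2 ?fact1 ?fact0; field.
- by have [_ _ _ E _] := sum_bin4 (T 3%N); rewrite [RHS]E /T /subn /= r3 r2 r1 r0 ?f3 ?f2 ?fact1 ?fact0; field.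
- by have [_ _ _ _ E] := sum_bin4 (T 4%N); rewrite [RHS]E /T /subn /= r4 r3 r2 r1 r0 ?f4 ?f3 ?f2 ?fact1 ?fact0; field.
Qed.

End RegularPart.

(** * Polylogarithmic bounds for the fourth derivative *)

Section LogDerivativeBound.
Context (R : realType).
Implicit Types (sg t c : R).

Lemma ell_pow_le t (m n : nat) : (m <= n)%N -> ell t ^+ m <= ell t ^+ n.
Proof. by move=> mn; rewrite ler_weXn2l // ell_ge1. Qed.

Lemma exists_common_bound (P : nat -> R -> Prop) n :
  (forall j (a b : R), P j a -> a <= b -> P j b) ->
  (forall j, exists C, P j C) ->
  exists C : R, 0 <= C /\ forall j, (j <= n)%N -> P j C.
Proof.
move=> mono hP; elim: n => [|n [C [C0 IH]]].
  have [C hC] := hP 0%N; exists (Num.max 0 C); split; first by rewrite le_max lexx.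
  by move=> j; rewrite leqn0 => /eqP ->; apply: mono hC _; rewrite le_max lexx orbT.
have [C' hC'] := hP n.+1; exists (Num.max C C'); split; first by rewrite le_max C0.
move=> j; rewrite leq_eqVlt => /orP[/eqP ->|jn].
  by apply: mono hC' _; rewrite le_max lexx orbT.
by apply: mono (IH j jn) _; rewrite le_max lexx.
Qed.

Lemma Lv_far k c : 0 < c -> c <= 1 -> exists C, 0 <= C /\
  forall sg t, 1 < sg <= 2 -> c <= `|t| ->
    cmod (Lv k sg t) <= C * ell t ^+ ((k + 7) * (2 * k + 2)).
Proof.
move=> c0 c1; have [a [a1 hrec]] := rec_bound R k.
have [A [A0 hA]] : exists C, 0 <= C /\ forall j, (j <= k.+1)%N ->
    forall sg t, 1 < sg <= 2 -> c <= `|t| -> cmod (Zs j sg t) <= C * ell t ^+ j.+1.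
  apply: (exists_common_bound (P := fun j C => forall sg t, 1 < sg <= 2 -> c <= `|t| -> cmod (Zs j sg t) <= C * ell t ^+ j.+1)).
    move=> j x y hx xy sg t h1 h2; rewrite (le_trans (hx sg t h1 h2)) //.
    by rewrite ler_wpM2r // exprn_ge0 // (le_trans _ (ell_ge1 t)).
  by move=> j; have [C [_ hC]] := Zs_far j c0 c1; exists C.
have [b [b0 hb]] := zeta_lower c0 c1.
pose C := 1 + A + b^-1.
have bi : 0 < b^-1 by rewrite invr_gt0.
have C1 : 1 <= C by rewrite /C; lra.
have AC : A <= C by rewrite /C; lra.
have bC : b^-1 <= C by rewrite /C; lra.
exists (a * C ^+ (2 * k + 2)); split; first by rewrite mulr_ge0 ?exprn_ge0; lra.
move=> sg t hs ct; set l := ell t; have l1 : 1 <= l := ell_ge1 t.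
have l0 : 0 <= l by lra.
have lp : 1 <= l ^+ (k + 7) by rewrite exprn_ege1.
have s1 : 1 < sg by case/andP: hs.
(* B = C l^(k + 7) dominates both the derivatives up to order k + 1, of size l^(k + 2), and 1 /
   |zeta|, of size l^7. *)
have := hrec (fun j => Zs j sg t) (fun j => Lv j sg t) (C * l ^+ (k + 7)) _ _ _ _ k (leqnn k).
rewrite exprMn -exprM mulrA; apply.
- by rewrite -[1]mulr1 ler_pM.
- move=> j jk; have jk7 : (j.+1 <= k + 7)%N by clear -jk; lia.
  rewrite (le_trans (hA j jk sg t hs ct)) //.
  by rewrite ler_pM ?exprn_ge0 // ler_weXn2l.
- rewrite (le_trans _ (hb sg t hs ct)) // invfM.
  have C0 : 0 < C by lra.
  have l0' : 0 < l by lra.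
  have Cb : C^-1 <= b by rewrite -[leRHS]invrK lef_pV2 ?posrE.
  have ll : l ^- (k + 7) <= l ^- 7.
    by rewrite lef_pV2 ?posrE ?exprn_gt0 // ler_weXn2l // leq_addl.
  by rewrite ler_pM ?invr_ge0 ?exprn_ge0 // ltW.
- by move=> i ik; exact: Zs_rec.
Qed.

(* Near [s = 1], [D = (s - 1) zeta(s)] is regular and nonzero, and the regular part of the
   logarithmic derivative satisfies the same recurrence with [D] in place of [zeta]. *)
Lemma Lv4_near : exists (C c : R), [/\ 0 <= C, 0 < c, c <= 1 &
  forall sg t, 1 < sg <= 1 + c -> `|t| <= c -> cmod (Lv 4 sg t - Zs 4 sg t) <= C].
Proof.
have [a [a1 hrec]] := rec_bound R 4.
have [G [G0 hG]] : exists C, 0 <= C /\ forall j, (j <= 5)%N -> 6 * Rmc R j <= C.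
  apply: (exists_common_bound (P := fun j C => 6 * Rmc R j <= C)).
    by move=> j x y h; apply: le_trans.
  by move=> j; exists (6 * Rmc R j).
(* Since |v| <= 2 c, this gives |v g| <= 1/2 for the regular parts [g], so [D 0] stays within 1/2 of
   1 and can be divided by. *)
pose c : R := (4 * (1 + G))^-1.
have c0 : 0 < c by rewrite invr_gt0; lra.
have cG : c * (4 * (1 + G)) = 1 by rewrite mulVf // gt_eqF; lra.
have c1 : c <= 1 by nra.
pose B : R := 2 + 7 * G.
exists (a * B ^+ 10 + G), c; split => //.
  by rewrite addr_ge0 // mulr_ge0 ?exprn_ge0 /B; lra.
move=> sg t /andP[s1 s2] tc; set v : R[i] := (sg - 1) +i* t.
have v0 : v != 0 by rewrite eq_complex /= negb_and subr_eq0 gt_eqF.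
have hs : 1 < sg <= 2 by apply/andP; split; lra.
have t1 : `|t| <= 1 by lra.
have vc : cmod v <= 2 * c by have := cmod_v_le t (ltW s1); rewrite -/v; lra.
pose g j := Zs j sg t - j`!%:R / v ^+ j.+1.
have gG j : (j <= 5)%N -> cmod (g j) <= G.
  by move=> j5; rewrite (le_trans (Zs_near j hs t1)) // hG.
have ZE j : Zs j sg t = j`!%:R / v ^+ j.+1 + g j by rewrite /g addrC subrK.
pose D j := v * Zs j sg t - j%:R * Zs j.-1 sg t.
pose Q j := Lv j sg t - j`!%:R / v ^+ j.+1.
have natC n : cmod (n%:R : R[i]) = n%:R.
  by rewrite -(rmorph_nat (real_complex R)) cmod_real ger0_norm.
have D0E : D 0%N = 1 + v * g 0%N.
  by rewrite /D /g mul0r subr0 fact0 expr1; field.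
have DE j : D j.+1 = v * g j.+1 - j.+1%:R * g j.
  rewrite /D [in RHS]/g /= factS natrM [v ^+ j.+2]exprS; field.
  by rewrite expf_neq0 //= v0.
have vg j : (j <= 5)%N -> cmod (v * g j) <= 2^-1.
  move=> j5; rewrite cmodM (@le_trans _ _ (2 * c * G)) //.
    by rewrite ler_pM ?cmod_ge0 ?gG.
  have := cG; nra.
have Q4 : cmod (Q 4%N) <= a * B ^+ 10.
  apply: (hrec D Q B _ _ _ _ 4%N (leqnn _)); first by rewrite /B; lra.
  - case=> [|j] j5.
      by rewrite D0E (le_trans (cmodD _ _)) // cmod1; have := vg 0%N isT; rewrite /B; lra.
    rewrite DE (le_trans (cmodB _ _)) //.
    have h1 := vg j.+1 j5.
    have h2 : cmod (j.+1%:R * g j) <= 5 * G.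
      rewrite cmodM natC ler_pM ?cmod_ge0 ?gG // ?ler_nat //; exact: ltnW.
    by rewrite /B; lra.
  - rewrite D0E; have := cmodB_ge 1 (- (v * g 0%N)); rewrite opprK cmod1 cmodN.
    have := vg 0%N isT.
    have : B^-1 <= 2^-1 by rewrite lef_pV2 ?posrE /B; lra.
    lra.
  - move=> i i4; apply: (regular_part_rec (Z := fun j => Zs j sg t) (L := fun j => Lv j sg t) v0 _ i4).
    by move=> n _; exact: Zs_rec.
have -> : Lv 4 sg t - Zs 4 sg t = Q 4%N - g 4%N by rewrite /Q /g; ring.
by rewrite (le_trans (cmodB _ _)) // lerD // gG.
Qed.

(** 110 is the exponent (k + 7) (2 k + 2) of [Lv_far] at k = 4. The two functions are taken together
    near s = 1, where their poles cancel, and separately elsewhere. *)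
Lemma Lv4_bound : exists (C c : R), [/\ 0 <= C, 0 < c, c <= 1 &
  forall sg t, 1 < sg <= 1 + c -> cmod (Lv 4 sg t - Zs 4 sg t) <= C * ell t ^+ 110].
Proof.
have [C1 [c [C10 c0 c1 h1]]] := Lv4_near.
have [C2 [C20 h2]] := Lv_far 4 c0 c1.
have [C3 [C30 h3]] := Zs_far 4 c0 c1.
exists (C1 + C2 + C3), c; split => //; first by lra.
move=> sg t hs; have l1 := ell_ge1 t.
have lp n : 1 <= ell t ^+ n by rewrite exprn_ege1.
have [tc|tc] := leP `|t| c.
  rewrite (le_trans (h1 sg t hs tc)) // -[leLHS]mulr1 ler_pM //; lra.
have hs2 : 1 < sg <= 2 by case/andP: hs => a b; apply/andP; split; lra.
rewrite (le_trans (cmodB _ _)) //.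
have a1 := h2 sg t hs2 (ltW tc); have a2 := h3 sg t hs2 (ltW tc).
have a3 : C3 * ell t ^+ 5 <= C3 * ell t ^+ 110 by rewrite ler_wpM2l // ell_pow_le.
have a4 : 0 <= C1 * ell t ^+ 110 by rewrite mulr_ge0 // (le_trans _ (lp _)).
rewrite !mulrDl; lra.
Qed.

End LogDerivativeBound.

(** * Truncated Fourier series of the sawtooth *)

Section Sawtooth.
Context (R : realType).
Implicit Types (x : R).

(** The Fourier partial sum of the function equal to (pi - x) / 2 on (0, 2 pi), which jumps by pi at
    0. *)
Definition saw N x : R := \sum_(1 <= j < N.+1) sin (j%:R * x) / j%:R.

Lemma saw_odd N x : saw N (- x) = - saw N x.
Proof. by rewrite /saw -sumrN; apply: eq_bigr => j _; rewrite mulrN sinN mulNr. Qed.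

Lemma sum_inv1_le N : \sum_(1 <= j < N.+1) j%:R^-1 <= 1 + ln (N%:R : R).
Proof.
case: N => [|N]; first by rewrite big_geq // ln0 // addr0.
have := sum_inv_le R (ltn0Sn N); rewrite big_ltn //= add0r.
congr (_ <= _); apply: eq_big_nat => -[//|j] _.
by rewrite /= mulN1r expRN lnK ?posrE ?ltr0n.
Qed.

Lemma saw_le N x : `|saw N x| <= 1 + ln (N%:R : R).
Proof.
rewrite (le_trans _ (sum_inv1_le N)) // (le_trans (ler_norm_sum _ _ _)) //.
apply: ler_sum => j _; rewrite normrM [X in _ * X]ger0_norm //.
by rewrite ler_piMl ?sin_max.
Qed.

Lemma is_derive_comp_lin (f : R -> R) (a x d : R) : is_derive (a * x) 1 f d ->
  is_derive x 1 (fun u => f (a * u)) (a * d).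
Proof.
move=> h; apply: (is_derive_eq (is_derive1_comp h (is_derive_lin a x))).
by rewrite mulrC.
Qed.

Lemma is_derive_saw N x : is_derive x 1 (saw N) (\sum_(1 <= j < N.+1) cos (j%:R * x)).
Proof.
elim: N => [|N IH].
  rewrite big_geq // (_ : saw 0 = cst 0); first exact: is_derive_cst.
  by apply/funext => u; rewrite /saw big_geq.
rewrite big_nat_recr //= (_ : saw N.+1 = saw N + (N.+1%:R^-1 \*: (fun u => sin (N.+1%:R * u)))).
  have h := is_deriveZ N.+1%:R^-1 (is_derive_comp_lin (is_derive_sin (N.+1%:R * x))).
  apply: (is_derive_eq (is_deriveD IH h)).
  by rewrite /GRing.scale /= mulKf // pnatr_eq0.
by apply/funext => u; rewrite !fctE /saw big_nat_recr //= /GRing.scale /= mulrC.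
Qed.

Lemma dirichlet_kernel N x : sin (x / 2) != 0 ->
  \sum_(1 <= j < N.+1) cos (j%:R * x) = sin ((N%:R + 2^-1) * x) / (2 * sin (x / 2)) - 2^-1.
Proof.
move=> s0; have s0' : 2 * sin (x / 2) != 0 by rewrite mulf_neq0.
elim: N => [|N IH].
  by rewrite big_geq // add0r [2^-1 * x]mulrC; field.
rewrite big_nat_recr //= IH; apply: (mulfI s0').
have -> : (N.+1%:R + 2^-1) * x = N.+1%:R * x + x / 2 by field.
have -> : (N%:R + 2^-1) * x = N.+1%:R * x - x / 2 by rewrite -natr1; field.
rewrite sinB sinD; field; exact: s0.
Qed.

Lemma sin_ge_lin x : 0 <= x <= 1 -> cos 1 * x <= sin x.
Proof.
move=> /andP[x0 x1].
have cs : {within `[0, x], continuous (@sin R)}%classic.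
  by apply: continuous_subspaceT => y; exact: continuous_sin.
have [c cx E] := @MVT_segment R sin cos 0 x x0 (fun y _ => is_derive_sin y) cs.
move: E; rewrite sin0 !subr0 => ->.
move: cx; rewrite in_itv /= => /andP[c0 cx].
rewrite ler_wpM2r //; have p2 := pi_ge2 R.
have [->//|] := eqVneq c 1; rewrite neq_lt => /orP[c1|]; last by lra.
by apply: ltW; rewrite ltr_cos ?in_itv /=; lra.
Qed.

(** The error vanishes at pi and its derivative is the oscillating part of the Dirichlet kernel; one
    integration by parts gains the factor 1 / N away from the jump. *)
Lemma saw_approx : exists C : R, 0 <= C /\ forall N x, (0 < N)%N -> 0 < x <= 2 ->
  `|saw N x - (pi - x) / 2| <= C / (N%:R * x ^+ 2).
Proof.
have c10 : 0 < cos 1 :> R := cos1_gt0 R.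
exists (6 / cos 1 ^+ 2); split; first by rewrite divr_ge0 ?exprn_ge0 // ltW.
move=> N x N0 /andP[x0 x2].
have N0' : 0 < (N%:R : R) by rewrite ltr0n.
pose a : R := N%:R + 2^-1; have a0 : 0 < a by rewrite /a; lra.
have p2 := pi_ge2 R; have p3 : pi < 4 :> R by have := pihalf_lt2 R; lra.
pose q (u : R) := cos (a * u) * (sin (2^-1 * u))^-1.
(* Adding [q / (2 a)] performs the integration by parts: it cancels sin (a u) / (2 sin (u / 2)) in
   the derivative and leaves [D'], of size 1 / (a sin^2). *)
pose D (u : R) : R := saw N u - (pi - u) / 2 + (2 * a)^-1 * q u.
pose D' (u : R) : R := - (cos (a * u) * cos (2^-1 * u)) / (4 * a * sin (2^-1 * u) ^+ 2).
have sp u : x <= u <= pi -> 0 < sin (2^-1 * u).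
  by move=> /andP[xu up]; apply: sin_gt0_pi; lra.
have dD u : x <= u <= pi -> is_derive u 1 D (D' u).
  move=> hu; have s0 := lt0r_neq0 (sp u hu).
  have h1 := is_derive_saw N u.
  have h2 : is_derive u 1 (fun u => (pi - u) / 2 : R) (- 2^-1).
    rewrite (_ : (fun u => _) = cst (pi / 2) + (fun u => - 2^-1 * u)).
      by apply: (is_derive_eq (is_deriveD (is_derive_cst _ _ _) (is_derive_lin _ _))); rewrite add0r.
    by apply/funext => y; rewrite !fctE; field.
  have h3 := is_derive_comp_lin (is_derive_cos (a * u)).
  have h4 := is_derive_comp_lin (is_derive_sin (2^-1 * u)).
  have h5 := is_deriveV s0 h4.
  have h6 := is_deriveZ ((2 * a)^-1) (is_deriveM h3 h5).
  apply: (is_derive_eq (is_deriveD (is_deriveB h1 h2) h6)).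
  rewrite dirichlet_kernel; last by rewrite [u / 2]mulrC.
  rewrite -/a [u / 2]mulrC /D' /GRing.scale /=; field.
  by rewrite s0 gt_eqF.
have xpi : x <= pi by lra.
have cD : {within `[x, pi], continuous D}%classic.
  apply: derivable_within_continuous => u; rewrite in_itv /= => hu.
  by have [] := dD u hu.
have [c cI E] := @MVT_segment R D D' x pi xpi
  (fun u hu => dD u (ltac:(move: hu; rewrite in_itv /= => /andP[/ltW -> /ltW ->]; done))) cD.
move: cI; rewrite in_itv /= => hc.
(* Base point: each sin (j pi) is 0, and so is cos ((N + 1/2) pi). *)
have Dpi : D pi = 0.
  rewrite /D /q subrr mul0r subr0.
  have -> : saw N pi = 0.
    rewrite /saw big1 // => j _.
    have -> : sin (j%:R * pi) = 0 :> R.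
      elim: j => [|j IH]; first by rewrite mul0r sin0.
      by rewrite -natr1 mulrDl mul1r sinDpi IH oppr0.
    by rewrite mul0r.
  have -> : cos (a * pi) = 0 :> R.
    rewrite /a; elim: (N) => [|j IH]; first by rewrite add0r mulrC cos_pihalf.
    rewrite -natr1 (_ : (j%:R + 1 + 2^-1) * pi = (j%:R + 2^-1) * pi + pi); last by ring.
    by rewrite cosDpi IH oppr0.
  by rewrite mul0r mulr0 addr0.
set s := sin (2^-1 * x).
have s_ge : cos 1 * (2^-1 * x) <= s by apply: sin_ge_lin; apply/andP; split; lra.
have s0 : 0 < s by apply: sp; rewrite lexx.
have sc : s <= sin (2^-1 * c).
  case/andP: hc => xc cp.
  have [->//|] := eqVneq c x; rewrite neq_lt => /orP[|xc']; first by lra.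
  by apply: ltW; rewrite ltr_sin ?in_itv /=; lra.
have s1 : s <= 1 := sin_le1 _.
have as2 : 0 < 4 * a * s ^+ 2 by rewrite !mulr_gt0 ?exprn_gt0.
have D'c : `|D' c| <= (4 * a * s ^+ 2)^-1.
  rewrite /D' mulNr normrN normrM -[leRHS]mul1r ler_pM //.
    rewrite normrM -[1]mulr1 ler_pM ?cos_max //.
  rewrite ger0_norm; last first.
    by rewrite invr_ge0 mulr_ge0 ?sqr_ge0 // mulr_ge0 // ltW.
  have sc2 : s ^+ 2 <= sin (2^-1 * c) ^+ 2 by rewrite lerXn2r ?nnegrE ?(ltW s0) // (le_trans (ltW s0)).
  have sc0 : 0 < sin (2^-1 * c) ^+ 2 by rewrite (lt_le_trans _ sc2) // exprn_gt0.
  rewrite lef_pV2 ?posrE //; last by rewrite mulr_gt0 // mulr_gt0.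
  by rewrite ler_wpM2l // mulr_ge0 // ltW.
have qx : `|(2 * a)^-1 * q x| <= 2 * (4 * a * s ^+ 2)^-1.
  rewrite /q -/s !normrM.
  have -> : 2 * (4 * a * s ^+ 2)^-1 = (2 * a)^-1 * (1 * (s^-1 * s^-1)).
    by field; rewrite !gt_eqF.
  have i0 : 0 <= (2 * a)^-1 by rewrite invr_ge0; lra.
  rewrite ger0_norm // ler_wpM2l // ler_pM ?cos_max //.
  by rewrite ger0_norm ?invr_ge0 ?(ltW s0) // ler_peMr ?invr_ge0 ?(ltW s0) // invf_ge1.
have Dx : `|D x| <= 4 * (4 * a * s ^+ 2)^-1.
  have -> : D x = - (D' c * (pi - x)) by rewrite -E Dpi sub0r opprK.
  have px : `|pi - x| <= 4 by rewrite ger0_norm; clear -p3 x0 x2 xpi; lra.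
  by rewrite normrN normrM [leRHS]mulrC; apply: ler_pM.
have tot : `|saw N x - (pi - x) / 2| <= 6 * (4 * a * s ^+ 2)^-1.
  have -> : saw N x - (pi - x) / 2 = D x - (2 * a)^-1 * q x by rewrite /D; ring.
  by rewrite (le_trans (ler_normB _ _)) //; move: Dx qx; clear; lra.
rewrite (le_trans tot) //.
have -> : 6 / cos 1 ^+ 2 / (N%:R * x ^+ 2) = 6 * (4 * N%:R * (cos 1 * (2^-1 * x)) ^+ 2)^-1.
  by field; rewrite !gt_eqF.
rewrite ler_pM2l // lef_pV2 ?posrE ?mulr_gt0 ?exprn_gt0 ?mulr_gt0 //.
rewrite ler_pM ?exprn_ge0 ?mulr_ge0 ?(ltW N0') ?(ltW c10) ?(ltW x0) //.
  by rewrite ler_pM2l // /a; lra.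
by rewrite lerXn2r ?nnegrE ?(ltW s0) // !mulr_ge0 // ltW.
Qed.

End Sawtooth.

(** * Growth comparisons and counting *)

Section Asymptotics.
Context (R : realType).
Implicit Types (L A : R).

Lemma pow_ln_le m A : exists L0 : R, 1 <= L0 /\ forall L, L0 <= L -> A * (1 + ln L) ^+ m <= L.
Proof.
pose B := `|A| * (m`!%:R / 2^-1 ^+ m * expR 2^-1).
have B0 : 0 <= B by rewrite !mulr_ge0 ?invr_ge0 ?expR_ge0 ?exprn_ge0 // invr_ge0.
exists (1 + B ^+ 2); split; first by rewrite lerDl sqr_ge0.
move=> L hL; have L1 : 1 <= L by rewrite (le_trans _ hL) // lerDl sqr_ge0.
have L0 : 0 < L by lra.
have l0 : 0 <= 1 + ln L by rewrite addr_ge0 // ln_ge0.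
have h2 : 0 < 2^-1 :> R by lra.
have h := pow_le_expR m h2 l0.
pose s := expR (2^-1 * ln L).
have sE : s ^+ 2 = L.
  by rewrite -expRM_natl mulrA mulfV // mul1r lnK.
have s0 : 0 < s := expR_gt0 _.
have hBs : B <= s.
  rewrite -(ler_pXn2r (n := 2)) ?nnegrE ?(ltW s0) // sE.
  by rewrite (le_trans _ hL) // lerDr.
apply: (@le_trans _ _ (B * s)).
  apply: (@le_trans _ _ (`|A| * (1 + ln L) ^+ m)).
    by rewrite ler_wpM2r ?exprn_ge0 // ler_norm.
  rewrite /B -mulrA ler_wpM2l // (le_trans h) // mulrDr mulr1 expRD -/s mulrA.
  exact: lexx.
by rewrite -sE expr2 ler_wpM2r // ltW.
Qed.

Lemma pow_le_expR_half m L : 0 <= L -> L ^+ m <= m`!%:R * 2 ^+ m * expR (L / 2).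
Proof.
move=> L0; have h2 : 0 < 2^-1 :> R by lra.
by have := pow_le_expR m h2 L0; rewrite exprVn invrK [2^-1 * L]mulrC.
Qed.

Lemma count_interval (X a b : nat) :
  \sum_(0 <= n < X) (if (a <= n < b)%N then 1 else 0) <= (b - a)%:R :> R.
Proof.
rewrite -big_mkcond.
have -> : \sum_(0 <= n < X | (a <= n < b)%N) (1 : R) = (\sum_(0 <= n < X | (a <= n < b)%N) 1)%N%:R.
  by rewrite natr_sum.
rewrite ler_nat sum1_count.
rewrite -size_filter -(size_iota a (b - a)); apply: uniq_leq_size.
  by rewrite filter_uniq // iota_uniq.
move=> n; rewrite mem_filter mem_iota => /andP[/andP[an nb] _].
by rewrite an /= subnKC // ltnW // (leq_ltn_trans an).
Qed.

End Asymptotics.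

(** * A trigonometric approximation to the indicator of an interval *)

Section Window.
Context (R : realType).
Implicit Types (al be th : R).

(** The linear parts of the two sawtooths leave (al - be) / (2 pi), which the first term cancels;
    their jumps produce 1 between [al] and [be] and 0 outside. *)
Definition window N al be th : R :=
  (be - al) / (2 * pi) + (saw N (th - al) - saw N (th - be)) / pi.

Lemma window_le N al be th : 0 <= al -> al <= be -> be <= 1 -> (0 < N)%N ->
  `|window N al be th| <= 2 + ln N%:R.
Proof.
move=> a0 ab b1 N0; have p2 := pi_ge2 R; have p0 : 0 < pi :> R by lra.
have l0 := ln_nat_ge0 R N.
have s1 := saw_le N (th - al); have s2 := saw_le N (th - be).
rewrite (le_trans (ler_normD _ _)) //.
have h1 : `|(be - al) / (2 * pi)| <= 1.
  by rewrite ger0_norm ?divr_ge0 ?subr_ge0 ?mulr_ge0 ?(ltW p0) // ler_pdivrMr ?mulr_gt0 //; lra.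
have h2 : `|(saw N (th - al) - saw N (th - be)) / pi| <= 1 + ln N%:R.
  rewrite normrM [X in _ * X]ger0_norm ?invr_ge0 ?(ltW p0) // ler_pdivrMr //.
  rewrite (le_trans (ler_normB _ _)) // (@le_trans _ _ ((1 + ln N%:R) * 2)) //; first by lra.
  by rewrite ler_wpM2l //; lra.
lra.
Qed.

(** The differences [th - al] and [th - be] lie in [-1, 2], so the sawtooths meet no jump other than
    the one at 0; negative arguments are reached by oddness. *)
Lemma window_approx : exists C : R, 0 <= C /\ forall N al be th eta, (0 < N)%N ->
  0 <= al -> al <= be -> be <= 1 -> 0 <= th <= 2 -> 0 < eta ->
  eta <= `|th - al| -> eta <= `|th - be| ->
  `|window N al be th - (if al < th < be then 1 else 0)| <= C / (N%:R * eta ^+ 2).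
Proof.
have [C [C0 hC]] := saw_approx R; exists C; split => //.
move=> N al be th eta N0 a0 ab b1 /andP[t0 t2] e0 ea eb.
have p2 := pi_ge2 R; have p0 : 0 < pi :> R by lra.
have N0' : 0 < (N%:R : R) by rewrite ltr0n.
pose E := C / (N%:R * eta ^+ 2).
have E0 : 0 <= E by rewrite divr_ge0 // mulr_ge0 ?sqr_ge0.
have Emono (x : R) : eta <= x -> C / (N%:R * x ^+ 2) <= E.
  move=> ex; have x0 : 0 < x by clear -ex e0; lra.
  have pos (y : R) : 0 < y -> 0 < N%:R * y ^+ 2 by move=> y0; exact: (mulr_gt0 N0' (exprn_gt0 2 y0)).
  rewrite ler_wpM2l // lef_pV2 ?posrE ?pos //.
  by rewrite ler_wpM2l ?(ltW N0') // lerXn2r ?nnegrE ?(ltW e0) // (le_trans (ltW e0)).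
have appr (ph : R) : -1 <= ph <= 2 -> eta <= `|ph| ->
    `|saw N ph - ((if 0 < ph then pi else - pi) - ph) / 2| <= E.
  move=> /andP[p1 p2'] eph; case: ifPn => [ph0|].
    move: eph; rewrite gtr0_norm // => eph.
    rewrite (le_trans (hC N ph N0 _)) ?ph0 //; exact: Emono.
  rewrite -leNgt => ph0; move: eph; rewrite ler0_norm // => eph.
  have ph1 : 0 < - ph <= 2 by apply/andP; split; lra.
  have := hC N (- ph) N0 ph1; rewrite saw_odd => h.
  have -> : saw N ph - (- pi - ph) / 2 = - (- saw N ph - (pi - - ph) / 2) by field.
  rewrite normrN.
  by rewrite (le_trans h) // Emono.
have h1 := appr (th - al) ltac:(apply/andP; split; lra) ea.
have h2 := appr (th - be) ltac:(apply/andP; split; lra) eb.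
rewrite !subr_gt0 in h1 h2.
have key : `|window N al be th - (if al < th < be then 1 else 0)| <= (E + E) / pi.
  rewrite -[leLHS]mul1r -[X in X * _](mulfV (lt0r_neq0 p0)) mulrAC ler_wpM2r ?invr_ge0 ?(ltW p0) //.
  rewrite -[X in X * _](ger0_norm (ltW p0)) -normrM.
  rewrite (le_trans _ (lerD h1 h2)) // (le_trans _ (ler_normB _ _)) //.
  rewrite le_eqVlt; apply/orP; left; apply/eqP; congr `|_|; rewrite /window.
  have ne : th != al by apply/eqP => e; move: ea; rewrite e subrr normr0; lra.
  have ne' : th != be by apply/eqP => e; move: eb; rewrite e subrr normr0; lra.
  have p00 := lt0r_neq0 p0; move: (@pi R) p00 => q q0.
  case: (ltrP al th) => [at_|ta] /=.
    case: (ltrP be th) => [bt|tb]; first by rewrite (lt_gtF bt); field.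
    have -> : th < be by rewrite lt_neqAle ne' tb.
    by field.
  by rewrite (le_gtF (le_trans ta ab)); field.
rewrite (le_trans key) // -/E ler_pdivrMr //.
have : E * 2 <= E * pi by rewrite ler_wpM2l.
lra.
Qed.

End Window.

(** * Sums against the window bounded by twisted series *)

Section SpectralBound.
Context (R : realType).

Lemma csum_Im (f : nat -> R[i]) : abs_summable f ->
  abs_summable (fun n => (complex.Im (f n))%:C) /\
  csum (fun n => (complex.Im (f n))%:C) = (complex.Im (csum f))%:C.
Proof.
move=> hf; have [B hB] := hf; split.
  exists B; apply: (abs_summable_le _ hB) => n.
  by rewrite cmod_real Im_le_cmod.
apply: csum_eq => e e0; have [N hN] := csumP hf e0.
exists N => n Nn; rewrite -rmorph_sum -rmorphB cmod_real /=.
rewrite (le_trans _ (hN n Nn)) // -Im_sum -ImN -ImD.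
exact: Im_le_cmod.
Qed.

(** As [b] is real, each harmonic contributes the imaginary part of the series twisted by n^(- i j
    lam), rotated by [cis (j ga)]. The weights 1 / j add up to the factor 1 + ln N. *)
Lemma saw_spectral (b : nat -> R) (lam ga B : R) N :
  abs_summable (fun n => (b n)%:C) -> 0 <= B ->
  (forall j, (j <= N)%N -> cmod (csum (fun n => (b n)%:C * cis (- (j%:R * lam * ln n%:R)))) <= B) ->
  abs_summable (fun n => (b n * saw N (lam * ln n%:R - ga))%:C) /\
  cmod (csum (fun n => (b n * saw N (lam * ln n%:R - ga))%:C)) <= B * (1 + ln N%:R).
Proof.
move=> [Bb hb] B0 hB.
pose G j n : R[i] := (b n)%:C * cis (- (j%:R * lam * ln n%:R)).
have hG j : abs_summable (G j).
  by exists Bb; apply: (abs_summable_le _ hb) => n; rewrite /G cmodM cmod_cis mulr1.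
pose F j n : R[i] := (- j%:R^-1)%:C * (complex.Im (cis (j%:R * ga) * G j n))%:C.
have hI j := csum_Im (abs_summableZ (cis (j%:R * ga)) (hG j)).
have hF j : abs_summable (F j) by apply: abs_summableZ; exact: (hI j).1.
have e : (fun n => (b n * saw N (lam * ln n%:R - ga))%:C) = (fun n => \sum_(j <- index_iota 1 N.+1) F j n).
  apply/funext => n; rewrite /saw mulr_sumr rmorph_sum; apply: eq_bigr => j _.
  rewrite /F -rmorphM; congr (_%:C).
  rewrite /G [cis _ * (_ * _)]mulrCA -cisD ImZ /=.
  have -> : j%:R * ga - j%:R * lam * ln n%:R = - (j%:R * (lam * ln n%:R - ga)) by ring.
  by rewrite sinN; ring.
have [h1 h2] := csum_sum (index_iota 1 N.+1) hF.
rewrite e; split => //; rewrite h2 (le_trans (cmod_sum _ _ _)) //.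
apply: (@le_trans _ _ (\sum_(1 <= j < N.+1) B * j%:R^-1)); last first.
  by rewrite -mulr_sumr ler_wpM2l // sum_inv1_le.
rewrite big_nat [leRHS]big_nat; apply: ler_sum => j /andP[j1 jN].
rewrite csumZ; last exact: (hI j).1.
rewrite (hI j).2 cmodM !cmod_real normrN ger0_norm ?invr_ge0 // mulrC.
rewrite ler_wpM2r ?invr_ge0 // (le_trans (Im_le_cmod _)) // csumZ // cmodM cmod_cis mul1r.
exact: hB.
Qed.

Lemma window_spectral (b : nat -> R) (lam al be B : R) N :
  abs_summable (fun n => (b n)%:C) -> 0 <= B -> 0 <= al -> al <= be -> be <= 1 ->
  (forall j, (j <= N)%N -> cmod (csum (fun n => (b n)%:C * cis (- (j%:R * lam * ln n%:R)))) <= B) ->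
  abs_summable (fun n => (b n * window N al be (lam * ln n%:R))%:C) /\
  cmod (csum (fun n => (b n * window N al be (lam * ln n%:R))%:C)) <= B * (2 + ln N%:R).
Proof.
move=> hb B0 a0 ab b1 hB.
have p2 := pi_ge2 R; have p0 : 0 < pi :> R by lra.
have [A1 A2] := saw_spectral al hb B0 hB.
have [B1 B2] := saw_spectral be hb B0 hB.
set fa := (fun n => _) in A1 A2; set fb := (fun n => _) in B1 B2.
pose c0 := (be - al) / (2 * pi).
have e : (fun n => (b n * window N al be (lam * ln n%:R))%:C) =
    (fun n => c0%:C * (b n)%:C + (pi^-1)%:C * (fa n - fb n)).
  apply/funext => n; rewrite /fa /fb -rmorphB -!rmorphM -rmorphD /window.
  congr (_%:C); have p00 := lt0r_neq0 p0; rewrite /c0; move: (@pi R) p00 => q q0.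
  by field.
have h1 := abs_summableZ c0%:C hb.
have hd := abs_summableB A1 B1.
have h2 := abs_summableZ (pi^-1)%:C hd.
rewrite e; split; first exact: abs_summableD.
rewrite csumD // !csumZ // csumB //.
have H0 : cmod (csum (fun n => (b n)%:C)) <= B.
  have := hB 0%N isT; congr (cmod (csum _) <= _); apply/funext => n.
  by rewrite !mul0r oppr0 cis0 mulr1.
have c00 : 0 <= c0 by rewrite divr_ge0 ?subr_ge0 // mulr_ge0 // ltW.
have c01 : c0 <= 1 by rewrite ler_pdivrMr ?mulr_gt0 //; lra.
have l0 := ln_nat_ge0 R N.
have bl : 0 <= B * (1 + ln N%:R) by rewrite mulr_ge0 //; lra.
rewrite (le_trans (cmodD _ _)) // !cmodM !cmod_real ger0_norm // ger0_norm ?invr_ge0 ?(ltW p0) //.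
have t1 : c0 * cmod (csum (fun n => (b n)%:C)) <= B.
  by rewrite -[leRHS]mul1r ler_pM ?cmod_ge0.
have t2 : pi^-1 * cmod (csum fa - csum fb) <= B * (1 + ln N%:R).
  rewrite mulrC ler_pdivrMr // (le_trans (cmodB _ _)) //.
  rewrite (@le_trans _ _ (B * (1 + ln N%:R) * 2)) ?ler_wpM2l //; lra.
have -> : B * (2 + ln N%:R) = B + B * (1 + ln N%:R) by ring.
exact: lerD.
Qed.

End SpectralBound.

(** * Partial sums of the weighted coefficients *)

Section PerronBound.
Context (R : realType).
Implicit Types (L d : R).

Definition bcoef sg n : R := (vonM R n - 1) * (ln n%:R ^+ 4 * pterm sg n).
Definition wt sg n : R := (1 + ln n%:R) * (ln n%:R ^+ 4 * pterm sg n).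

Lemma bcoef_twist sg t : (fun n => (bcoef sg n)%:C * cis (- (t * ln n%:R))) =
  (fun n => vterm 4 sg t n - dterm 4 sg t n).
Proof.
apply/funext => n; rewrite /bcoef /vterm /dterm.
set w : R := ln _ ^+ 4 * _; have -> : (vonM R n - 1) * w = vonM R n * w - w by ring.
by rewrite rmorphB rmorphM mulrBl mulrA.
Qed.

Lemma csum_bcoef sg t : 1 < sg ->
  csum (fun n => (bcoef sg n)%:C * cis (- (t * ln n%:R))) = Lv 4 sg t - Zs 4 sg t.
Proof.
move=> s1; rewrite bcoef_twist csumB //; first exact: vterm_summable.
exact: dterm_summable.
Qed.

Lemma bcoef_summable sg : 1 < sg -> abs_summable (fun n => (bcoef sg n)%:C).
Proof.
move=> s1; have h := abs_summableB (vterm_summable 4 0 s1) (dterm_summable 4 0 s1).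
rewrite -bcoef_twist in h; move: h; congr abs_summable; apply/funext => n.
by rewrite mul0r oppr0 cis0 mulr1.
Qed.

Lemma wt_ge0 sg n : 0 <= wt sg n.
Proof.
have l0 := ln_nat_ge0 R n.
by rewrite mulr_ge0 ?mulr_ge0 ?pterm_ge0 ?exprn_ge0 // addr_ge0.
Qed.

Lemma bcoef_le sg n : `|bcoef sg n| <= wt sg n.
Proof.
have l0 := ln_nat_ge0 R n; have v0 := vonM_ge0 R n; have v1 := vonM_le R n.
rewrite normrM [X in _ * X]ger0_norm ?mulr_ge0 ?pterm_ge0 ?exprn_ge0 //.
rewrite ler_wpM2r ?mulr_ge0 ?pterm_ge0 ?exprn_ge0 // ler_norml; lra.
Qed.

(** One factor 1 / d for each of at most five logarithms and one for the sum of n^(-1-d). *)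
Lemma sum_wt : exists A : R, 0 <= A /\ forall d X, 0 < d -> d <= 1 ->
  \sum_(0 <= n < X) wt (1 + d) n <= A * d^-1 ^+ 6.
Proof.
exists (4`!%:R * 2 ^+ 4 * 3 + 5`!%:R * 2 ^+ 5 * 3); split.
  by rewrite addr_ge0 // !mulr_ge0 // exprn_ge0.
move=> d X d0 d1.
have e1 : 1 <= d^-1 by rewrite invf_ge1.
have h4 := sum_ln_pterm 4 X d0; have h5 := sum_ln_pterm 5 X d0.
have -> : \sum_(0 <= n < X) wt (1 + d) n = \sum_(0 <= n < X) ln n%:R ^+ 4 * pterm (1 + d) n
   + \sum_(0 <= n < X) ln n%:R ^+ 5 * pterm (1 + d) n.
  by rewrite -big_split /=; apply: eq_bigr => n _; rewrite /wt [_ ^+ 5]exprS; ring.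
have h3 : 1 + 2 / d <= 3 * d^-1 by rewrite -/(2 * d^-1); move: e1; clear; lra.
have i0 : 0 <= d^-1 by lra.
rewrite mulrDl lerD //.
  rewrite (le_trans h4) // exprMn.
  have -> : 4`!%:R * 2 ^+ 4 * 3 * d^-1 ^+ 6 = 4`!%:R * (2 ^+ 4 * d^-1 ^+ 5) * (3 * d^-1).
    by rewrite [_ ^+ 6]exprSr; ring.
  have p4 : 0 <= 4`!%:R * (2 ^+ 4 * d^-1 ^+ 4) :> R by rewrite mulr_ge0 // mulr_ge0 // exprn_ge0.
  apply: ler_pM => //; first by rewrite addr_ge0 // mulr_ge0.
  apply: ler_wpM2l => //; apply: ler_wpM2l; first exact: exprn_ge0.
  by rewrite ler_weXn2l.
rewrite (le_trans h5) // exprMn.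
have -> : 5`!%:R * 2 ^+ 5 * 3 * d^-1 ^+ 6 = 5`!%:R * (2 ^+ 5 * d^-1 ^+ 5) * (3 * d^-1).
  by rewrite [_ ^+ 6]exprSr; ring.
by rewrite ler_wpM2l // mulr_ge0 // mulr_ge0 ?exprn_ge0.
Qed.

Lemma near_bounds (y n : nat) (rho : R) : (0 < y)%N -> (0 < n)%N ->
  0 < rho -> rho <= 2^-1 -> `|ln n%:R - ln y%:R| < rho ->
  (y%:R : R) * (1 - rho) <= n%:R <= y%:R * (1 + 2 * rho).
Proof.
move=> y0 n0 r0 r1; rewrite ltr_norml => /andP[h1 h2].
have y0' : 0 < (y%:R : R) by rewrite ltr0n.
have n0' : 0 < (n%:R : R) by rewrite ltr0n.
have e1 := expR_ge1Dx (- rho).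
have nE : n%:R = y%:R * expR (ln n%:R - ln y%:R) :> R.
  by rewrite expRB !lnK ?posrE // mulrC divfK // gt_eqF.
rewrite nE !ler_pM2l //; apply/andP; split.
  by rewrite (le_trans e1) // ler_expR ltW.
apply: (@le_trans _ _ (expR rho)); first by rewrite ler_expR ltW.
have p0 : 0 < 1 - rho by lra.
rewrite -[rho in expR rho]opprK expRN -[leLHS]mul1r ler_pdivrMr ?expR_gt0 //.
have : (1 + 2 * rho) * (1 - rho) <= (1 + 2 * rho) * expR (- rho) by rewrite ler_wpM2l //; lra.
nra.
Qed.

(** Each such n has weight at most 3 L times (2 L)^4 times 2 / y, and there are at most 4 rho y + 1
    of them; the isolated 1 becomes exp(-L / 2) because y >= exp(L / 2). *)
Lemma sum_near L (y X : nat) (rho sg : R) : 1 <= L -> 1 <= sg ->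
  expR (L / 2) <= y%:R -> y%:R <= expR L -> 0 < rho -> rho <= 2^-1 ->
  \sum_(0 <= n < X) (if `|ln n%:R - ln y%:R| < rho then wt sg n else 0) <=
  96 * L ^+ 5 * (4 * rho + expR (- (L / 2))).
Proof.
move=> L1 s1 y1 y2 r0 r1.
have L0 : 0 <= L by lra.
have yp : 0 < (y%:R : R) by rewrite (lt_le_trans _ y1) // expR_gt0.
have y0 : (0 < y)%N by rewrite -(ltr0n R).
have lny2 : ln (y%:R : R) <= L by rewrite -ler_expR lnK.
pose k := Num.truncn (2 * rho * y%:R).
have ry0 : 0 <= 2 * rho * y%:R by rewrite !mulr_ge0 // ltW.
have k1 : k%:R <= 2 * rho * y%:R :> R by rewrite truncn_le.
have k2 : 2 * rho * y%:R < k.+1%:R :> R by rewrite truncnS_gt.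
have c0 : 0 <= 96 * L ^+ 5 / y%:R by rewrite divr_ge0 ?mulr_ge0 ?exprn_ge0 // ltW.
apply: (@le_trans _ _ (\sum_(0 <= n < X) 96 * L ^+ 5 / y%:R * (if (y - k <= n < y + k.+1)%N then 1 else 0))).
  apply: ler_sum => n _; case: ifP => hn; last by case: ifP; rewrite ?mulr1 ?mulr0.
  case: n hn => [|n] hn; first by rewrite /wt /= !mulr0 mulr_ge0 //; case: ifP.
  have /andP[b1 b2] := near_bounds y0 (ltn0Sn n) r0 r1 hn.
  have -> : (y - k <= n.+1 < y + k.+1)%N.
    have t1 : (n.+1 < y + k.+1)%N by rewrite -(ltr_nat R) natrD; clear -b2 k2; lra.
    have t2 : (y < n.+1 + k.+1)%N.
      rewrite -(ltr_nat R) natrD; clear -b1 k2 r0 yp.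
      have := mulr_gt0 r0 yp; lra.
    by rewrite t1 andbT; clear -t2; lia.
  rewrite mulr1.
  have nn : ln (n.+1%:R : R) <= 2 * L.
    by move: hn; rewrite ltr_norml => /andP[_ h]; clear -h r1 lny2 L1; lra.
  have ln0 := ln_nat_ge0 R n.+1.
  have w1 : 1 + ln n.+1%:R <= 3 * L by clear -nn L1; lra.
  have w2 : ln (n.+1%:R : R) ^+ 4 <= (2 * L) ^+ 4 by rewrite lerXn2r ?nnegrE // mulr_ge0.
  have w3 : pterm sg n.+1 <= 2 / y%:R.
    rewrite (le_trans (pterm_antimono n.+1 s1)) //= mulN1r expRN lnK ?posrE ?ltr0n //.
    rewrite ler_pdivlMr // mulrC ler_pdivrMr ?ltr0n //.
    by move: b1; have := ler_wpM2l (ltW yp) r1; clear; lra.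
  have -> : 96 * L ^+ 5 / y%:R = (3 * L) * ((2 * L) ^+ 4 * (2 / y%:R)) by ring.
  rewrite /wt; apply: ler_pM; rewrite ?mulr_ge0 ?pterm_ge0 ?exprn_ge0 //; first lra.
  by apply: ler_pM; rewrite ?pterm_ge0 ?exprn_ge0.
rewrite -mulr_sumr (le_trans (ler_wpM2l c0 (count_interval R X (y - k) (y + k.+1)))) //.
have kk : (y + k.+1 - (y - k))%:R <= 4 * rho * y%:R + 1 :> R.
  apply: (@le_trans _ _ (2 * k + 1)%:R); first by rewrite ler_nat; clear; lia.
  by rewrite natrD natrM; clear -k1; lra.
rewrite (le_trans (ler_wpM2l c0 kk)) //.
have iy : y%:R^-1 <= expR (- (L / 2)) by rewrite expRN lef_pV2 ?posrE ?expR_gt0.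
have -> : 96 * L ^+ 5 / y%:R * (4 * rho * y%:R + 1) = 96 * L ^+ 5 * (4 * rho + y%:R^-1).
  by field; rewrite gt_eqF.
by rewrite ler_wpM2l ?lerD2l // mulr_ge0 // exprn_ge0.
Qed.

(* As a function of [n] the window is a Dirichlet polynomial with frequencies [j / L^2], [j <= q^26];
   it plays the role of the truncated Perron integral. *)
Lemma perron_error : exists A : R, 0 <= A /\ forall L (q y z X : nat),
  1 <= L -> L <= q%:R -> 3 + ln ((q ^ 26)%N%:R : R) <= L ->
  expR (L / 2) <= y%:R -> (y <= z)%N -> z%:R <= expR L ->
  \sum_(0 <= n < X) `|bcoef (1 + L^-1) n *
     (window (q ^ 26) (L^-1 ^+ 2 * ln y%:R) (L^-1 ^+ 2 * ln z%:R) (L^-1 ^+ 2 * ln n%:R)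
       - (if (y < n <= z)%N then 1 else 0))| <= A.
Proof.
have [A [A0 hA]] := sum_wt; have [C [C0 hC]] := window_approx R.
have [E [E0 hE]] : exists E : R, 0 <= E /\ forall L, 0 <= L -> L ^+ 6 <= E * expR (L / 2).
  exists (6`!%:R * 2 ^+ 6); split; first by apply: mulr_ge0 => //; exact: exprn_ge0.
  by move=> L; exact: pow_le_expR_half.
have [E' [E0' hE']] : exists E : R, 0 <= E /\ forall L, 0 <= L -> L ^+ 7 <= E * expR (L / 2).
  exists (7`!%:R * 2 ^+ 7); split; first by apply: mulr_ge0 => //; exact: exprn_ge0.
  by move=> L; exact: pow_le_expR_half.
have e1 : 0 <= 96 * (4 + E) by apply: mulr_ge0 => //; exact: addr_ge0.
exists (96 * (4 + E) + 96 * (4 + E) + C * A + A * 2 ^+ 6 * E'); split.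
  have e2 : 0 <= C * A by exact: mulr_ge0.
  have e3 : 0 <= A * 2 ^+ 6 * E'.
    by apply: mulr_ge0 => //; apply: mulr_ge0 => //; exact: exprn_ge0.
  by apply: addr_ge0 => //; apply: addr_ge0 => //; exact: addr_ge0.
move=> L q y z X L1 Lq hK y1 yz z2.
have L0 : 0 < L by lra.
have i1 : L^-1 <= 1 by rewrite invf_le1.
have i0 : 0 < L^-1 by rewrite invr_gt0.
set N := (q ^ 26)%N in hK *; set lam := L^-1 ^+ 2; set sg := 1 + L^-1.
have lam0 : 0 < lam by rewrite exprn_gt0.
have lamL : lam * L ^+ 2 = 1 by rewrite /lam -exprMn mulVf ?expr1n // gt_eqF.
have sg1 : 1 <= sg by rewrite /sg; lra.
have q0 : (0 < q)%N by rewrite -(ltr0n R) (lt_le_trans _ Lq).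
have N0 : (0 < N)%N by rewrite expn_gt0 q0.
have yp : 0 < (y%:R : R) by rewrite (lt_le_trans _ y1) // expR_gt0.
have y0 : (0 < y)%N by rewrite -(ltr0n R).
have z0 : (0 < z)%N by rewrite (leq_trans y0).
have y2 : y%:R <= expR L by rewrite (le_trans _ z2) // ler_nat.
have z1 : expR (L / 2) <= z%:R by rewrite (le_trans y1) // ler_nat.
have lny := ln_nat_ge0 R y.
have lnyz : ln (y%:R : R) <= ln z%:R by apply: ler_ln_nat.
have lnz : ln (z%:R : R) <= L by rewrite -ler_expR lnK // posrE ltr0n.
set al := lam * ln y%:R; set be := lam * ln z%:R.
have al0 : 0 <= al by rewrite mulr_ge0 // ltW.
have ab : al <= be by rewrite ler_wpM2l // ltW.
have be1 : be <= 1.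
  rewrite /be (@le_trans _ _ (lam * L ^+ 2)) //; last by rewrite lamL.
  by rewrite ler_wpM2l ?(ltW lam0) // (le_trans lnz) // expr2 ler_peMr // ltW.
(* [rho] makes L^6 rho <= 1 near the endpoints, and [eta] is the corresponding distance between
   angles. As L^26 = L^6 / eta^2, the cutoff q^26 brings the window error down to C L^(-6), matching
   the growth L^6 of the total weight. *)
pose rho := L^-1 ^+ 8; pose eta := L^-1 ^+ 10.
have rho0 : 0 < rho by rewrite exprn_gt0.
have [L2|L2] := ltrP L 2.
  by exfalso; move: hK; have := ln_nat_ge0 R N; clear -L2; lra.
have rho1 : rho <= 2^-1.
  rewrite /rho (@le_trans _ _ L^-1) //; last by rewrite lef_pV2 ?posrE.
  by rewrite exprS ler_piMr ?(ltW i0) // exprn_ile1 // ltW.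
have eta0 : 0 < eta by rewrite exprn_gt0.
have etaE : eta = lam * rho by rewrite /eta /lam /rho -exprD.
have wind n : `|window N al be (lam * ln n%:R) - (if (y < n <= z)%N then 1 else 0)| <= L.
  rewrite (le_trans _ hK) // (le_trans (ler_normB _ _)) //.
  have := window_le (lam * ln n%:R) al0 ab be1 N0.
  have : `|(if (y < n <= z)%N then 1 else 0)| <= 1 :> R.
    by case: ifP; rewrite ?normr1 ?normr0.
  lra.
have NE : C / (N%:R * eta ^+ 2) <= C * L^-1 ^+ 6.
  rewrite ler_wpM2l // exprVn lef_pV2 ?posrE ?mulr_gt0 ?exprn_gt0 ?ltr0n //.
  rewrite /eta -exprM exprVn ler_pdivlMr ?exprn_gt0 // -exprD /N natrX lerXn2r ?nnegrE //.
  exact: ltW.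
have cL0 : 0 <= C * L^-1 ^+ 6 by apply: mulr_ge0 => //; apply: exprn_ge0; exact: ltW.
have eL0 : 0 <= L * expR (- L) by apply: mulr_ge0; [exact: ltW|exact: expR_ge0].
(* The first two terms treat n near [y] or [z] by the trivial bound L. The third treats the other n
   with ln n <= 2 L^2, whose angle is at most 2. The last treats larger n, where n^(-1/L) <= e^(-L)
   n^(-1/(2L)). *)
pose u n : R := L * (if `|ln n%:R - ln y%:R| < rho then wt sg n else 0)
  + L * (if `|ln n%:R - ln z%:R| < rho then wt sg n else 0)
  + C * L^-1 ^+ 6 * wt sg n + L * expR (- L) * wt (1 + (2 * L)^-1) n.
have ptw n : `|bcoef sg n * (window N al be (lam * ln n%:R) - (if (y < n <= z)%N then 1 else 0))| <= u n.
  have w0 := wt_ge0 sg n; have w0' := wt_ge0 (1 + (2 * L)^-1) n.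
  have t3 : 0 <= C * L^-1 ^+ 6 * wt sg n by exact: mulr_ge0.
  have t4 : 0 <= L * expR (- L) * wt (1 + (2 * L)^-1) n by exact: mulr_ge0.
  have ife c : 0 <= L * (if c then wt sg n else 0) by rewrite mulr_ge0 ?(ltW L0) //; case: c.
  have main : `|bcoef sg n * (window N al be (lam * ln n%:R) - (if (y < n <= z)%N then 1 else 0))| <= L * wt sg n.
    by rewrite normrM mulrC ler_pM // bcoef_le.
  rewrite /u; case: (boolP (`|ln n%:R - ln y%:R| < rho)) => near_y.
    have h := ife (`|ln n%:R - ln z%:R| < rho).
    by rewrite (le_trans main) // -!addrA lerDl !addr_ge0.
  case: (boolP (`|ln n%:R - ln z%:R| < rho)) => near_z.
    by rewrite (le_trans main) // mulr0 add0r -!addrA lerDl !addr_ge0.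
  rewrite mulr0 !add0r.
  have [n0|n0] := posnP n.
    have b0 : bcoef sg n = 0 by rewrite n0 /bcoef /= !mulr0.
    by rewrite b0 mul0r normr0 addr_ge0.
  have lnn := ln_nat_ge0 R n.
  have [fr|nr] := lerP (ln (n%:R : R)) (2 * L ^+ 2).
    rewrite (le_trans _ (_ : C * L^-1 ^+ 6 * wt sg n <= _)) ?lerDl // normrM mulrC.
    rewrite ler_pM ?bcoef_le //.
    have th2 : 0 <= lam * ln n%:R <= 2.
      rewrite mulr_ge0 ?(ltW lam0) //=.
      by rewrite (le_trans (ler_wpM2l (ltW lam0) fr)) // mulrCA lamL mulr1.
    have dist (m : nat) : ~~ (`|ln n%:R - ln m%:R| < rho) -> eta <= `|lam * ln n%:R - lam * ln m%:R|.
      move=> hm; rewrite -mulrBr normrM (ger0_norm (ltW lam0)) etaE ler_pM2l //.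
      by rewrite leNgt.
    (* The open interval of angles matches the half-open range y < n <= z because n = z is excluded
       by [near_z]. *)
    have ind : (al < lam * ln n%:R < be) = (y < n <= z)%N.
      rewrite /al /be !ltr_pM2l // !ltr_ln ?posrE ?ltr0n // !ltr_nat; congr (_ && _).
      rewrite [LHS]ltn_neqAle; case: eqP => //= e; exfalso; move: near_z.
      by rewrite e subrr normr0 rho0.
    have := hC N al be (lam * ln n%:R) eta N0 al0 ab be1 th2 eta0 (dist y near_y) (dist z near_z).
    by rewrite ind => h; rewrite (le_trans h).
  rewrite (le_trans main) // (le_trans _ (_ : L * expR (- L) * wt (1 + (2 * L)^-1) n <= _)) ?lerDr //.
  rewrite -mulrA ler_wpM2l ?(ltW L0) // /wt [expR _ * _]mulrCA.
  rewrite ler_wpM2l ?addr_ge0 // mulrCA ler_wpM2l ?exprn_ge0 //.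
  case: (n) n0 nr => // m _ nr; rewrite /pterm -expRD ler_expR /sg.
  have -> : - (1 + L^-1) * ln m.+1%:R = - (1 + (2 * L)^-1) * ln m.+1%:R - (2 * L)^-1 * ln m.+1%:R.
    by field; rewrite gt_eqF.
  rewrite addrC lerD2r lerNr opprK.
  rewrite -[L in leLHS](_ : (2 * L)^-1 * (2 * L ^+ 2) = L); last by field; rewrite gt_eqF.
  by rewrite ler_wpM2l ?(ltW nr) // invr_ge0 mulr_ge0 // ltW.
apply: (le_trans (ler_sum _ (fun n _ => ptw n))).
rewrite /u !big_split /= -!mulr_sumr.
have nearb (m : nat) : expR (L / 2) <= m%:R -> m%:R <= expR L ->
  L * \sum_(0 <= n < X) (if `|ln n%:R - ln m%:R| < rho then wt sg n else 0) <= 96 * (4 + E).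
  move=> m1 m2; have h := sum_near X L1 sg1 m1 m2 rho0 rho1.
  rewrite (le_trans (ler_wpM2l (ltW L0) h)) //.
  have -> : L * (96 * L ^+ 5 * (4 * rho + expR (- (L / 2)))) =
    96 * (4 * (L ^+ 6 * rho) + L ^+ 6 * expR (- (L / 2))) by ring.
  rewrite ler_wpM2l // lerD //.
    rewrite -[leRHS]mulr1 ler_wpM2l // /rho exprVn ler_pdivrMr ?exprn_gt0 // mul1r.
    by rewrite ler_weXn2l.
  by rewrite expRN ler_pdivrMr ?expR_gt0 // hE // ltW.
rewrite !lerD ?nearb //.
  have h := hA L^-1 X i0 i1; rewrite invrK in h.
  rewrite (le_trans (ler_wpM2l cL0 h)) // exprVn.
  have -> : C / L ^+ 6 * (A * L ^+ 6) = C * A by field; rewrite gt_eqF.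
  exact: lexx.
have d0 : 0 < (2 * L)^-1 by rewrite invr_gt0 mulr_gt0.
have d1 : (2 * L)^-1 <= 1 by rewrite invf_le1 ?mulr_gt0 //; lra.
have h := hA (2 * L)^-1 X d0 d1; rewrite invrK in h.
rewrite (le_trans (ler_wpM2l eL0 h)) // exprMn.
have -> : L * expR (- L) * (A * (2 ^+ 6 * L ^+ 6)) = A * 2 ^+ 6 * (L ^+ 7 * expR (- L)).
  by rewrite [L ^+ 7]exprS; ring.
rewrite ler_wpM2l ?mulr_ge0 ?exprn_ge0 // expRN ler_pdivrMr ?expR_gt0 //.
rewrite (le_trans (hE' L (ltW L0))) // ler_wpM2l // ler_expR; lra.
Qed.

(** At all frequencies of the window [ell] is O(log L). The spectral bound is therefore a power of
    log L, and with the harmonic sum it reaches only (log L)^111, eventually below L. *)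
Lemma perron_bound : exists (C L0 : R), [/\ 0 <= C, 1 <= L0 & forall L (y z : nat),
  L0 <= L -> expR (L / 2) <= y%:R -> (y <= z)%N -> z%:R <= expR L ->
  `|\sum_(y.+1 <= n < z.+1) bcoef (1 + L^-1) n| <= C * L].
Proof.
have [A [A0 hA]] := perron_error.
have [C1 [c [C10 c0 c1 hH]]] := Lv4_bound R.
(* 29 = 26 + 3: both 3 + ln N and [ell] at every frequency are at most 29 (1 + ln L), where ln N <=
   26 (1 + ln L). *)
have [La [La1 hLa]] := pow_ln_le 1 (29 : R).
have [Lb [Lb1 hLb]] := pow_ln_le 111 (C1 * 29 ^+ 111).
exists (1 + A), (La + Lb + c^-1).
have ci : 1 <= c^-1 by rewrite invf_ge1.
split; [lra|lra|] => L y z hL y1 yz z2.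
have L1 : 1 <= L by lra.
have L0 : 0 < L by lra.
have i0 : 0 < L^-1 by rewrite invr_gt0.
have ic : L^-1 <= c by rewrite -[leRHS]invrK lef_pV2 ?posrE ?invr_gt0 //; lra.
have l0 : 0 <= ln L by rewrite ln_ge0.
have [q [Lq qL]] : exists q : nat, L <= q%:R /\ q%:R <= 2 * L.
  exists (Num.truncn L).+1; split; first by rewrite ltW // truncnS_gt.
  have : (Num.truncn L)%:R <= L by rewrite truncn_le // ltW.
  rewrite -natr1; lra.
have q0 : (0 < q)%N by rewrite -(ltr0n R) (lt_le_trans L0).
have ln2 : ln 2 <= 1 :> R.
  by rewrite -ler_expR lnK ?posrE //; have := expR_ge1Dx (1 : R); lra.
have [N [NE N0 lnN]] : exists N : nat, [/\ N = (q ^ 26)%N, (0 < N)%N &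
    ln (N%:R : R) <= 26 * (1 + ln L)].
  exists (q ^ 26)%N; split => //; first by rewrite expn_gt0 q0.
  have -> : ln ((q ^ 26)%N%:R : R) = 26 * ln q%:R by rewrite natrX lnXn ?ltr0n // mulr_natl.
  rewrite ler_wpM2l //.
  have : ln (q%:R : R) <= ln (2 * L) by rewrite ler_ln ?posrE ?mulr_gt0 ?ltr0n.
  by rewrite lnM ?posrE //; lra.
have hK : 3 + ln (N%:R : R) <= L.
  have := hLa L ltac:(lra); rewrite expr1; lra.
pose lam := L^-1 ^+ 2.
have lam0 : 0 <= lam by rewrite exprn_ge0 // ltW.
have lam1 : lam <= 1 by rewrite exprn_ile1 ?(ltW i0) // (le_trans ic).
pose sg := 1 + L^-1.
have sg1 : 1 < sg by rewrite /sg; lra.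
have sgc : 1 < sg <= 1 + c by rewrite sg1 /sg lerD2l.
pose B := C1 * (29 * (1 + ln L)) ^+ 110.
have B0 : 0 <= B by rewrite mulr_ge0 // exprn_ge0 //; lra.
have hB j : (j <= N)%N ->
    cmod (csum (fun n => (bcoef sg n)%:C * cis (- (j%:R * lam * ln n%:R)))) <= B.
  move=> jN; rewrite csum_bcoef // (le_trans (hH sg _ sgc)) // ler_wpM2l //.
  have e1 := ell_ge1 (j%:R * lam).
  rewrite lerXn2r ?nnegrE //; [lra|lra|].
  have j1 : `|j%:R * lam| <= N%:R.
    rewrite ger0_norm; last by rewrite mulr_ge0.
    by rewrite (le_trans (ler_piMr _ lam1)) // ler_nat.
  have N1 : 1 <= N%:R :> R by rewrite ler1n.
  rewrite /ell.
  have : ln (2 + `|j%:R * lam|) <= 2 + ln (N%:R : R).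
    rewrite -ler_expR expRD !lnK ?posrE; [|lra|by have := normr_ge0 (j%:R * lam); lra].
    apply: (@le_trans _ _ (3 * N%:R)); first lra.
    rewrite ler_wpM2r //; have := expR_ge1Dx (2 : R); clear; lra.
  clear -lnN l0; lra.
have [y0' yp] : (0 < y)%N /\ 0 < (y%:R : R).
  have yp : 0 < (y%:R : R) by rewrite (lt_le_trans _ y1) // expR_gt0.
  by split => //; rewrite -(ltr0n R).
have lny := ln_nat_ge0 R y.
have lnyz : ln (y%:R : R) <= ln z%:R by apply: ler_ln_nat.
have lnz : ln (z%:R : R) <= L.
  by rewrite -ler_expR lnK // posrE ltr0n (leq_trans y0').
set al := lam * ln y%:R; set be := lam * ln z%:R.
have al0 : 0 <= al by rewrite mulr_ge0.
have ab : al <= be by rewrite ler_wpM2l.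
have be1 : be <= 1.
  rewrite /be /lam exprVn mulrC ler_pdivrMr ?exprn_gt0 // mul1r (le_trans lnz) //.
  by rewrite expr2 ler_peMr // ltW.
have bs := bcoef_summable sg1.
have [w1 w2] := window_spectral bs B0 al0 ab be1 hB.
pose ind n : R := if (y < n <= z)%N then 1 else 0.
have err : abs_bound (fun n => (bcoef sg n * (window N al be (lam * ln n%:R) - ind n))%:C) A.
  move=> X; under eq_bigr do rewrite cmod_real.
  by rewrite NE; apply: hA => //; rewrite -NE.
have eA := csum_le err; have es := abs_summable_bound err.
have fin : csum (fun n => (bcoef sg n * ind n)%:C) = (\sum_(y.+1 <= n < z.+1) bcoef sg n)%:C.
  apply: csum_eq => e e0; exists z.+1 => X zX.
  rewrite -rmorph_sum (_ : \sum_(0 <= n < X) _ = \sum_(y.+1 <= n < z.+1) bcoef sg n) ?subrr ?cmod0 ?ltW //.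
  have yz1 : (y.+1 <= z.+1)%N by [].
  rewrite (big_cat_nat (leq0n _) (leq_trans yz1 zX)) /= (big_cat_nat yz1 zX) /=.
  rewrite [X in X + _]big_nat [X in X + _]big1 ?add0r; last first.
    by move=> n /andP[_ ny]; rewrite /ind ltnNge -ltnS ny mulr0.
  rewrite [X in _ + X]big_nat [X in _ + X]big1 ?addr0; last first.
    by move=> n /andP[ny _]; rewrite /ind [(n <= z)%N]leqNgt ny andbF mulr0.
  by apply: eq_big_nat => n /andP[ny nz]; rewrite /ind ny -ltnS nz mulr1.
have -> : `|\sum_(y.+1 <= n < z.+1) bcoef sg n| = cmod (csum (fun n => (bcoef sg n * ind n)%:C)).
  by rewrite fin cmod_real.
have -> : (fun n => (bcoef sg n * ind n)%:C) =
    (fun n => (bcoef sg n * window N al be (lam * ln n%:R))%:C -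
      (bcoef sg n * (window N al be (lam * ln n%:R) - ind n))%:C).
  by apply/funext => n; rewrite -rmorphB; congr (_%:C); ring.
rewrite csumB // (le_trans (cmodB _ _)) //.
have main : B * (2 + ln N%:R) <= L.
  have LbL : Lb <= L by clear -hL La1 ci; lra.
  apply: (le_trans _ (hLb L LbL)).
  have h : 2 + ln N%:R <= 29 * (1 + ln L) by clear -lnN l0; lra.
  have e (a x : R) : a * x ^+ 110 * x = a * x ^+ 111 by rewrite [x ^+ 111]exprSr mulrA.
  have e' (a x x' : R) : a * (x * x') ^+ 111 = a * x ^+ 111 * x' ^+ 111 by rewrite exprMn mulrA.
  by apply: (le_trans (ler_wpM2l B0 h)); rewrite /B e e'.
have AL : A <= A * L by rewrite ler_peMr.
clear -w2 eA main AL; lra.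
Qed.

End PerronBound.

(** * The prime number theorem with a power-of-log saving *)

Section PrimeNumberTheorem.
Context (R : realType).
Implicit Types (L : R).

(** Abel summation; as [g] is nondecreasing and nonnegative, both its total variation and its last
    value are at most [g z]. *)
Lemma abel_bound (b g : nat -> R) (y z : nat) (B : R) : (y < z)%N -> 0 <= B ->
  (forall n, (y < n <= z)%N -> 0 <= g n) ->
  (forall n, (y < n < z)%N -> g n <= g n.+1) ->
  (forall m, (y <= m <= z)%N -> `|\sum_(y.+1 <= n < m.+1) b n| <= B) ->
  `|\sum_(y.+1 <= n < z.+1) g n * b n| <= 2 * B * g z.
Proof.
move=> yz B0 g0 gm hB.
pose T m := \sum_(y.+1 <= n < m.+1) b n.
have key m : (y < m <= z)%N ->
    `|\sum_(y.+1 <= n < m.+1) g n * b n - g m * T m| <= B * (g m - g y.+1).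
  elim: m => // m IH /andP[ym mz].
  have [e|ym'] := eqVneq y m.
    by rewrite -e /T !big_nat1 !subrr mulr0 normr0.
  have ym2 : (y < m)%N by rewrite ltn_neqAle ym' -ltnS.
  have h := IH ltac:(by rewrite ym2 ltnW).
  have gg := gm m ltac:(by rewrite ym2).
  have tB := hB m ltac:(by rewrite (ltnW ym2) ltnW).
  have TS : T m.+1 = T m + b m.+1 by rewrite /T big_nat_recr.
  rewrite big_nat_recr //= TS.
  set S := \sum_(_ <= _ < _) _ in h *.
  have -> : S + g m.+1 * b m.+1 - g m.+1 * (T m + b m.+1) = (S - g m * T m) - (g m.+1 - g m) * T m by ring.
  rewrite (le_trans (ler_normB _ _)) // normrM (ger0_norm (_ : 0 <= g m.+1 - g m)) ?subr_ge0 //.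
  have : (g m.+1 - g m) * `|T m| <= (g m.+1 - g m) * B by rewrite ler_wpM2l ?subr_ge0.
  move: h; clear; lra.
have h := key z ltac:(by rewrite yz leqnn).
have gz := g0 z ltac:(by rewrite yz leqnn).
have gy := g0 y.+1 ltac:(by rewrite leqnn).
have tB := hB z ltac:(by rewrite ltnW ?leqnn).
set S := \sum_(_ <= _ < _) _ in h *.
have -> : S = (S - g z * T z) + g z * T z by rewrite subrK.
rewrite (le_trans (ler_normD _ _)) // normrM (ger0_norm gz).
have h1 : g z * `|T z| <= g z * B by rewrite ler_wpM2l.
have h2 : 0 <= B * g y.+1 by rewrite mulr_ge0.
move: h h1 h2; clear; lra.
Qed.

(** From n to n + 1 the fourth power of the logarithm grows by at most exp(4 / (n ln n)), while
    n^(-sg) shrinks by at least exp(-1 / (n + 1)); ln n >= 8 and n + 1 <= 2 n make the second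
    win. *)
Lemma weight_antimono (sg : R) n : (0 < n)%N -> 1 <= sg -> 8 <= ln (n%:R : R) ->
  ln (n.+1%:R : R) ^+ 4 * pterm sg n.+1 <= ln (n%:R : R) ^+ 4 * pterm sg n.
Proof.
move=> n0 s1 ln8.
have n0' : 0 < (n%:R : R) by rewrite ltr0n.
have d1 := lnS_sub_le R n0; have d2 := lnS_sub_ge R n0.
set u := ln (n%:R : R) in ln8 d1 d2 *; set w := ln (n.+1%:R : R) in d1 d2 *.
have u0 : 0 < u by lra.
have w0 : 0 <= w by exact: ln_nat_ge0.
have h1 : w <= u * expR (n%:R^-1 / u).
  have := expR_ge1Dx (n%:R^-1 / u) => h.
  rewrite (le_trans _ (ler_wpM2l (ltW u0) h)) // mulrDr mulr1 mulrC divfK ?gt_eqF //.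
  by move: d1; clear; lra.
have h2 : w ^+ 4 <= u ^+ 4 * expR (4 * (n%:R^-1 / u)).
  by rewrite (expRM_natl 4) -exprMn lerXn2r ?nnegrE // mulr_ge0 ?expR_ge0 ?ltW.
have h3 : pterm sg n.+1 = pterm sg n * expR (- sg * (w - u)).
  by case: n n0 @u @w {n0' d1 d2 ln8 u0 w0 h1 h2} => // n _; rewrite /pterm -expRD; congr expR; ring.
have h4 : expR (- sg * (w - u)) <= expR (- n.+1%:R^-1).
  rewrite ler_expR mulNr lerN2 (le_trans d2) // ler_peMl //.
  by rewrite (le_trans _ d2) // invr_ge0.
have h5 : expR (4 * (n%:R^-1 / u)) * expR (- n.+1%:R^-1) <= 1.
  rewrite -expRD expR_le1 subr_le0 -[leRHS]div1r ler_pdivlMr ?ltr0n // -mulrA -mulrA.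
  have e8 : u^-1 <= 8^-1 by rewrite lef_pV2 ?posrE.
  have nn : n%:R^-1 * n.+1%:R <= 2 :> R.
    rewrite mulrC ler_pdivrMr // -natrM ler_nat; clear -n0; lia.
  have -> : 4 * (n%:R^-1 * (u^-1 * n.+1%:R)) = 4 * (u^-1 * (n%:R^-1 * n.+1%:R)) by ring.
  have : u^-1 * (n%:R^-1 * n.+1%:R) <= 8^-1 * 2.
    by apply: ler_pM => //; rewrite ?mulr_ge0 ?invr_ge0 ?ltW.
  clear; lra.
have p0 := pterm_ge0 sg n.
rewrite h3; apply: (@le_trans _ _ (u ^+ 4 * expR (4 * (n%:R^-1 / u)) * (pterm sg n * expR (- n.+1%:R^-1)))).
  apply: ler_pM => //; first exact: exprn_ge0.
    by rewrite mulr_ge0 ?expR_ge0.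
  by rewrite ler_wpM2l.
have -> : u ^+ 4 * expR (4 * (n%:R^-1 / u)) * (pterm sg n * expR (- n.+1%:R^-1)) =
  (u ^+ 4 * pterm sg n) * (expR (4 * (n%:R^-1 / u)) * expR (- n.+1%:R^-1)) by ring.
by rewrite ler_piMr // mulr_ge0 // exprn_ge0 // ltW.
Qed.

(** Abel summation divides by (ln n)^4 n^(-1-1/L). On this range the reciprocal weight is at most 16
    e e^L / L^4, and the partial sums are O(L). The condition L >= 16 gives ln n >= L / 2 >= 8,
    hence monotone weights. *)
Lemma vonM_window : exists (C L0 : R), [/\ 0 <= C, 1 <= L0 & forall L (y z : nat),
  L0 <= L -> expR (L / 2) <= y%:R -> (y <= z)%N -> z%:R <= expR L ->
  `|\sum_(y.+1 <= n < z.+1) (vonM R n - 1)| <= C * expR L / L ^+ 3].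
Proof.
have [C [L0 [C0 L01 hC]]] := perron_bound R.
exists (2 * C * (expR 1 * 16)), (16 + L0); split; [|lra|].
  by rewrite mulr_ge0 ?mulr_ge0 ?expR_ge0.
move=> L y z hL y1 yz z2.
have L1 : 16 <= L by clear -hL L01; lra.
have Lp : 0 < L by lra.
have e0 := expR_gt0 L; have L3 : 0 < L ^+ 3 by rewrite exprn_gt0.
have i0 : 0 < L^-1 by rewrite invr_gt0.
have rhs0 : 0 <= 2 * C * (expR 1 * 16) * expR L / L ^+ 3.
  apply: divr_ge0; last exact: ltW.
  by rewrite mulr_ge0 ?expR_ge0 // mulr_ge0 ?mulr_ge0 ?expR_ge0.
move: yz; rewrite leq_eqVlt => /orP[/eqP <-|yz]; first by rewrite big_geq // normr0.
pose sg := 1 + L^-1; have sg1 : 1 <= sg by rewrite /sg; lra.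
pose f n := ln (n%:R : R) ^+ 4 * pterm sg n.
have lnn n : (y <= n)%N -> L / 2 <= ln (n%:R : R).
  move=> yn; rewrite -ler_expR lnK; last first.
    by rewrite posrE (lt_le_trans (expR_gt0 (L / 2))) // (le_trans y1) // ler_nat.
  by rewrite (le_trans y1) // ler_nat.
have npos n : (y <= n)%N -> (0 < n)%N.
  by move=> yn; rewrite -(ltr0n R) (lt_le_trans (expR_gt0 (L / 2))) // (le_trans y1) // ler_nat.
have fpos n : (y <= n)%N -> 0 < f n.
  move=> yn; have := lnn n yn; have := npos n yn; case: n {yn} => // n _ h.
  by apply: mulr_gt0; [apply: exprn_gt0; clear -h Lp; lra|exact: expR_gt0].
have -> : \sum_(y.+1 <= n < z.+1) (vonM R n - 1) = \sum_(y.+1 <= n < z.+1) (f n)^-1 * bcoef sg n.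
  apply: eq_big_nat => n /andP[yn _].
  by rewrite /bcoef -/(f n) mulrC mulfK // gt_eqF // fpos // ltnW.
have hab : `|\sum_(y.+1 <= n < z.+1) (f n)^-1 * bcoef sg n| <= 2 * (C * L) * (f z)^-1.
  apply: abel_bound => //; first by rewrite mulr_ge0 // ltW.
  - by move=> n /andP[yn _]; rewrite invr_ge0 ltW // fpos // ltnW.
  - move=> n /andP[yn _]; rewrite lef_pV2 ?posrE ?fpos ?(ltnW yn) //; last by rewrite leqW // ltnW.
    apply: weight_antimono => //; first by apply: npos; exact: ltnW.
    have := lnn n (ltnW yn); clear -L1; lra.
  - move=> m /andP[ym mz]; apply: hC => //; first by clear -hL; lra.
    by rewrite (le_trans _ z2) // ler_nat.
rewrite (le_trans hab) //.
have z1 := lnn z (ltnW yz).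
have lnz : ln (z%:R : R) <= L by rewrite -ler_expR lnK // posrE ltr0n npos // ltnW.
have fz : (f z)^-1 <= expR 1 * 16 * expR L / L ^+ 4.
  have L4 : 0 < L ^+ 4 by rewrite exprn_gt0.
  rewrite -[leRHS]invrK lef_pV2 ?posrE ?invr_gt0 ?fpos ?(ltnW yz) //; last first.
    by rewrite mulr_gt0 ?invr_gt0 // mulr_gt0 ?mulr_gt0 ?expR_gt0.
  have -> : (expR 1 * 16 * expR L / L ^+ 4)^-1 = (L / 2) ^+ 4 * (expR (1 + L))^-1.
    by rewrite expRD; field; rewrite !gt_eqF ?expR_gt0.
  have l2 : 0 <= L / 2 by clear -Lp; lra.
  rewrite /f; apply: ler_pM; rewrite ?invr_ge0 ?expR_ge0 ?exprn_ge0 //.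
    by rewrite lerXn2r ?nnegrE // (le_trans l2).
  move: (npos z (ltnW yz)) lnz; case: (z) => // z' _ lnz.
  rewrite /pterm -expRN ler_expR /sg mulNr lerN2 mulrDl mul1r addrC lerD //.
  by rewrite mulrC ler_pdivrMr // mul1r.
have cl0 : 0 <= 2 * (C * L) by rewrite mulr_ge0 // mulr_ge0 // ltW.
rewrite (le_trans (ler_wpM2l cl0 fz)) // le_eqVlt; apply/orP; left; apply/eqP.
by field; rewrite gt_eqF.
Qed.

Definition psi n : R := \sum_(0 <= k < n.+1) vonM R k.
Definition theta n : R := \sum_(0 <= p < n.+1 | prime p) ln p%:R.

Lemma vonM0 : vonM R 0 = 0.
Proof. by rewrite /vonM big_mkcond big_nat1. Qed.

Lemma psi_small L (z : nat) : 1 <= L -> z%:R <= expR L -> `|psi z - z%:R| <= z%:R * L.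
Proof.
move=> L1 zL.
have h1 : psi z <= z%:R * L.
  rewrite /psi big_ltn // vonM0 add0r.
  apply: (@le_trans _ _ (\sum_(1 <= k < z.+1) L)).
    rewrite big_nat [leRHS]big_nat; apply: ler_sum => k /andP[k1 kz].
    rewrite (le_trans (vonM_le R k)) // -ler_expR lnK ?posrE ?ltr0n //.
    by rewrite (le_trans _ zL) // ler_nat.
  by rewrite big_const_nat iter_addr_0 subn1 mulr_natl.
have h2 : 0 <= psi z by apply: sumr_ge0 => k _; exact: vonM_ge0.
have h3 : z%:R <= z%:R * L :> R by rewrite ler_peMr.
have z0 : 0 <= z%:R :> R by [].
rewrite ler_norml; move: h1 h2 h3 z0; clear; lra.
Qed.

Lemma sqrt_nat L : 0 <= L -> exists y : nat, expR (L / 2) <= y%:R /\ y%:R <= 2 * expR (L / 2).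
Proof.
move=> L0; have e0 := expR_gt0 (L / 2).
have e1 : 1 <= expR (L / 2) by have := expR_ge1Dx (L / 2); lra.
exists (Num.truncn (expR (L / 2))).+1; split; first by rewrite ltW // truncnS_gt.
have : (Num.truncn (expR (L / 2)))%:R <= expR (L / 2) by rewrite truncn_le // ltW.
rewrite -natr1; lra.
Qed.

Lemma half_power m : exists E : R, 0 <= E /\ forall L k, 0 < L -> (k <= m)%N -> 1 <= L ->
  L ^+ k * expR (L / 2) <= E * expR L / L ^+ (m - k).
Proof.
exists (m`!%:R * 2 ^+ m); split; first by apply: mulr_ge0 => //; exact: exprn_ge0.
move=> L k L0 km L1; rewrite ler_pdivlMr ?exprn_gt0 //.
rewrite mulrAC -exprD subnKC // (_ : expR L = expR (L / 2) * expR (L / 2)); last first.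
  by rewrite -expRD; congr expR; field.
by rewrite mulrA ler_wpM2r ?expR_ge0 // pow_le_expR_half // ltW.
Qed.

(** The error is measured at a common height e^L rather than at z, so that both ends of a short
    interval share it. Below e^(L/2) the trivial bound is enough, by [half_power]. *)
Lemma psi_bound : exists (C L0 : R), [/\ 0 <= C, 1 <= L0 & forall L (z : nat),
  L0 <= L -> z%:R <= expR L -> `|psi z - z%:R| <= C * expR L / L ^+ 3].
Proof.
have [C [L0 [C0 L01 hC]]] := vonM_window.
have [E [E0 hE]] := half_power 4.
exists (C + 2 * E), L0; split => //; first by rewrite addr_ge0 // mulr_ge0.
move=> L z hL zL; have L1 : 1 <= L by lra.
have Lp : 0 < L by lra.
have [y [y1 y2]] := sqrt_nat (ltW Lp).
have small w : (w <= y)%N -> w%:R <= expR L -> `|psi w - w%:R| <= 2 * E * expR L / L ^+ 3.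
  move=> wy wL; rewrite (le_trans (psi_small L1 wL)) //.
  have h := hE L 1%N Lp isT L1; rewrite expr1 subSS subn0 in h.
  have : w%:R * L <= 2 * expR (L / 2) * L.
    by rewrite ler_wpM2r ?(ltW Lp) // (le_trans _ y2) // ler_nat.
  move: h; rewrite -!mulrA; move: (E * _) => u; clear; lra.
have Cpos : 0 <= C * expR L / L ^+ 3.
  by apply: divr_ge0; [apply: mulr_ge0; rewrite ?expR_ge0|rewrite exprn_ge0 // ltW].
have tgt : (C + 2 * E) * expR L / L ^+ 3 = C * expR L / L ^+ 3 + 2 * E * expR L / L ^+ 3 by ring.
rewrite tgt; have [zy|/ltnW yz] := leqP z y.
  by rewrite (le_trans (small z zy zL)) // lerDr.
have hy := small y (leqnn y) ltac:(by rewrite (le_trans _ zL) // ler_nat).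
have hz := hC L y z hL y1 yz zL.
have -> : psi z - z%:R = \sum_(y.+1 <= n < z.+1) (vonM R n - 1) + (psi y - y%:R).
  rewrite /psi (big_cat_nat (leq0n _) (_ : y.+1 <= z.+1)%N) //= big_split /=.
  rewrite sumrN big_const_nat iter_addr_0 subSS.
  rewrite natrB //; ring.
by rewrite (le_trans (ler_normD _ _)) // lerD.
Qed.

End PrimeNumberTheorem.

(** * Primes in short intervals *)

Section PrimesInIntervals.
Context (R : realType).
Implicit Types (L : R).

Lemma psi_sub_theta z : psi R z - theta R z =
  \sum_(0 <= p < z.+1 | prime p) \sum_(2 <= i < z.+1) (if (p ^ i <= z)%N then ln (p%:R : R) else 0).
Proof.
have -> : psi R z = \sum_(0 <= p < z.+1 | prime p)
    \sum_(1 <= i < z.+1) (if (p ^ i <= z)%N then ln (p%:R : R) else 0).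
  rewrite /psi big_nat; under eq_bigr => k /andP[_ kz] do rewrite (vonME R kz).
  rewrite -big_nat exchange_big /=; apply: eq_bigr => p _.
  rewrite (exchange_big_dep xpredT) //=; apply: eq_bigr => i _.
  rewrite (eq_bigl (fun k => k == p ^ i)%N) => [|k]; last by rewrite eq_sym.
  by rewrite big_nat1_eq /= ltnS.
rewrite /theta -sumrB; case: z => [|z].
  by rewrite [LHS]big_mkcond [RHS]big_mkcond [LHS]big_nat1 [RHS]big_nat1.
rewrite big_nat_cond [RHS]big_nat_cond; apply: eq_bigr => p /andP[/andP[_ pz] _].
by rewrite big_ltn // expn1 -ltnS pz addrAC subrr add0r.
Qed.

Lemma ln2_ge : 2^-1 <= ln 2 :> R.
Proof.
rewrite -ler_expR lnK ?posrE // -[X in expR X]opprK expRN -[leRHS]invrK.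
rewrite lef_pV2 ?posrE ?expR_gt0 //.
by have := expR_ge1Dx (- 2^-1 : R); lra.
Qed.

Lemma theta_bound : exists (C L0 : R), [/\ 0 <= C, 1 <= L0 & forall L (z : nat),
  L0 <= L -> z%:R <= expR L -> `|theta R z - z%:R| <= C * expR L / L ^+ 3].
Proof.
have [C [L0 [C0 L01 hC]]] := psi_bound R.
have [E [E0 hE]] := half_power R 5.
exists (C + 12 * E), L0; split => //; first by rewrite addr_ge0 // mulr_ge0.
move=> L z hL zL; have L1 : 1 <= L by lra.
have Lp : 0 < L by lra.
have [y [y1 y2]] := sqrt_nat (ltW Lp).
have y1' : 1 <= y%:R :> R by have := expR_ge1Dx (L / 2); lra.
(* Higher prime powers p^i <= z are few: i >= 2 forces ln p <= L / 2, hence p <= y, and ln p >= 1/2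
   forces i <= 2 L. *)
pose K := (Num.truncn (2 * L)).+1.
have K1 : 2 * L < K%:R by rewrite truncnS_gt.
have K2 : K%:R <= 3 * L.
  have : (Num.truncn (2 * L))%:R <= 2 * L by rewrite truncn_le // mulr_ge0 // ltW.
  have -> : K%:R = (Num.truncn (2 * L))%:R + 1 :> R by rewrite natr1.
  by lra.
have inner p : prime p -> \sum_(2 <= i < z.+1) (if (p ^ i <= z)%N then ln (p%:R : R) else 0) <=
    3 * L ^+ 2 * (if (0 <= p < y.+1)%N then 1 else 0).
  move=> pp; have p1 := prime_gt1 pp; have p0 : (0 < p)%N by exact: ltnW.
  have bnd i : (2 <= i)%N -> (p ^ i <= z)%N -> [/\ (p < y.+1)%N, (0 <= i < K)%N & ln (p%:R : R) <= L].
    move=> i2 piz.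
    have piL (k : nat) : (p ^ k <= z)%N -> k%:R * ln p%:R <= L.
      move=> pk; rewrite mulr_natl -lnXn ?ltr0n // -ler_expR lnK ?posrE ?exprn_gt0 ?ltr0n //.
      by rewrite -natrX (le_trans _ zL) // ler_nat.
    have lp := ln_nat_ge0 R p.
    have p2 : ln (p%:R : R) <= L / 2.
      have := piL 2%N (leq_trans (_ : p ^ 2 <= p ^ i)%N piz).
      rewrite leq_exp2l // => /(_ i2); lra.
    split.
    - rewrite ltnS -(ler_nat R) (le_trans _ y1) // -[leLHS]lnK ?posrE ?ltr0n // ler_expR.
      exact: p2.
    - rewrite /= -(ltr_nat R) (le_lt_trans _ K1) //.
      have := piL i piz; have : 2^-1 <= ln (p%:R : R).
        by rewrite (le_trans ln2_ge) // ler_ln_nat.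
      move=> h2 h; have : i%:R * 2^-1 <= i%:R * ln (p%:R : R) by rewrite ler_wpM2l.
      lra.
    - by move: p2; clear -Lp; lra.
  case: ifPn => py; last first.
    rewrite mulr0 big_nat big1 // => i /andP[i2 _]; case: ifPn => // piz.
    by have [h _ _] := bnd i i2 piz; rewrite h in py.
  rewrite mulr1; apply: (@le_trans _ _ (\sum_(0 <= i < z.+1) L * (if (0 <= i < K)%N then 1 else 0))).
    have nn i : 0 <= L * (if (0 <= i < K)%N then 1 else 0) :> R.
      by case: ifP; rewrite ?mulr1 ?mulr0 // ltW.
    have [z2|z2] := leqP 2 z.+1; last first.
      by rewrite big_geq ?sumr_ge0 //; exact: ltnW.
    rewrite [leRHS](big_cat_nat (leq0n _) z2) /= -[leLHS]add0r lerD //.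
      by apply: sumr_ge0 => i _; exact: nn.
    rewrite big_nat [leRHS]big_nat; apply: ler_sum => i /andP[i2 _].
    case: ifPn => [piz|_]; last exact: nn.
    by have [_ hK hl] := bnd i i2 piz; rewrite /= in hK; rewrite hK mulr1.
  rewrite -mulr_sumr; apply: (@le_trans _ _ (L * (3 * L))).
    by rewrite ler_wpM2l ?(ltW Lp) // (le_trans _ K2) // (le_trans (count_interval R _ 0 K)) // subn0.
  by rewrite mulrCA -expr2.
have diff : 0 <= psi R z - theta R z <= 12 * E * expR L / L ^+ 3.
  rewrite psi_sub_theta; apply/andP; split.
    by do 2![apply: sumr_ge0 => ? _]; case: ifP => // _; exact: ln_nat_ge0.
  apply: (@le_trans _ _ (\sum_(0 <= p < z.+1) 3 * L ^+ 2 * (if (0 <= p < y.+1)%N then 1 else 0))).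
    rewrite [leLHS]big_mkcond; apply: ler_sum => p _; case: ifP => [/inner //|_].
    by case: ifP; rewrite ?mulr1 ?mulr0 // mulr_ge0 // exprn_ge0 // ltW.
  rewrite -mulr_sumr; have L20 : 0 <= 3 * L ^+ 2 by rewrite mulr_ge0 // exprn_ge0 // ltW.
  rewrite (le_trans (ler_wpM2l L20 (count_interval R _ 0 y.+1))) // subn0.
  have h := hE L 2%N Lp isT L1; rewrite !subSS subn0 in h.
  have yy : y.+1%:R <= 4 * expR (L / 2) by rewrite -natr1; lra.
  rewrite (le_trans (ler_wpM2l L20 yy)) //.
  have -> : 3 * L ^+ 2 * (4 * expR (L / 2)) = 12 * (L ^+ 2 * expR (L / 2)) by ring.
  by move: h; rewrite -!mulrA; move: (E * _) => u; clear; lra.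
have hp := hC L z hL zL.
have -> : theta R z - z%:R = (psi R z - z%:R) - (psi R z - theta R z) by ring.
rewrite (le_trans (ler_normB _ _)) //.
have -> : (C + 12 * E) * expR L / L ^+ 3 = C * expR L / L ^+ 3 + 12 * E * expR L / L ^+ 3 by ring.
by case/andP: diff => d1 d2; rewrite lerD // ger0_norm.
Qed.

Definition npr (x m : nat) : nat := \sum_(x.+1 <= p < (x + m).+1 | prime p) 1.

Lemma theta_sub x m : theta R (x + m) - theta R x =
  \sum_(x.+1 <= p < (x + m).+1 | prime p) ln (p%:R : R).
Proof.
have h : (x.+1 <= (x + m).+1)%N by rewrite ltnS leq_addr.
by rewrite /theta (big_cat_nat (leq0n _) h) /= addrAC subrr add0r.
Qed.

Lemma sum_npr x m (c : R) :
  \sum_(x.+1 <= p < (x + m).+1 | prime p) c = (npr x m)%:R * c.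
Proof.
rewrite /npr natr_sum mulr_suml; apply: eq_bigr => p _; by rewrite mul1r.
Qed.

Lemma theta_sub_le x m L : (x + m)%:R <= expR L ->
  theta R (x + m) - theta R x <= (npr x m)%:R * L.
Proof.
move=> xmL; rewrite theta_sub -sum_npr big_nat_cond [leRHS]big_nat_cond.
apply: ler_sum => p /andP[/andP[xp pxm] _].
rewrite -ler_expR lnK ?posrE ?ltr0n ?(leq_trans _ xp) // (le_trans _ xmL) // ler_nat.
by rewrite -ltnS.
Qed.

(** The primes up to [T], at most [T] of them, are thrown away: the interval may start near 0, where
    ln p is too small to be compared with [u]. *)
Lemma theta_sub_ge x m (T u : R) : 0 <= T -> 0 <= u ->
  (forall p : nat, (0 < p)%N -> T < p%:R -> u <= ln p%:R) ->
  ((npr x m)%:R - T) * u <= theta R (x + m) - theta R x.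
Proof.
move=> T0 u0 hu; rewrite theta_sub.
pose k := Num.truncn T.
have cnt : \sum_(x.+1 <= p < (x + m).+1) (if (1 <= p < k.+1)%N then 1 else 0) <= T.
  apply: (@le_trans _ _ (\sum_(0 <= p < (x + m).+1) (if (1 <= p < k.+1)%N then 1 else 0))).
    have h : (x.+1 <= (x + m).+1)%N by rewrite ltnS leq_addr.
    rewrite [leRHS](big_cat_nat (leq0n _) h) /= lerDr.
    by apply: sumr_ge0 => p _; case: ifP.
  rewrite (le_trans (count_interval R _ 1 k.+1)) // subn1 /= /k truncn_le //.
apply: (@le_trans _ _ (\sum_(x.+1 <= p < (x + m).+1 | prime p) (u - u * (if (1 <= p < k.+1)%N then 1 else 0)))).
  rewrite sumrB sum_npr mulrBl lerD2l lerN2 -mulr_sumr [leRHS]mulrC ler_wpM2l //.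
  rewrite (le_trans _ cnt) // big_mkcond; apply: ler_sum => p _.
  by case: ifP => // _; case: ifP.
rewrite big_nat_cond [leRHS]big_nat_cond; apply: ler_sum => p /andP[/andP[xp _] _].
have p0 : (0 < p)%N by rewrite (leq_trans _ xp).
rewrite p0 /=; case: ltnP => pk; first by rewrite mulr1 subrr ln_nat_ge0.
rewrite mulr0 subr0 hu // (lt_le_trans (truncnS_gt T)) // ler_nat //.
Qed.

(** Write l = ln M and w = ln l. Over the interval theta grows by M + O(M / l). Dividing by ln p <=
    l + 3 w bounds the number of primes from below; for the other side, ln p >= l - 2 w once the
    primes up to M / l^2 are discarded. *)
Lemma prime_interval : exists (C : R) (M0 : nat), 1 <= C /\ forall M x : nat, (M0 <= M)%N ->
  (x + M)%:R <= 30 * M%:R * ln (M%:R : R) ^+ 2 ->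
  [/\ 1 <= ln (ln (M%:R : R)), M%:R <= (npr x M)%:R * (ln M%:R + C * ln (ln M%:R)) &
      (npr x M)%:R * (ln M%:R - C * ln (ln M%:R)) <= M%:R].
Proof.
have [C [L0 [C0 L01 hC]]] := theta_bound.
(* Each endpoint has an error of at most 30 C M / l, since e^L = 30 M l^2 and L >= l. *)
pose c := 60 * C; have c0 : 0 <= c by rewrite mulr_ge0.
have [La [La1 hLa]] := pow_ln_le 1 (2 : R).
have [M0 hM0] := ln_nat_unbounded (30 + L0 + 2 * c + La).
(* As 1 - d >= 1/2, half of this constant covers the 3 w from ln p and the [c] from the error in
   theta. *)
exists (6 + 2 * c), M0; split; first lra.
move=> M x MM xM; have hl := hM0 M MM.
set l := ln (M%:R : R) in hl xM *; set w := ln l.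
have l30 : 30 <= l by lra.
have l0 : 0 < l by lra.
have Mp : 0 < M%:R :> R.
  by rewrite ltNge; apply/negP => h; move: l30; rewrite /l ln0 //; lra.
have e4 : expR 1 <= 4 :> R.
  have := expR_ge1Dx (- 2^-1 : R) => h.
  have h2 : expR 2^-1 <= 2 :> R.
    rewrite -[2^-1]opprK expRN -[leRHS]invrK lef_pV2 ?posrE ?expR_gt0 //; lra.
  rewrite (_ : 1 = 2 * 2^-1 :> R); last by rewrite mulfV.
  rewrite (expRM_natl 2) (le_trans (_ : _ <= 2 ^+ 2)) //; last by rewrite expr2; lra.
  by rewrite lerXn2r ?nnegrE ?expR_ge0.
have w1 : 1 <= w by rewrite -ler_expR /w lnK //; lra.
have wl : 2 * w <= l by have := hLa l ltac:(lra); rewrite expr1 -/w; lra.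
pose L := ln 30 + l + 2 * w.
have ln30a : 0 <= ln (30 : R) by rewrite ln_ge0 //; lra.
have ln30b : ln (30 : R) <= w by rewrite /w ler_ln ?posrE.
have eL : expR L = 30 * M%:R * l ^+ 2 by rewrite /L !expRD (expRM_natl 2) !lnK ?posrE.
have lL : l <= L by rewrite /L; lra.
have LL : L <= l + 3 * w by rewrite /L; lra.
pose e := c * M%:R / l.
have err z : z%:R <= expR L -> `|theta R z - z%:R| <= 2^-1 * e.
  move=> zL; have L0L : L0 <= L by lra.
  rewrite (le_trans (hC L z L0L zL)) // eL.
  apply: (@le_trans _ _ (C * (30 * M%:R * l ^+ 2) / l ^+ 3)).
    apply: ler_wpM2l.
      by apply: mulr_ge0 => //; apply: mulr_ge0; [apply: mulr_ge0; rewrite ?ltW|exact: sqr_ge0].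
    by rewrite lef_pV2 ?posrE ?exprn_gt0 ?lerXn2r ?nnegrE //; lra.
  by rewrite le_eqVlt; apply/orP; left; apply/eqP; rewrite /e /c; field; rewrite gt_eqF.
have e1 := err (x + M)%N ltac:(by rewrite eL).
have e2 := err x ltac:(by rewrite eL (le_trans _ xM) // ler_nat leq_addr).
pose D := theta R (x + M) - theta R x.
have hD : `|D - M%:R| <= e.
  have -> : D - M%:R = (theta R (x + M) - (x + M)%:R) - (theta R x - x%:R).
    by rewrite /D natrD; ring.
  by rewrite (le_trans (ler_normB _ _)) //; move: e1 e2; clear; lra.
have [D1 D2] : M%:R - e <= D /\ D <= M%:R + e.
  by move: hD; rewrite ler_norml => /andP[? ?]; split; lra.
have n0 : 0 <= (npr x M)%:R :> R by [].
pose d := c / l; have eE : e = d * M%:R by rewrite /e /d; ring.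
have d0 : 0 <= d by rewrite divr_ge0 // ltW.
have d1 : d <= 2^-1 by rewrite ler_pdivrMr //; lra.
have dl : d * l = c by rewrite divfK // gt_eqF.
split => //.
- have up := theta_sub_le (_ : (x + M)%:R <= expR L); rewrite -/D in up.
  have {}up := up ltac:(by rewrite eL).
  have s1 : (1 - d) * M%:R <= (npr x M)%:R * (l + 3 * w).
    have := ler_wpM2l n0 LL; rewrite eE in D1; move: up D1; clear; lra.
  have s2 : l + 3 * w <= (1 - d) * (l + (6 + 2 * c) * w).
    have -> : (1 - d) * (l + (6 + 2 * c) * w) = l - d * l + (1 - d) * ((6 + 2 * c) * w) by ring.
    rewrite dl; have cw : 0 <= (6 + 2 * c) * w by rewrite mulr_ge0; lra.
    have : 2^-1 * ((6 + 2 * c) * w) <= (1 - d) * ((6 + 2 * c) * w) by rewrite ler_wpM2r //; clear -d1; lra.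
    have : c <= c * w by rewrite ler_peMr.
    move: w1; clear; lra.
  have d1' : 0 < 1 - d by clear -d1; lra.
  rewrite -(ler_pM2l d1') (le_trans s1) // mulrCA ler_wpM2l //.
(* A prime above M / l^2 has logarithm at least l - 2 w, and the discarded part costs at most T l =
   M / l. *)
- pose T := M%:R / l ^+ 2; have l2 : 0 < l ^+ 2 by rewrite exprn_gt0.
  have T0 : 0 <= T by rewrite divr_ge0 // ltW.
  have u0 : 0 <= l - 2 * w by clear -wl; lra.
  have hT (p : nat) : (0 < p)%N -> T < p%:R -> l - 2 * w <= ln p%:R.
    move=> p0 Tp; rewrite -ler_expR lnK ?posrE ?ltr0n // (le_trans _ (ltW Tp)) //.
    by rewrite expRB (expRM_natl 2) /w !lnK ?posrE.
  have low := theta_sub_ge x M T0 u0 hT; rewrite -/D in low.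
  have Tl : T * (l - 2 * w) <= M%:R / l.
    apply: (@le_trans _ _ (T * l)); first by rewrite ler_wpM2l //; clear -w1; lra.
    by rewrite le_eqVlt; apply/orP; left; apply/eqP; rewrite /T; field; rewrite gt_eqF.
  pose f := (c + 1) / l.
  have f0 : 0 < f by rewrite divr_gt0 //; clear -c0; lra.
  have fl : f * l = c + 1 by rewrite divfK // gt_eqF.
  have s1 : (npr x M)%:R * (l - 2 * w) <= (1 + f) * M%:R.
    have -> : (1 + f) * M%:R = M%:R + e + M%:R / l by rewrite /f /e; ring.
    by move: low D2 Tl; rewrite mulrBl; clear; lra.
  have s2 : (1 + f) * (l - (6 + 2 * c) * w) <= l - 2 * w.
    have -> : (1 + f) * (l - (6 + 2 * c) * w) = l + f * l - (6 + 2 * c) * w - f * ((6 + 2 * c) * w) by ring.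
    rewrite fl; have cw : 0 <= (6 + 2 * c) * w by rewrite mulr_ge0; clear -c0 w1; lra.
    have := mulr_ge0 (ltW f0) cw.
    have : c <= c * w by rewrite ler_peMr.
    move: w1; clear -c0; lra.
  have f1 : 0 < 1 + f by clear -f0; lra.
  rewrite -(ler_pM2l f1) (le_trans _ s1) // mulrCA ler_wpM2l //.
Qed.

Lemma many_primes : exists n0 : nat, forall n : nat, (n0 <= n)%N ->
  n%:R <= 2 * ln n%:R * (npr 0 n)%:R :> R.
Proof.
have [C [L0 [C0 L01 hC]]] := theta_bound.
have [n0 hn0] := ln_nat_unbounded (L0 + 2 * C).
exists n0.+1 => n nn; have hl := hn0 n (ltnW nn).
have np : 0 < n%:R :> R by rewrite ltr0n (leq_trans _ nn).
set L := ln (n%:R : R) in hl *.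
have L1 : 1 <= L by lra.
have nL : (0 + n)%:R <= expR L by rewrite add0n lnK.
have h := hC L n ltac:(lra) nL; rewrite lnK // in h.
have up := theta_sub_le nL.
have t0 : theta R 0 = 0 by rewrite /theta big_mkcond big_nat1.
rewrite t0 subr0 add0n in up.
have small : C * n%:R / L ^+ 3 <= 2^-1 * n%:R.
  have Lp : 0 < L by lra.
  have L3 := exprn_gt0 3 Lp; rewrite ler_pdivrMr //.
  have : 2 * C <= L ^+ 3.
    rewrite (@le_trans _ _ L) //; first lra.
    by rewrite exprS ler_peMr ?exprn_ege1 //; lra.
  move=> /(ler_wpM2l (ltW np)); lra.
move: h; rewrite ler_norml => /andP[h _].
lra.
Qed.

End PrimesInIntervals.

(** * Survival probabilities of the walk *)

Section SurvivalRecursion.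
Context (R : realType) (M : nat).

(* The probability that the walk started at [x] meets no prime in its first [n] steps. *)
Fixpoint surv n x : R :=
  if n is n'.+1 then
    (\sum_(i < M) (if prime (x + i.+1) then 0 else surv n' (x + i.+1)%N)) / M%:R
  else 1.

(** The event of [first_prime_at] for a walk started at [x]; a variable start is what lets the first
    step be peeled off by induction. *)
Definition hits (r x : nat) (eta : {ffun 'I_r -> 'I_M}) : bool :=
  [forall l : 'I_r, (1 <= l)%N ==> ~~ prime (x + partial_sum eta l)] &&
  prime (x + partial_sum eta r).

Definition fcons r (ae : 'I_M * {ffun 'I_r -> 'I_M}) : {ffun 'I_r.+1 -> 'I_M} :=
  [ffun i => if unlift ord0 i is Some j then ae.2 j else ae.1].

Lemma fcons_bij r : bijective (@fcons r).
Proof.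
exists (fun f : {ffun 'I_r.+1 -> 'I_M} => (f ord0, [ffun j : 'I_r => f (lift ord0 j)])).
  move=> [a e]; rewrite /fcons; congr pair; first by rewrite ffunE unlift_none.
  by apply/ffunP => j; rewrite !ffunE liftK.
move=> f; apply/ffunP => i; rewrite ffunE /=.
by case: unliftP => [j ->|->]; rewrite ?ffunE.
Qed.

Lemma partial_sum0 r (e : {ffun 'I_r -> 'I_M}) : partial_sum e 0 = 0%N.
Proof. by rewrite /partial_sum big1. Qed.

Lemma partial_sum_fcons r a (e : {ffun 'I_r -> 'I_M}) l :
  partial_sum (fcons (a, e)) l.+1 = (a.+1 + partial_sum e l)%N.
Proof.
rewrite /partial_sum big_mkcond big_ord_recl /= ffunE unlift_none /=; congr addn.
by rewrite [RHS]big_mkcond; apply: eq_bigr => i _; rewrite ffunE liftK.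
Qed.

Lemma hits1 x a (e : {ffun 'I_0 -> 'I_M}) : hits x (fcons (a, e)) = prime (x + a.+1).
Proof.
rewrite /hits partial_sum_fcons partial_sum0 addn0.
by rewrite (_ : [forall _, _] = true) //; apply/forallP => l; case: l => -[|l].
Qed.

Lemma hitsS r x a (e : {ffun 'I_r.+1 -> 'I_M}) :
  hits x (fcons (a, e)) = ~~ prime (x + a.+1) && hits (x + a.+1) e.
Proof.
rewrite /hits partial_sum_fcons addnA [RHS]andbA; congr andb.
apply/forallP/andP => [h|[h1 /forallP h2] l].
  split; first by have := h (lift ord0 ord0); rewrite /= partial_sum_fcons partial_sum0 addn0.
  apply/forallP => l; have := h (lift ord0 l); rewrite /= partial_sum_fcons addnA.
  by move=> ->; rewrite implybT.
case: (unliftP ord0 l) => [j ->|-> //]; rewrite /= partial_sum_fcons addnA /bump /=.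
have := h2 j; case: (nat_of_ord j) => [|j'] //.
by rewrite partial_sum0 addn0.
Qed.

Definition phit r x : R := #|[set eta : {ffun 'I_r -> 'I_M} | hits x eta]|%:R / M%:R ^+ r.

Lemma card_hits r x : #|[set eta : {ffun 'I_r.+1 -> 'I_M} | hits x eta]| =
  (\sum_(a < M) #|[set e : {ffun 'I_r -> 'I_M} | hits x (fcons (a, e))]|)%N.
Proof.
rewrite -sum1dep_card (reindex _ (onW_bij _ (fcons_bij r))) /=.
under [RHS]eq_bigr do rewrite -sum1dep_card.
rewrite pair_big_dep /=; apply: eq_bigl => -[a e] //.
Qed.

Hypothesis M0 : (0 < M)%N.
Let M0' : (M%:R : R) != 0. Proof. by rewrite pnatr_eq0 -lt0n. Qed.

(** Conditioning on the first step: a prime first step ends the walk, any other leaves a shorter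
    walk with a new start, which is also the recursion of [surv]. *)
Lemma phit_surv r x : phit r.+1 x = surv r x - surv r.+1 x.
Proof.
elim: r x => [|r IH] x.
  rewrite /phit card_hits expr1 natr_sum /=.
  transitivity ((M%:R - \sum_(i < M) (if prime (x + i.+1) then 0 else 1)) / M%:R : R); last first.
    by rewrite mulrBl mulfV.
  congr (_ / _).
  have -> : (M%:R : R) = \sum_(i < M) 1 by rewrite sumr_const card_ord.
  rewrite -sumrB; apply: eq_bigr => a _.
  have -> : #|[set e : {ffun 'I_0 -> 'I_M} | hits x (fcons (a, e))]| = prime (x + a.+1) :> nat.
    case: (boolP (prime (x + a.+1))) => pp.
      rewrite (_ : [set _ | _] = finset.setTfor {ffun 'I_0 -> 'I_M}) ?cardsT ?card_ffun ?card_ord //.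
      by apply/setP => e; rewrite !inE hits1 pp.
    rewrite (_ : [set _ | _] = finset.set0) ?cards0 //.
    by apply/setP => e; rewrite !inE hits1 (negbTE pp).
  by case: (prime _); rewrite ?subr0 ?subrr.
rewrite /phit card_hits natr_sum exprS invfM mulrCA mulr_suml mulrC.
rewrite [surv r.+1 x]/= [surv r.+2 x]/= -mulrBl -sumrB; congr (_ / _).
apply: eq_bigr => a _; case: ifP => pp.
  rewrite subr0 (_ : [set _ | _] = finset.set0) ?cards0 ?mul0r //.
  by apply/setP => e; rewrite !inE hitsS pp.
rewrite -IH /phit; congr (_%:R / _); apply: eq_card => e.
by rewrite !inE hitsS pp.
Qed.

Lemma pr_tau_surv r : pr_tau_eq R M r.+1 = surv r 0 - surv r.+1 0.
Proof.
by rewrite -phit_surv /phit /pr_tau_eq; congr (_%:R / _); apply: eq_card => e.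
Qed.

Lemma surv_ge0 n x : 0 <= surv n x.
Proof.
elim: n x => [|n IH] x //=; apply: divr_ge0 => //.
by apply: sumr_ge0 => i _; case: ifP.
Qed.

Lemma surv_step n x : surv n.+1 x <= surv n x.
Proof.
have : 0 <= phit n.+1 x by rewrite divr_ge0 // exprn_ge0.
by rewrite phit_surv subr_ge0.
Qed.

Lemma surv_noninc m n : (m <= n)%N -> surv n 0 <= surv m 0.
Proof.
elim: n => [|n IH]; first by rewrite leqn0 => /eqP ->.
rewrite leq_eqVlt => /orP[/eqP -> //|]; rewrite ltnS => /IH; apply: le_trans.
exact: surv_step.
Qed.

Lemma sum_nonprime x (c : R) :
  (\sum_(i < M) (if prime (x + i.+1) then 0 else c)) / M%:R = (1 - (npr x M)%:R / M%:R) * c.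
Proof.
have E : (npr x M)%:R * c = \sum_(i < M) (if prime (x + i.+1) then c else 0).
  rewrite -sum_npr big_mkcond -[x.+1]add0n big_addn subSS addKn big_mkord.
  by apply: eq_bigr => i _; rewrite addnC addSnnS.
have F : (npr x M)%:R * c + \sum_(i < M) (if prime (x + i.+1) then 0 else c) = M%:R * c.
  rewrite E -big_split /= (eq_bigr (fun=> c)).
    by rewrite sumr_const card_ord mulr_natl.
  by move=> i _; case: ifP; rewrite ?addr0 ?add0r.
have -> : \sum_(i < M) (if prime (x + i.+1) then 0 else c) = M%:R * c - (npr x M)%:R * c.
  by rewrite -F addrAC subrr add0r.
by field.
Qed.

(** By [sum_nonprime] one step multiplies a constant bound by 1 minus the proportion of primes in
    the next window. Steps are at most [M], so all windows met within [n] steps end by [Y]. *)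
Lemma surv_lower (la : R) Y n x : 1 <= la ->
  (forall z, (z + M <= Y)%N -> (npr z M)%:R * la <= M%:R) ->
  (x + n * M <= Y)%N -> (1 - la^-1) ^+ n <= surv n x.
Proof.
move=> la1 hY; have la0 : 0 < la by rewrite (lt_le_trans ltr01).
have M0'' : 0 < (M%:R : R) by rewrite ltr0n.
have a0 : 0 <= 1 - la^-1 by rewrite subr_ge0 invf_le1.
elim: n x => [|n IH] x xY; first by rewrite expr0.
rewrite /= mulSn in xY *.
apply: (@le_trans _ _ ((\sum_(i < M) (if prime (x + i.+1) then 0 else (1 - la^-1) ^+ n)) / M%:R)).
  rewrite sum_nonprime exprS ler_wpM2r ?exprn_ge0 // lerD2l lerN2.
  rewrite ler_pdivrMr // mulrC ler_pdivlMr // hY // (leq_trans _ xY) //.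
  by rewrite addnA leq_addr.
rewrite ler_wpM2r ?invr_ge0 //; apply: ler_sum => i _; case: ifP => // _.
apply: IH; rewrite (leq_trans _ xY) // addnA leq_add2r leq_add2l //.
Qed.

Lemma surv_upper (la : R) Y n x : 1 <= la ->
  (forall z, (z + M <= Y)%N -> M%:R <= (npr z M)%:R * la) ->
  (x + n * M <= Y)%N -> surv n x <= (1 - la^-1) ^+ n.
Proof.
move=> la1 hY; have la0 : 0 < la by rewrite (lt_le_trans ltr01).
have M0'' : 0 < (M%:R : R) by rewrite ltr0n.
have a0 : 0 <= 1 - la^-1 by rewrite subr_ge0 invf_le1.
elim: n x => [|n IH] x xY; first by rewrite expr0.
rewrite /= mulSn in xY *.
apply: (@le_trans _ _ ((\sum_(i < M) (if prime (x + i.+1) then 0 else (1 - la^-1) ^+ n)) / M%:R)).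
  rewrite ler_wpM2r ?invr_ge0 //; apply: ler_sum => i _; case: ifP => // _.
  apply: IH; rewrite (leq_trans _ xY) // addnA leq_add2r leq_add2l //.
rewrite sum_nonprime exprS ler_wpM2r ?exprn_ge0 // lerD2l lerN2.
rewrite ler_pdivlMr // mulrC ler_pdivrMr // hY // (leq_trans _ xY) //.
by rewrite addnA leq_addr.
Qed.

Lemma bernoulli (d : R) k : 0 <= d <= 1 -> 1 - k%:R * d <= (1 - d) ^+ k.
Proof.
move=> /andP[d0 d1]; elim: k => [|k IH]; first by rewrite mul0r subr0 expr0.
have d1' : 0 <= 1 - d by lra.
rewrite exprS (le_trans _ (ler_wpM2l d1' IH)) // -natr1.
have : 0 <= k%:R * (d * d) by rewrite !mulr_ge0.
nra.
Qed.

(* With [k] primes in the next window, a step survives with probability [1 - k / M] and the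
   remaining count drops by at most [k]; Bernoulli's inequality makes the bound inductive. *)
Lemma surv_primes Y n x : (Y <= x + n)%N ->
  surv n x <= (1 - (M%:R)^-1) ^+ npr x (Y - x).
Proof.
have M0'' : 0 < (M%:R : R) by rewrite ltr0n.
have d01 : 0 <= (M%:R : R)^-1 <= 1 by rewrite invr_ge0 ltW //= invf_le1 // ler1n.
set rho : R := 1 - M%:R^-1.
have rho0 : 0 <= rho by rewrite /rho; case/andP: d01; lra.
have rho1 : rho <= 1 by rewrite /rho; case/andP: d01; lra.
elim: n x => [|n IH] x Yx.
  have -> : (Y - x = 0)%N by apply/eqP; rewrite subn_eq0 -(addn0 x).
  by rewrite /npr addn0 big_geq.
set c := npr x (Y - x); set k := npr x M.
have drop (i : 'I_M) : (c - k <= npr (x + i.+1) (Y - (x + i.+1)))%N.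
  rewrite leq_subLR /c /k /npr.
  have [xY|xY] := leqP (x + i.+1) Y; last first.
    have h : (Y - x <= M)%N by have := ltn_ord i; move: xY; clear; lia.
    rewrite (leq_trans _ (leq_addr _ _)) //.
    have h' : ((x + (Y - x)).+1 <= (x + M).+1)%N by rewrite ltnS leq_add2l.
    have h'' : (x.+1 <= (x + (Y - x)).+1)%N by rewrite ltnS leq_addr.
    by rewrite [leqRHS](big_cat_nat h'' h') /= leq_addr.
  have xY' : (x <= Y)%N by rewrite (leq_trans _ xY) // leq_addr.
  rewrite !subnKC //.
  have h1 : (x.+1 <= (x + i.+1).+1)%N by rewrite ltnS leq_addr.
  rewrite (big_cat_nat h1 (_ : (x + i.+1).+1 <= Y.+1)%N) //= leq_add2r.
  by rewrite [leqRHS](big_cat_nat h1 (_ : (x + i.+1).+1 <= (x + M).+1)%N) /= ?leq_addr // ltnS leq_add2l.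
apply: (@le_trans _ _ ((\sum_(i < M) (if prime (x + i.+1) then 0 else rho ^+ (c - k))) / M%:R)).
  rewrite /= ler_wpM2r ?invr_ge0 //; apply: ler_sum => i _; case: ifP => // _.
  apply: (@le_trans _ _ (rho ^+ npr (x + i.+1) (Y - (x + i.+1)))).
    by apply: IH; move: Yx; clear; lia.
  by rewrite ler_wiXn2l // drop.
rewrite sum_nonprime -/k.
apply: (@le_trans _ _ (rho ^+ k * rho ^+ (c - k))).
  by rewrite ler_wpM2r ?exprn_ge0 // bernoulli.
rewrite -exprD ler_wiXn2l //; clear; lia.
Qed.

(** Summation by parts of E(tau) = sum of P(tau > r). The boundary term is dropped in the upper
    bound and kept in the lower one, where it is small at a well-chosen [n]. *)
Lemma expected_tau_partial n :
  \sum_(1 <= r < n.+1) r%:R * pr_tau_eq R M r = \sum_(0 <= r < n) surv r 0 - n%:R * surv n 0.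
Proof.
elim: n => [|n IH]; first by rewrite !big_geq // mul0r subrr.
rewrite big_nat_recr //= IH big_nat_recr //= pr_tau_surv -natr1 -/(surv n.+1 0).
ring.
Qed.

Lemma expected_tau_le (B : R) : (forall n, \sum_(0 <= r < n) surv r 0 <= B) ->
  (expected_tau R M <= B%:E)%E.
Proof.
move=> hB; rewrite /expected_tau.
have pos r : (0 <= (r%:R * pr_tau_eq R M r)%:E)%E.
  by rewrite lee_fin mulr_ge0 // divr_ge0 // exprn_ge0.
apply: lime_le; first by apply: is_cvg_nneseries => r _ _; exact: pos.
apply: nearW => n; rewrite sumEFin lee_fin.
case: n => [|n]; first by rewrite big_geq // (le_trans _ (hB 0%N)) // big_geq.
rewrite expected_tau_partial (le_trans _ (hB n)) // lerBlDr lerDl.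
by rewrite mulr_ge0 // surv_ge0.
Qed.

Lemma expected_tau_ge n :
  ((\sum_(0 <= r < n) surv r 0 - n%:R * surv n 0)%:E <= expected_tau R M)%E.
Proof.
rewrite -expected_tau_partial -sumEFin /expected_tau.
apply: nneseries_lim_ge => r _.
by rewrite lee_fin mulr_ge0 // divr_ge0 // exprn_ge0.
Qed.

End SurvivalRecursion.

(** * Asymptotics of the expected hitting time *)

Section ExpectedHittingTime.
Context (R : realType).

Lemma geometric_sum (a : R) n : a != 1 ->
  \sum_(0 <= r < n) a ^+ r = (1 - a ^+ n) / (1 - a).
Proof.
move=> a1; have d0 : 1 - a != 0 by rewrite subr_eq0 eq_sym.
elim: n => [|n IH]; first by rewrite big_geq // expr0 subrr mul0r.
by rewrite big_nat_recr //= IH exprSr; field.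
Qed.

Lemma pow_one_sub_le (la : R) n : 1 <= la -> (1 - la^-1) ^+ n <= expR (- (n%:R / la)).
Proof.
move=> la1; have la0 : 0 < la by lra.
have a0 : 0 <= 1 - la^-1 by rewrite subr_ge0 invf_le1.
rewrite -mulrN expRM_natl lerXn2r ?nnegrE ?expR_ge0 //.
exact: (expR_ge1Dx (- la^-1)).
Qed.

(** After [r] steps the walk has passed height [r], so survival is at most exp(- pi(r) / M). With
    pi(r) >= r / (2 ln r) and M <= r^(1/4), the exponent is at least r^(3/4) / (2 ln r), which
    exceeds 2 ln r. *)
Lemma surv_tail : exists M0 : nat, forall M r : nat, (M0 <= M)%N -> (M ^ 4 <= r)%N ->
  surv R M r 0 <= pterm 2 r.
Proof.
have [n0 hn0] := many_primes R.
(* For u >= 128, e^(u/4) >= 1 + u / 4 > 32, which turns 4 u^2 <= 32 e^(u/2) into 4 u^2 <=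
   e^(3u/4). *)
have [n1 hn1] := ln_nat_unbounded (128 : R).
exists (maxn 2 (maxn n0 n1)) => M r; rewrite !geq_max => /andP[M2 /andP[Mn0 Mn1]] Mr.
have M0 : (0 < M)%N by exact: ltnW.
have Mr1 : (M <= r)%N by rewrite (leq_trans _ Mr) // -[leqLHS]expn1 leq_pexp2l.
have r0 : (0 < r)%N by rewrite (leq_trans M0).
have rp : 0 < (r%:R : R) by rewrite ltr0n.
have Mp : 0 < (M%:R : R) by rewrite ltr0n.
set u := ln (r%:R : R).
have u1 : 128 <= u by apply: hn1; exact: leq_trans Mr1.
have u0 : 0 < u by clear -u1; lra.
have rE : r%:R = expR u :> R by rewrite lnK.
have Mu : M%:R <= expR (u / 4) :> R.
  rewrite -(ler_pXn2r (n := 4)) ?nnegrE ?expR_ge0 // -expRM_natl -natrX.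
  by rewrite (_ : 4 * (u / 4) = u) -?rE ?ler_nat //; field.
have np := hn0 r (leq_trans Mn0 Mr1); rewrite -/u in np.
have M1 : 1 <= (M%:R : R) by rewrite ler1n.
apply: (le_trans (surv_primes R M0 (_ : (r <= 0 + r)%N))) => //; rewrite subn0.
apply: (le_trans (pow_one_sub_le _ M1)).
have -> : pterm 2 r = expR (- 2 * u) by rewrite /u; case: (r) r0.
rewrite ler_expR mulNr lerN2 ler_pdivlMr //.
have e4 : 2 * u * (2 * u) <= expR (3 * u / 4).
  have h2 : u ^+ 2 <= 8 * expR (u / 2).
    have := pow_le_expR_half 2 (ltW u0).
    by rewrite (_ : 2`!%:R * 2 ^+ 2 = 8 :> R) // (_ : 2`! = 2)%N // -[2 * _]exprS -natrX.
  have h3 : 32 <= expR (u / 4) by have := expR_ge1Dx (u / 4); clear -u1; lra.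
  have -> : expR (3 * u / 4) = expR (u / 2) * expR (u / 4) by rewrite -expRD; congr expR; field.
  have := ler_wpM2l (expR_ge0 (u / 2)) h3; move: h2; rewrite expr2; clear; lra.
have e5 : 2 * u * (2 * u * M%:R) <= expR u.
  have -> : expR u = expR (3 * u / 4) * expR (u / 4) by rewrite -expRD; congr expR; field.
  rewrite mulrA; apply: ler_pM => //; clear -u0; nra.
have u2 : 0 < 2 * u by clear -u0; lra.
rewrite -(ler_pM2l u2) (le_trans e5) // -rE.
exact: np.
Qed.

Lemma expected_tau_asymp : exists (C : R) (M0 : nat), forall M : nat, (M0 <= M)%N ->
  1 <= ln (ln (M%:R : R)) /\
  (((ln M%:R - C * ln (ln M%:R))%:E <= expected_tau R M)%E /\
   (expected_tau R M <= (ln M%:R + C * ln (ln M%:R))%:E)%E).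
Proof.
have [C [Ma [C1 hC]]] := prime_interval R.
have [Mb hMb] := surv_tail.
have [La [La1 hLa]] := pow_ln_le 1 (2 * C).
have [Mc hMc] := ln_nat_unbounded (64 + La).
(* In the upper bound the extra 3 collects 1 from the steps between [K] and M^4 and 2 from the tail;
   in the lower bound it covers two errors of at most 1. Each is compared with [w >= 1]. *)
exists (C + 3), (maxn 1 (maxn Ma (maxn Mb Mc))) => M.
rewrite !geq_max => /andP[M0 /andP[MMa /andP[MMb MMc]]].
have Mp : 0 < (M%:R : R) by rewrite ltr0n.
have hl := hMc M MMc; set l := ln (M%:R : R) in hl *.
have l64 : 64 <= l by clear -hl La1; lra.
have l0 : 0 < l by clear -l64; lra.
have lLa : La <= l by clear -hl; lra.
have Cw := hLa l lLa; rewrite expr1 in Cw.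
have prm x : (x + M)%:R <= 30 * M%:R * l ^+ 2 -> _ := hC M x MMa.
have l21 : 1 <= l ^+ 2 by rewrite exprn_ege1 //; clear -l64; lra.
have M30 : (0 + M)%:R <= 30 * M%:R * l ^+ 2.
  by rewrite add0n [30 * _]mulrC -mulrA ler_peMr ?(ltW Mp) //; clear -l21; lra.
have [w1 _ _] := prm 0%N M30.
set w := ln l in w1 Cw prm *.
split => //.
pose lm := l - C * w; pose lp := l + C * w.
have Cw0 : 0 <= C * w by rewrite mulr_ge0 //; clear -C1 w1; lra.
have Cwl : C * w <= l / 2 by clear -Cw C1; lra.
have lm1 : 32 <= lm by rewrite /lm; clear -Cwl l64; lra.
have lml : lm <= l by rewrite /lm; clear -Cw0; lra.
have lp1 : 32 <= lp by rewrite /lp; clear -Cw0 l64; lra.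
have lpl : lp <= 2 * l by rewrite /lp; clear -Cwl l0; lra.
(* 20 l^2 steps bring survival down to exp(-K / lp) <= M^(-10), as lp <= 2 l, while the height K M
   <= 21 M l^2 stays in the range of [prime_interval]. *)
pose K := (Num.truncn (20 * l ^+ 2)).+1.
have K1 : 20 * l ^+ 2 <= K%:R by rewrite ltW // truncnS_gt.
have K2 : K%:R <= 21 * l ^+ 2.
  have -> : K%:R = (Num.truncn (20 * l ^+ 2))%:R + 1 :> R by rewrite natr1.
  have : (Num.truncn (20 * l ^+ 2))%:R <= 20 * l ^+ 2 by rewrite truncn_le // mulr_ge0 // sqr_ge0.
  by clear -l21; lra.
pose Y := (K * M)%N.
have hz z : (z + M <= Y)%N -> (z + M)%:R <= 30 * M%:R * l ^+ 2.
  rewrite -(ler_nat R) => h; rewrite (le_trans h) // /Y natrM mulrC -[30 * _]mulrC -mulrA.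
  by rewrite ler_pM2l //; clear -K2 l21; lra.
have lower n : (n <= K)%N -> (1 - lm^-1) ^+ n <= surv R M n 0.
  move=> nK; apply: (surv_lower M0 (Y := Y)); [clear -lm1; lra| |by rewrite add0n leq_mul2r nK orbT].
  by move=> z /hz /prm [_ _]; rewrite -/lm.
have upper n : (n <= K)%N -> surv R M n 0 <= (1 - lp^-1) ^+ n.
  move=> nK; apply: (surv_upper M0 (Y := Y)); [clear -lp1; lra| |by rewrite add0n leq_mul2r nK orbT].
  by move=> z /hz /prm [_ + _]; rewrite -/lp.
have lp0 : 0 < lp by clear -lp1; lra.
have lm0 : 0 < lm by clear -lm1; lra.
have sK : surv R M K 0 <= expR (- (10 * l)).
  rewrite (le_trans (upper K (leqnn K))) // (le_trans (pow_one_sub_le _ _)) //; first by clear -lp1; lra.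
  rewrite ler_expR lerN2 ler_pdivlMr // (le_trans _ K1) //.
  have := ler_wpM2l (_ : 0 <= 10 * l) lpl; rewrite expr2; move=> /(_ ltac:(clear -l0; lra)).
  by clear; lra.
have ME : M%:R = expR l by rewrite lnK.
split.
- apply: (le_trans _ (expected_tau_ge R M0 K)); rewrite lee_fin.
  have aK : (1 - lm^-1) ^+ K <= expR (- (20 * l)).
    rewrite (le_trans (pow_one_sub_le _ _)) //; first by clear -lm1; lra.
    rewrite ler_expR lerN2 ler_pdivlMr // (le_trans _ K1) // expr2.
    by rewrite -mulrA ler_pM2l // ler_pM2l.
  have S : lm * (1 - (1 - lm^-1) ^+ K) <= \sum_(0 <= r < K) surv R M r 0.
    rewrite (_ : lm * _ = \sum_(0 <= r < K) (1 - lm^-1) ^+ r).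
      by rewrite big_nat [leRHS]big_nat; apply: ler_sum => r /andP[_ rK]; apply: lower; exact: ltnW.
    rewrite geometric_sum; last by rewrite -subr_eq0 addrAC subrr add0r oppr_eq0 invr_eq0 gt_eqF.
    by rewrite subKr invrK mulrC.
  have e1 : lm * (1 - lm^-1) ^+ K <= 1.
    rewrite (le_trans (ler_wpM2l (ltW lm0) aK)) // expRN ler_pdivrMr ?expR_gt0 // mul1r.
    by have := expR_ge1Dx (20 * l); clear -lml l0; lra.
  have e2 : K%:R * surv R M K 0 <= 1.
    rewrite (le_trans (ler_wpM2l (ler0n _ _) sK)) // expRN ler_pdivrMr ?expR_gt0 // mul1r.
    rewrite (le_trans K2) // (_ : 10 * l = l + 9 * l); last by ring.
    have h2 : l ^+ 2 <= 2 * expR l.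
      have h1 : 0 < 1 :> R by [].
      have := pow_le_expR 2 h1 (ltW l0); rewrite expr1n divr1 mul1r.
      by rewrite (_ : 2`!%:R = 2 :> R).
    rewrite expRD; have h9 : 42 <= expR (9 * l) by have := expR_ge1Dx (9 * l); clear -l64; lra.
    have := ler_wpM2l (expR_ge0 l) h9; clear -h2; lra.
  rewrite mulrBr mulr1 in S.
  move: S e1 e2 w1; rewrite [(C + 3) * w]mulrDl.
  have -> : l - (C * w + 3 * w) = lm - 3 * w by rewrite opprD addrA.
  move: (lm * _) (K%:R * _) (\sum_(0 <= r < K) _) => x y z; clear; lra.
apply: expected_tau_le => // n.
have s0 r : 0 <= surv R M r 0 by exact: surv_ge0.
pose N := maxn n (maxn K (M ^ 4)).
have nN : (n <= N)%N by rewrite leq_max leqnn.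
apply: (@le_trans _ _ (\sum_(0 <= r < N) surv R M r 0)).
  by rewrite (big_cat_nat (leq0n _) nN) /= lerDl sumr_ge0.
(* The geometric part sums to at most [lp]; the M^4 terms of size M^(-10) to at most 1; the terms
   r^(-2), valid from M^4 on, to at most 2. *)
pose v r : R := (if (r < K)%N then (1 - lp^-1) ^+ r else 0)
  + (if (0 <= r < M ^ 4)%N then 1 else 0) * expR (- (10 * l)) + pterm (1 + 1) r.
have a0 : 0 <= 1 - lp^-1 by rewrite subr_ge0 invf_le1 //; clear -lp1; lra.
have sv r : surv R M r 0 <= v r.
  have p0 := pterm_ge0 (1 + 1) r : 0 <= pterm (1 + 1) r :> R.
  have e0 := expR_ge0 (- (10 * l)).
  have q0 : 0 <= (if (0 <= r < M ^ 4)%N then 1 else 0) * expR (- (10 * l)) by case: ifP; rewrite ?mul1r ?mul0r.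
  rewrite /v; case: ltnP => rK.
    rewrite (le_trans (upper r (ltnW rK))) // -addrA lerDl addr_ge0 //.
  rewrite add0r; case: ltnP => r4 /=.
    by rewrite (le_trans (surv_noninc R M0 rK)) // (le_trans sK) // mul1r lerDl.
  by rewrite mul0r add0r (le_trans (hMb M r MMb r4)).
apply: (le_trans (ler_sum _ (fun r _ => sv r))).
rewrite !big_split /= -mulr_suml.
have t1 : \sum_(0 <= r < N) (if (r < K)%N then (1 - lp^-1) ^+ r else 0) <= lp.
  have KN : (K <= N)%N by rewrite /N !leq_max leqnn orbT.
  rewrite (big_cat_nat (leq0n _) KN) /= [X in _ + X]big_nat [X in _ + X]big1 ?addr0; last first.
    by move=> r /andP[Kr _]; rewrite ltnNge Kr.
  rewrite (eq_big_nat _ _ (F2 := fun r => (1 - lp^-1) ^+ r)); last by move=> r /andP[_ ->].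
  rewrite geometric_sum; last by rewrite -subr_eq0 addrAC subrr add0r oppr_eq0 invr_eq0 gt_eqF.
  rewrite subKr invrK ler_piMl ?(ltW lp0) // lerBlDr lerDl exprn_ge0 //.
have t2 : (\sum_(0 <= r < N) (if (0 <= r < M ^ 4)%N then 1 else 0)) * expR (- (10 * l)) <= 1.
  have := count_interval R N 0 (M ^ 4); rewrite subn0 natrX ME -expRM_natl => h.
  rewrite (le_trans (ler_wpM2r (expR_ge0 _) h)) // -expRD expR_le1; clear -l0; lra.
have t3 : \sum_(0 <= r < N) pterm (1 + 1) r <= 2 :> R.
  have h1 : 0 < 1 :> R by [].
  by have := sum_pterm N h1; rewrite invr1.
rewrite /lp in t1; move: t1 t2 t3 w1; clear; lra.
Qed.

End ExpectedHittingTime.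

Theorem theorem1 (R : realType) :
  exists (C : R) (M0 : nat), forall M : nat, (2 <= M)%N -> (M0 <= M)%N ->
    (`| expected_tau R M - (ln (M%:R : R))%:E |
       <= (C * ln (ln (M%:R : R)))%:E)%E.
Proof.
have [C [M0 hM]] := expected_tau_asymp R.
exists C, M0 => M _ MM; have [_ [h1 h2]] := hM M MM.
have fin : expected_tau R M \is a fin_num.
  by rewrite fin_numElt (lt_le_trans _ h1) ?ltNyr // (le_lt_trans h2) ?ltry.
move: h1 h2; rewrite -(fineK fin) !lee_fin => h1 h2.
by rewrite ler_norml; apply/andP; split; lra.
Qed.
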